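(* Let $L$ be a closed connected manifold and $\theta:L\to S^1=\mathbb R/2\pi\mathbb Z$ a Morse map with $\theta_*(H_1(L))=H_1(S^1)=\mathbb Z$. Then for every $k$ the Pitcher number $Q_k$ of $\theta$ equals the Novikov Betti number $\widehat b_k(L,[\theta])$.
   Context: Let $K\to L$ be the infinite cyclic covering induced by $\theta$ from $\mathbb R\to S^1$, and $F^*:K\to\mathbb R$ a Morse function lifting $\theta$. Let $T$ be the generator of the deck group with $F^*(Tx)=F^*(x)+2\pi$, and $t=T^{-1}$. Choose a regular value $A$ of $F^*$, let $B=A+2\pi$ and $V^-=(F^* )^{-1}(]-\infty,B])$, so that $tV^-=(F^* )^{-1}(]-\infty,A])\subset V^-$. With rational coefficients, put $R_k=\dim_{\mathbb Q} H_k(V^-)/tH_k(V^-)$ and $S_k=\dim_{\mathbb Q}\mathrm{Ker}\big(t:H_k(V^-)\to H_k(V^-)\big)$. The Pitcher number is $Q_k=R_k-S_k$. The Novikov Betti number $\widehat b_k(L,[\theta])$ is the rank over the principal ideal domain $\mathbb Z((t))=\mathbb Z[[t]][t^{-1}]$ of the homology in degree $k$ of the chain complex $\mathcal S_*(K)\otimes_{\mathbb Z[t,t^{-1}]}\mathbb Z((t))$, where $\mathcal S_*(K)$ is the singular chain complex of $K$. *)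

(* Defs.v *)
From HB Require Import structures.
From mathcomp Require Import all_boot all_order all_algebra.
From mathcomp Require Import ring_quotient generic_quotient.
From mathcomp Require Import all_classical all_reals all_analysis.
From mathcomp.multinomials Require Import freeg.
From mathcomp Require Import zify lra.
Set Implicit Arguments.
Unset Strict Implicit.
Unset Printing Implicit Defensive.
Import Order.TTheory GRing.Theory Num.Theory.
Import numFieldNormedType.Exports.
Local Open Scope classical_set_scope.
Local Open Scope ring_scope.

Section Laurent.

Definition bounded_below (f : int -> int) : Prop :=
  exists N : int, forall i, i < N -> f i = 0.

Definition laurent_pred : {pred int -> int} := fun f => `[< bounded_below f >].

Lemma laurent_zmod_closed : zmod_closed laurent_pred.
Proof.
split=> [|f g /asboolP[N fN] /asboolP[M gM]]; apply/asboolP; first by exists 0.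
exists (Num.min N M) => i; rewrite lt_min => /andP[iN iM].
by rewrite !fctE fN// gM// subr0.
Qed.
HB.instance Definition _ := GRing.isZmodClosed.Build (int -> int) laurent_pred
  laurent_zmod_closed.

(* [Z((t))]: the coefficient families [int -> int] vanishing far to the left *)
Record laurent := Laurent { coefl :> int -> int; _ : coefl \in laurent_pred }.
HB.instance Definition _ := [isSub for coefl].
HB.instance Definition _ := [Choice of laurent by <:].
HB.instance Definition _ := [SubChoice_isSubZmodule of laurent by <:].

Definition conv (f g : int -> int) : int -> int :=
  fun n => \sum_(i \in [set: int]) f i * g (n - i).

Lemma finite_zint (a b : int) : finite_set [set i : int | a <= i <= b].
Proof.
apply: (sub_finite_set (B := (fun j : nat => a + j%:Z) @` `I_(`|b - a|.+1))).
  move=> i /= /andP[ai ib]; exists `|i - a|%N; first by rewrite /=; lia.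
  lia.
exact/finite_image/finite_II.
Qed.

Lemma fsum_zint (a b : int) (F : int -> int) :
  (forall i, ~~ (a <= i <= b) -> F i = 0) ->
  \sum_(i \in [set: int]) F i = \sum_(i \in [set i : int | a <= i <= b]) F i.
Proof.
by move=> F0; apply/esym/fsbig_widen => // i [_ /= /negP /F0 ->].
Qed.

Lemma reindex_subl n (F : int -> int) :
  \sum_(i \in [set: int]) F i = \sum_(i \in [set: int]) F (n - i).
Proof.
by apply: reindex_fsbigT; exists (fun i => n - i) => i; rewrite opprB addrCA subrr addr0.
Qed.

Lemma reindex_subr n (F : int -> int) :
  \sum_(i \in [set: int]) F i = \sum_(i \in [set: int]) F (i - n).
Proof.
by apply: reindex_fsbigT; exists (fun i => i + n) => i; rewrite ?addrK ?subrK.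
Qed.

Lemma conv_bounded (f g : laurent) : conv f g \in laurent_pred.
Proof.
case: f g => [f /= /asboolP[N fN]] [g /= /asboolP[M gM]].
apply/asboolP; exists (N + M) => n nNM; apply: fsbig1 => i _.
case: (ltP i N) => iN; first by rewrite fN// mul0r.
by rewrite gM ?mulr0//; lia.
Qed.

Definition laurent_mul (f g : laurent) : laurent := Laurent (conv_bounded f g).

Lemma laurent_one_bounded : (fun i : int => (i == 0)%:R : int) \in laurent_pred.
Proof. by apply/asboolP; exists 0 => i; case: eqP => // ->. Qed.

Definition laurent_one : laurent := Laurent laurent_one_bounded.

Lemma laurent_mulC : commutative laurent_mul.
Proof.
move=> f g; apply: val_inj; apply/funext => n /=; rewrite /conv (reindex_subl n).
by apply: eq_fsbigr => i _; rewrite opprB addrCA subrr addr0 mulrC.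
Qed.

Lemma laurent_mul1 : left_id laurent_one laurent_mul.
Proof.
move=> f; apply: val_inj; apply/funext => n /=; rewrite /conv.
rewrite (fsum_zint (a := 0) (b := 0)) => [|i i0]; last by case: eqP i0 => [->|_ _]; rewrite ?mul0r.
rewrite (_ : [set _ | _] = [set 0]); first by rewrite fsbig_set1 eqxx mul1r subr0.
by apply/seteqP; split=> i /=; [lia|move=> ->].
Qed.

Lemma laurent_mulDl : left_distributive laurent_mul +%R.
Proof.
move=> [f /= fL] [g /= gL] [h /= hL]; apply: val_inj; apply/funext => n /=.
rewrite /conv !fctE.
have [[N fN] [M gM] [P hP]] : [/\ bounded_below f, bounded_below g & bounded_below h].
  by split; apply/asboolP.
pose a := Num.min N M.
have H (F : int -> int) : (forall i, i < a -> F i = 0) ->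
    forall i, ~~ (a <= i <= n - P) -> F i * h (n - i) = 0.
  move=> Fa i; rewrite negb_and -!ltNge => /orP[/Fa->|ni]; first by rewrite mul0r.
  by rewrite hP ?mulr0//; lia.
have fa i : i < a -> f i = 0 by rewrite /a => ?; apply: fN; lia.
have ga i : i < a -> g i = 0 by rewrite /a => ?; apply: gM; lia.
rewrite (fsum_zint (H _ fa)) (fsum_zint (H _ ga)).
rewrite (fsum_zint (a := a) (b := n - P)); last first.
  by move=> i /(H (fun i => f i + g i)) -> // j ja; rewrite fa// ga// addr0.
rewrite -fsbig_split; last exact: finite_zint.
by apply: eq_fsbigr => i _; rewrite mulrDl.
Qed.

Lemma laurent_mulA : associative laurent_mul.
Proof.
move=> [f /= fL] [g /= gL] [h /= hL]; apply: val_inj; apply/funext => n /=.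
rewrite /conv.
have [[N fN] [M gM] [P hP]] : [/\ bounded_below f, bounded_below g & bounded_below h].
  by split; apply/asboolP.
transitivity (\sum_(i \in [set: int]) \sum_(k \in [set: int])
    f i * (g (k - i) * h (n - k))).
  apply: eq_fsbigr => i _; rewrite -mulr_fsumr (reindex_subr i); congr (_ * _).
  by apply: eq_fsbigr => k _; congr (_ * h _); rewrite opprB addrA subrK.
transitivity (\sum_(k \in [set: int]) \sum_(i \in [set: int])
    f i * (g (k - i) * h (n - k))); last first.
  apply: eq_fsbigr => k _; rewrite mulr_fsuml.
  by apply: eq_fsbigr => i _; rewrite mulrA.
pose D i k := f i * (g (k - i) * h (n - k)).
have D0 i k : ~~ ((N <= i <= n - P - M) && (N + M <= k <= n - P)) -> D i k = 0.
  rewrite /D => H; case: (ltP i N) => iN; first by rewrite fN// mul0r.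
  case: (ltP (k - i) M) => kM; first by rewrite gM// mul0r mulr0.
  by rewrite (hP (n - k)) ?mulr0//; lia.
have Di i : ~~ (N <= i <= n - P - M) ->
    \sum_(k \in [set: int]) D i k = 0.
  by move=> Hi; apply: fsbig1 => k _; apply: D0; rewrite (negbTE Hi).
have Dk k : ~~ (N + M <= k <= n - P) ->
    \sum_(i \in [set: int]) D i k = 0.
  by move=> Hi; apply: fsbig1 => i _; apply: D0; rewrite (negbTE Hi) andbF.
rewrite (fsum_zint Di) (fsum_zint Dk).
under eq_fsbigr => i _.
  rewrite (@fsum_zint (N + M) (n - P)); last by
    move=> k Hk; apply: D0; rewrite (negbTE Hk) andbF.
  over.
under [RHS]eq_fsbigr => k _.
  rewrite (@fsum_zint N (n - P - M)); last by
    move=> i Hi; apply: D0; rewrite (negbTE Hi).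
  over.
by apply: exchange_fsbig; exact: finite_zint.
Qed.

Lemma laurent_oner_neq0 : laurent_one != 0.
Proof. by apply/eqP => /(congr1 (fun f : laurent => f 0)). Qed.

HB.instance Definition _ := GRing.Zmodule_isComNzRing.Build laurent
  laurent_mulA laurent_mulC laurent_mul1 laurent_mulDl laurent_oner_neq0.

End Laurent.

Section Span.
Variables (R : nzRingType) (M : lmodType R).

Definition submodule (P : set M) : Prop :=
  P 0 /\ forall a x y, P x -> P y -> P (a *: x + y).

Definition span (N : set M) : {pred M} :=
  fun x => `[< forall P : set M, submodule P -> N `<=` P -> P x >].

Lemma span_submod_closed N : submod_closed (span N).
Proof.
split=> [|a x y /asboolP xN /asboolP yN]; apply/asboolP => P subP NP.
  exact: subP.1.
by apply: subP.2; [exact: xN|exact: yN].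
Qed.
HB.instance Definition _ N := GRing.isSubmodClosed.Build R M (span N)
  (span_submod_closed N).

Lemma sub_span N : N `<=` [set x | x \in span N].
Proof. by move=> x Nx; apply/asboolP => P _; exact. Qed.

Lemma span_min N (P : set M) : submodule P -> N `<=` P ->
  [set x | x \in span N] `<=` P.
Proof. by move=> sP NP x /asboolP; exact. Qed.

Definition quotmod (N : set M) : Type := Quotient.quot (span N).

HB.instance Definition _ N := EqQuotient.on (quotmod N).
HB.instance Definition _ N := GRing.Zmodule.on (quotmod N).

Definition quot_proj (N : set M) : M -> quotmod N := \pi_(quotmod N)%qT.

Lemma quot_proj_eq N x y :
  quot_proj N x = quot_proj N y <-> x - y \in span N.
Proof.
rewrite /quot_proj -[X in _ <-> is_true X]/(Quotient.equiv _ x y).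
by split=> [/eqquotP|H]; [|exact/eqquotP].
Qed.

Lemma quot_projD N : {morph quot_proj N : x y / x + y}.
Proof. exact: Quotient.pi_add. Qed.

Definition quot_scale N (a : R) (q : quotmod N) : quotmod N :=
  quot_proj N (a *: repr q).

Lemma quot_reprK N (q : quotmod N) : quot_proj N (repr q) = q.
Proof. exact: reprK. Qed.

Lemma quot_projZ N a x : quot_proj N (a *: x) = quot_scale a (quot_proj N x).
Proof.
apply/quot_proj_eq; rewrite -scalerBr; apply: rpredZ.
by apply/quot_proj_eq; rewrite quot_reprK.
Qed.

Lemma quot_scaleA N a b (q : quotmod N) :
  quot_scale a (quot_scale b q) = quot_scale (a * b) q.
Proof. by rewrite -[q]quot_reprK -!quot_projZ scalerA. Qed.
Lemma quot_scale1 N : left_id 1 (@quot_scale N).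
Proof. by move=> q; rewrite -[q]quot_reprK -!quot_projZ scale1r. Qed.
Lemma quot_scaleDr N : right_distributive (@quot_scale N) +%R.
Proof.
move=> a q r; rewrite -[q]quot_reprK -[r]quot_reprK.
by rewrite -!quot_projZ -!quot_projD -quot_projZ scalerDr.
Qed.
Lemma quot_scaleDl N (q : quotmod N) :
  {morph (@quot_scale N)^~ q : a b / a + b}.
Proof.
move=> a b; rewrite -[q]quot_reprK -!quot_projZ -!quot_projD.
by rewrite scalerDl.
Qed.
HB.instance Definition _ N := GRing.Zmodule_isLmodule.Build R (quotmod N)
  (@quot_scaleA N) (@quot_scale1 N) (@quot_scaleDr N) (@quot_scaleDl N).

Lemma quot_proj_linear N : linear (quot_proj N).
Proof. by move=> a x y; rewrite quot_projD quot_projZ. Qed.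
HB.instance Definition _ N :=
  GRing.isLinear.Build R M (quotmod N) _ (quot_proj N) (quot_proj_linear N).

End Span.

Section QuotMap.
Variables (R : nzRingType) (M M' : lmodType R) (f : {linear M -> M'}).
Variables (N : set M) (N' : set M').
Hypothesis fN : forall x, N x -> f x \in span N'.

Definition quot_map of (forall x, N x -> f x \in span N') :
  quotmod N -> quotmod N' := fun q => quot_proj N' (f (repr q)).

Lemma quot_mapE x : quot_map fN (quot_proj N x) = quot_proj N' (f x).
Proof.
apply/quot_proj_eq; rewrite -linearB.
have /quot_proj_eq := quot_reprK (quot_proj N x).
move: (_ - x); apply: span_min => //; split=> [|a u v /= uN vN].
  by rewrite /= linear0 rpred0.
by rewrite linearP rpredD ?rpredZ.
Qed.

Lemma quot_map_linear : linear (quot_map fN).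
Proof.
move=> a q r; rewrite -[q]quot_reprK -[r]quot_reprK -linearP !quot_mapE.
by rewrite !linearP.
Qed.
HB.instance Definition _ := GRing.isLinear.Build R (quotmod N) (quotmod N') _
  (quot_map fN) quot_map_linear.
End QuotMap.

Section Kernel.
Variables (R : nzRingType) (M M' : lmodType R) (f : {linear M -> M'}).

Definition ker_pred : {pred M} := fun x => f x == 0.
Lemma ker_submod_closed : submod_closed ker_pred.
Proof.
split=> [|a x y /eqP fx /eqP fy]; apply/eqP; first exact: linear0.
by rewrite linearP fx fy scaler0 addr0.
Qed.
HB.instance Definition _ := GRing.isSubmodClosed.Build R M ker_pred
  ker_submod_closed.

Record kermod := KerMod { ker_val : M; ker_valP : ker_val \in ker_pred }.
HB.instance Definition _ := [isSub for ker_val].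
HB.instance Definition _ := [Choice of kermod by <:].
HB.instance Definition _ := [SubChoice_isSubLmodule of kermod by <:].
End Kernel.

Section KerMap.
Variables (R : nzRingType) (A A' B B' : lmodType R).
Variables (f : {linear A -> B}) (f' : {linear A' -> B'}).
Variables (g : {linear A -> A'}) (h : {linear B -> B'}).
Hypothesis comm : forall x, f' (g x) = h (f x).

Lemma ker_map_subproof (x : kermod f) : g (ker_val x) \in ker_pred f'.
Proof. by case: x => x /= /eqP fx; apply/eqP; rewrite comm fx linear0. Qed.

Definition ker_map (x : kermod f) : kermod f' := KerMod (ker_map_subproof x).

Lemma ker_map_linear : linear ker_map.
Proof. by move=> a x y; apply: val_inj; rewrite /= linearP. Qed.
HB.instance Definition _ := GRing.isLinear.Build R (kermod f) (kermod f') _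
  ker_map ker_map_linear.
End KerMap.

(* The maximal number of linearly independent elements of [M] is [r]: the
   dimension over a field, the rank over an integral domain. *)
Definition has_rank (R : nzRingType) (M : lmodType R) (r : nat) : Prop :=
  let indep n (v : 'I_n -> M) :=
    forall a : 'I_n -> R, \sum_i a i *: v i = 0 -> forall i, a i = 0 in
  (exists v : 'I_r -> M, indep r v) /\
  ~ (exists v : 'I_r.+1 -> M, indep r.+1 v).

(* ker e / im d for A -d-> B -e-> C *)
Definition homology (R : nzRingType) (A B C : lmodType R)
    (d : {linear A -> B}) (e : {linear B -> C}) : lmodType R :=
  quotmod (M := kermod e) [set z | exists x, ker_val z = d x].

Section HomologyMap.
Variables (R : nzRingType) (A B C A' B' C' : lmodType R).
Variables (d : {linear A -> B}) (e : {linear B -> C}).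
Variables (d' : {linear A' -> B'}) (e' : {linear B' -> C'}).
Variables (f : {linear A -> A'}) (g : {linear B -> B'}) (h : {linear C -> C'}).
Hypothesis (gd : forall x, d' (f x) = g (d x)).
Hypothesis (he : forall x, e' (g x) = h (e x)).

Lemma homology_map_subproof (z : kermod e) :
  [set z | exists x, ker_val z = d x] z ->
  ker_map he z \in span [set z | exists x, ker_val z = d' x].
Proof.
by case=> x zx; apply: sub_span; exists (f x); rewrite /= zx gd.
Qed.

Definition homology_map : {linear homology d e -> homology d' e'} :=
  quot_map homology_map_subproof.
End HomologyMap.

Section FreegLift.
Variables (R : nzRingType) (K : choiceType) (M : lmodType R) (f : K -> M).

Definition flift : {freeg K / R} -> M := fglift f.

Lemma flift_linear : linear flift.
Proof.
have fB := lift_is_additive f.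
have f0 : flift 0 = 0 by rewrite -(subrr 0) /flift fB subrr.
have fN x : flift (- x) = - flift x by rewrite -sub0r /flift fB -/flift f0 sub0r.
have fD x y : flift (x + y) = flift x + flift y.
  by rewrite -{1}[y]opprK /flift fB -/(flift (- y)) fN opprK.
move=> a x y; rewrite fD; congr (_ + _).
have fS (I : Type) (s : seq I) (F : I -> {freeg K / R}) :
    flift (\sum_(i <- s) F i) = \sum_(i <- s) flift (F i).
  by apply: big_morph.
rewrite -{1 2}[x]freeg_sumE scaler_sumr !fS scaler_sumr; apply: eq_bigr => z _.
have -> : a *: << coeff z x *g z >> = << a * coeff z x *g z >> :> {freeg K / R}.
  by apply/eqP/freeg_eqP => w; rewrite coeffZ !coeffU mulrA.
by rewrite /flift !liftU scalerA.
Qed.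
HB.instance Definition _ := GRing.isLinear.Build R {freeg K / R} M _
  flift flift_linear.

Lemma fliftU x : flift << x >> = f x.
Proof. by rewrite /flift liftU scale1r. Qed.
End FreegLift.

Lemma flift_ext (R : nzRingType) (K : choiceType) (M : lmodType R)
  (f g : {linear {freeg K / R} -> M}) :
  (forall x, f << x >> = g << x >>) -> f =1 g.
Proof.
move=> fg c; rewrite -[c]freeg_sumE !linear_sum; apply: eq_bigr => z _.
have -> : << coeff z c *g z >> = coeff z c *: << z >> :> {freeg K / R}.
  by apply/eqP/freeg_eqP => y; rewrite coeffZ !coeffU mul1r.
by rewrite !linearZ fg.
Qed.

Section Simplex.
Variable R : realType.

Definition std_simplex (m : nat) : set 'rV[R]_m.+1 :=
  [set x | (forall i, 0 <= x ord0 i) /\ \sum_i x ord0 i = 1].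

Arguments std_simplex m : clear implicits.

(* the affine inclusion of the face opposite to vertex [i] *)
Definition coface_mx m (i : 'I_m.+2) (x : 'rV[R]_m.+1) : 'rV[R]_m.+2 :=
  \row_j if unlift i j is Some j' then x ord0 j' else 0.

Lemma coface_mx_simplex m (i : 'I_m.+2) (x : std_simplex m) :
  coface_mx i (set_val x) \in std_simplex m.+1.
Proof.
have [x0 x1] : std_simplex m (set_val x) by exact: (set_valP x).
move: (set_val x) x0 x1 => {}x x0 x1; apply/mem_set; split=> [j|].
  by rewrite mxE; case: unliftP => [j' _|_].
rewrite (bigD1_ord i)//= mxE unlift_none add0r -[RHS]x1.
by apply: eq_bigr => j _; rewrite mxE liftK.
Qed.

Definition coface_fun m (i : 'I_m.+2) (x : std_simplex m) : std_simplex m.+1 :=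
  SigSub (coface_mx_simplex i x).

Lemma coface_continuous m (i : 'I_m.+2) : continuous (@coface_fun m i).
Proof.
apply: (@continuous_comp_initial _ _ _ set_val).
move=> x; apply: (@continuous_comp _ _ _ (set_val) (coface_mx i)).
  exact: initial_continuous.
move=> A [/= B Bn BA].
pose C (k : 'I_1) (j : 'I_m.+1) : set R := B ord0 (fintype.lift i j).
exists C => [k j|y /= Cy]; first by rewrite (ord1 k); have := Bn ord0 (fintype.lift i j); rewrite mxE liftK.
apply: BA => k j; rewrite ord1 mxE; case: unliftP => [j' ->|->].
  exact: Cy.
by have := Bn ord0 i; rewrite mxE unlift_none; exact: nbhs_singleton.
Qed.
HB.instance Definition _ m (i : 'I_m.+2) :=
  isContinuous.Build _ _ (@coface_fun m i) (@coface_continuous m i).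

Definition coface m (i : 'I_m.+2) :
  continuousType (std_simplex m) (std_simplex m.+1) := @coface_fun m i.

End Simplex.
Arguments std_simplex R m : clear implicits.

Section Singular.
Variables (R : realType) (F : nzRingType).

Definition singular (X : topologicalType) (m : nat) : choiceType :=
  continuousType (std_simplex R m) X.

Definition chain (X : topologicalType) (m : nat) : lmodType F :=
  {freeg (singular X m) / F}.

(* The target in degree [0] is a dummy [chain X 0], on which the boundary is
   zero, so that [kermod (bd X 0)] is the whole of [chain X 0]. *)
Definition bd_simplex X m : singular X m -> chain X m.-1 :=
  match m with
  | 0 => fun=> 0
  | m'.+1 => fun s : singular X m'.+1 =>
      \sum_(i < m'.+2) (-1) ^+ i *: << (s \o coface R i : singular X m') >>
  end.

Definition bd X m : {linear chain X m -> chain X m.-1} := flift (@bd_simplex X m).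

Definition chain_map (X Y : topologicalType) (f : continuousType X Y) m :
  {linear chain X m -> chain Y m} :=
  flift (fun s : singular X m => << (f \o s : singular Y m) >> : chain Y m).

Lemma bdU X m (s : singular X m) : bd X m << s >> = bd_simplex s.
Proof. exact: fliftU. Qed.

Lemma chain_mapU (X Y : topologicalType) (f : continuousType X Y) m
    (s : singular X m) :
  chain_map f m << s >> = << (f \o s : singular Y m) >>.
Proof. exact: fliftU. Qed.

Lemma bd_chain_map (X Y : topologicalType) (f : continuousType X Y) m (c : chain X m) :
  bd Y m (chain_map f m c) = chain_map f m.-1 (bd X m c).
Proof.
apply: (@flift_ext _ _ _ (bd Y m \o chain_map f m) (chain_map f m.-1 \o bd X m)).
move=> s /=; rewrite chain_mapU !bdU; case: m s {c} => [|m] s /=; first by rewrite linear0.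
rewrite linear_sum; apply: eq_bigr => i _; rewrite linearZ/= chain_mapU.
by congr (_ *: << _ >>); apply/continuousEP.
Qed.

Definition singular_homology (X : topologicalType) (m : nat) : lmodType F :=
  homology (bd X m.+1) (bd X m).

Definition homology_push (X Y : topologicalType) (f : continuousType X Y) (m : nat) :
  {linear singular_homology X m -> singular_homology Y m} :=
  homology_map (bd_chain_map f (m := m.+1)) (bd_chain_map f (m := m)).

End Singular.

Section Circle.
Variable R : realType.

Definition circle_rel : rel R :=
  fun x y => `[< exists m : int, x - y = 2 * pi * m%:~R >].

Lemma circle_rel_class : equiv_class_of circle_rel.
Proof.
split=> [x|x y|y x z].
- by apply/asboolP; exists 0; rewrite subrr mulr0.
- by apply/asboolP/asboolP => -[m xy]; exists (- m);
    rewrite mulrNz mulrN -xy opprB.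
- move=> /asboolP[m xy] /asboolP[p yz]; apply/asboolP; exists (m + p).
  by rewrite intrD mulrDr -xy -yz addrA subrK.
Qed.
Canonical circle_equiv := EquivRelPack circle_rel_class.

Definition circle : topologicalType := quotient_topology {eq_quot circle_rel}%qT.
Definition to_circle (x : R) : circle := (\pi_({eq_quot circle_rel}) x)%qT.

Lemma to_circleP x y :
  to_circle x = to_circle y <-> exists m : int, x - y = 2 * pi * m%:~R.
Proof.
split=> [/eqquotP/asboolP//|H]; apply/eqquotP/asboolP; exact: H.
Qed.

End Circle.
Arguments to_circle {R} x.

Section Smooth.
Variables (R : realType) (n : nat).
Implicit Types (U : set 'rV[R]_n) (f : 'rV[R]_n -> R).

Definition partial f (i : 'I_n) : 'rV[R]_n -> R :=
  fun x => 'D_(delta_mx 0 i) f x.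

(* [U] is meant to be open: only the germs of [f] at points of [U] matter *)
Fixpoint Ck_on (k : nat) U f : Prop :=
  {in U, continuous f} /\
  match k with
  | 0 => True
  | k'.+1 => forall i, (forall x, U x -> derivable f x (delta_mx 0 i)) /\
                       Ck_on k' U (partial f i)
  end.

Definition smooth_on U f : Prop := forall k, Ck_on k U f.

Definition hessian f (x : 'rV[R]_n) : 'M[R]_n :=
  \matrix_(i, j) partial (partial f j) i x.

(* [chart_coord] is meaningful on [chart_dom] only, and [chart_param], its
   inverse, on the image of [chart_dom] only; see [is_chart] *)
Record chart (X : Type) := Chart {
  chart_dom : set X;
  chart_coord : X -> 'rV[R]_n;
  chart_param : 'rV[R]_n -> X }.

Variable X : topologicalType.
Implicit Types (c : chart X) (atl : set (chart X)).

Definition is_chart c : Prop :=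
  [/\ open (chart_dom c), open (chart_coord c @` chart_dom c),
      {within chart_dom c, continuous (chart_coord c)},
      {within chart_coord c @` chart_dom c, continuous (chart_param c)} &
      {in chart_dom c, cancel (chart_coord c) (chart_param c)}].

Definition smooth_atlas atl : Prop :=
  [/\ forall c, atl c -> is_chart c,
      forall x, exists2 c, atl c & chart_dom c x &
      forall c c', atl c -> atl c' -> forall i,
        smooth_on (chart_coord c @` (chart_dom c `&` chart_dom c'))
          (fun u => chart_coord c' (chart_param c u) 0 i)].

Definition closed_connected_manifold atl : Prop :=
  [/\ hausdorff_space X, compact [set: X], connected [set: X] &
      smooth_atlas atl].

Definition critical_in c (g : X -> R) (x : X) : Prop :=
  forall i, partial (g \o chart_param c) i (chart_coord c x) = 0.

Definition critical_point atl (g : X -> R) (x : X) : Prop :=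
  forall c, atl c -> chart_dom c x -> critical_in c g x.

Definition regular_value atl (g : X -> R) (a : R) : Prop :=
  forall x, g x = a -> ~ critical_point atl g x.

Definition morse_on atl (W : set X) (g : X -> R) : Prop :=
  forall c, atl c ->
    smooth_on (chart_coord c @` (W `&` chart_dom c)) (g \o chart_param c) /\
    forall x, W x -> chart_dom c x -> critical_in c g x ->
      \det (hessian (g \o chart_param c) (chart_coord c x)) != 0.

(* A map to R / 2 pi Z is Morse when its local lifts to R are Morse functions *)
Definition circle_morse atl (theta : X -> circle R) : Prop :=
  forall x, exists W : set X, exists g : X -> R,
    [/\ open W, W x, {in W, forall y, theta y = to_circle (g y)} &
        morse_on atl W g].

End Smooth.

(* The smooth structure on [Y] making a covering [p : Y -> X] a local
   diffeomorphism *)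
Section PullbackAtlas.
Variables (R : realType) (n : nat) (X Y : topologicalType) (p : Y -> X).

Definition pullback_atlas (atl : set (chart R n X)) : set (chart R n Y) :=
  [set e | is_chart e /\
    exists2 c, atl c & forall y, chart_dom e y ->
      chart_dom c (p y) /\ chart_coord e y = chart_coord c (p y)].
End PullbackAtlas.

Section CyclicCover.
Variables (R : realType) (L : topologicalType).
Variable theta : continuousType L (circle R).

(* The pullback of R -> R / 2 pi Z along theta; its second projection
   [cover_height] is a lift F^* of theta *)
Definition cover : topologicalType :=
  [set y : L * R | to_circle y.2 = theta y.1].

Definition cover_proj (y : cover) : L := (set_val y).1.
Definition cover_height (y : cover) : R := (set_val y).2.

Lemma cover_shift_subproof (m : int) (y : cover) :
  ((set_val y).1, (set_val y).2 - 2 * pi * m%:~R) \in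
    [set y : L * R | to_circle y.2 = theta y.1].
Proof.
apply: mem_set; rewrite /= -(set_valP y); apply/to_circleP.
by exists (- m); rewrite addrAC subrr sub0r mulrNz mulrN.
Qed.

Definition cover_shift_fun (m : int) (y : cover) : cover :=
  SigSub (cover_shift_subproof m y).

Lemma cover_shift_continuous (m : int) : continuous (cover_shift_fun m).
Proof.
apply: (@continuous_comp_initial _ _ _ set_val).
pose s (y : L * R) := (y.1, y.2 - 2 * pi * m%:~R).
move=> y; apply: (@continuous_comp _ _ _ set_val s).
  exact: initial_continuous.
move: (set_val y) => [a b]; rewrite /s /=.
have ca : y.1 @[y --> (a, b)] --> a by exact: cvg_fst.
have cb : (y.2 - 2 * pi * m%:~R) @[y --> (a, b)] --> b - 2 * pi * m%:~R.
  by apply: cvgB; [exact: cvg_snd|exact: cvg_cst].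
exact: (cvg_pair ca cb).
Qed.
HB.instance Definition _ m :=
  isContinuous.Build _ _ (cover_shift_fun m) (@cover_shift_continuous m).

(* The action of t ^ m, where T (x, s) = (x, s + 2 pi) and t = T^-1 *)
Definition cover_shift (m : int) : continuousType cover cover :=
  cover_shift_fun m.

Variable B : R.

Definition sublevel : topologicalType := [set y : cover | cover_height y <= B].

Lemma sublevel_shift_subproof (y : sublevel) :
  cover_shift 1 (set_val y) \in [set y : cover | cover_height y <= B].
Proof.
apply/mem_set; rewrite /= /cover_height /=.
have /= := set_valP y; rewrite /cover_height => h.
by rewrite mulr1 lerBlDr (le_trans h)// lerDl mulr_ge0// pi_ge0.
Qed.

Definition sublevel_shift_fun (y : sublevel) : sublevel :=
  SigSub (sublevel_shift_subproof y).

Lemma sublevel_shift_continuous : continuous sublevel_shift_fun.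
Proof.
apply: (@continuous_comp_initial _ _ _ set_val).
move=> y; apply: (@continuous_comp _ _ _ set_val (cover_shift 1)).
  exact: initial_continuous.
exact: cts_fun.
Qed.
HB.instance Definition _ :=
  isContinuous.Build _ _ sublevel_shift_fun sublevel_shift_continuous.

(* t : V^- -> V^- *)
Definition sublevel_shift : continuousType sublevel sublevel :=
  sublevel_shift_fun.

End CyclicCover.

Section Pitcher.
Variables (R : realType) (L : topologicalType).
Variable theta : continuousType L (circle R).

Definition is_pitcher_number (A : R) (k : nat) (Q : int) : Prop :=
  let t := homology_push R rat (sublevel_shift theta (A + 2 * pi)) k in
  exists r s : nat,
    [/\ has_rank (quotmod (range t)) r, has_rank (kermod t) s & Q = r%:Z - s%:Z].
End Pitcher.

Section Novikov.
Variables (R : realType) (L : topologicalType).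
Variable theta : continuousType L (circle R).
Local Notation S k := (chain R int (cover theta) k).

Definition laurent_poly (p : laurent) : Prop :=
  finite_set [set i : int | p i != 0].

(* The action of Z[t, t^-1] on the singular chains of the cover *)
Definition lp_act (p : laurent) k (c : S k) : S k :=
  \sum_(i \in [set i : int | p i != 0])
    p i *: chain_map R int (cover_shift theta i) k c.

Lemma bd_lp_act (p : laurent) k (c : S k) : laurent_poly p ->
  bd R int (cover theta) k (lp_act p c) = lp_act p (bd R int (cover theta) k c).
Proof.
move=> pfin; rewrite /lp_act !fsbig_finite// linear_sum; apply: eq_bigr => i _.
by rewrite linearZ/= bd_chain_map.
Qed.

(* Extension of scalars of [S k] from Z[t, t^-1] to Z((t)): the Z((t))-module
   generated by symbols << x >>, standing for the tensors x (x) 1, subject to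
   additivity in x and to (p x) (x) 1 = x (x) p for p in Z[t, t^-1] *)
Definition tensor_rel k : set {freeg (S k) / laurent} :=
  [set z | (exists x y : S k, z = << x + y >> - << x >> - << y >>) \/
    (exists p x, laurent_poly p /\ z = << lp_act p x >> - p *: << x >>)].

Definition tensor k : lmodType laurent := quotmod (@tensor_rel k).

Lemma tensor_bd_subproof k z : @tensor_rel k z ->
  flift (fun c : S k =>
    << bd R int (cover theta) k c >> : {freeg (S k.-1) / laurent}) z
  \in span (@tensor_rel k.-1).
Proof.
case=> [[x [y ->]]|[p [x [pfin ->]]]]; rewrite !linearB/= ?linearZ/= !fliftU; apply: sub_span.
  by left; exists (bd R int _ k x), (bd R int _ k y); rewrite linearD.
by right; exists p, (bd R int _ k x); rewrite bd_lp_act// scalerN.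
Qed.

Definition tensor_bd k : {linear tensor k -> tensor k.-1} :=
  quot_map (@tensor_bd_subproof k).

Definition is_novikov_betti (k : nat) (b : nat) : Prop :=
  has_rank (homology (tensor_bd k.+1) (tensor_bd k)) b.
End Novikov.

(* Main.v *)
(* Let X = V^- with its shift t, and work over Q[t]. Both sides are read off one finite presentation of
   H_k(X; Q) by an r' x r matrix M with independent rows: setting t = 0, coker t and ker t have dimensions
   r - rank M(0) and r' - rank M(0), so Q_k = r - r', which is also the rank of H_k(X; Q) over Q[t].

   Finite generation is local on L. Say that C in L is tame if every open V around C contains an open U around C
   such that the image of H_k(X_U) in H_k(X_V) is finitely generated, X_U being the part of X above U. In a chart
   of L, the part of X above it consists of the pairs (w, i) with f w - 2 pi i <= B, where f is a local lift of
   theta. Where f is regular at the level B (mod 2 pi) it can be pushed down a little, after which X is locally a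
   finite union of boxes (convex open set) x (i >= i_0), each contractible up to the action of t. Mayer-Vietoris
   and the noetherianity of Q[t] assemble the boxes, and then the tame compact subsets of L.

   Every chain of the cover K is moved into X by a power of t, so H_k(K; Z) over Z[t] has the same rank. Finally
   this rank survives the extension of scalars to Z((t)): a relation over Z((t)) between pure tensors c (x) 1 is,
   up to a nonzero factor in Z[t], a combination of relations over Z[t] between the chains c. This replaces the
   flatness of Z((t)). *)
From HB Require Import structures.
From mathcomp Require Import all_boot all_order all_algebra.
From mathcomp Require Import generic_quotient fraction.
From mathcomp Require Import all_classical all_reals all_analysis.
From mathcomp.multinomials Require Import freeg.
From mathcomp Require Import zify lra ring.
Require Import Defs.
Set Implicit Arguments.
Unset Strict Implicit.
Unset Printing Implicit Defensive.
Import Order.TTheory GRing.Theory Num.Theory.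
Import numFieldNormedType.Exports.
Local Open Scope classical_set_scope.
Local Open Scope ring_scope.

(** The cokernel and the kernel of t on H = H_k(X; Q) are Tor_0 and Tor_1 of H and Q[t]/(t). The
    difference of their dimensions sees the rank of H and not its torsion, so a basis of the
    relations suffices and no structure theorem is invoked. H may be infinite-dimensional over Q, so
    finiteness must be expressed over Q[t], and every set used in the localisation has to be stable
    under t. Arbitrary open sets have no finite homology. The statements therefore concern images of
    H_k(U) in H_k(V): a homotopy may leave U as long as it stays in V, and noetherianity replaces
    any finite system generating an overmodule by one inside the image. Mayer-Vietoris is carried
    out on cycles, without exact sequences. Critical points of theta cause no difficulty, because
    none of them lies on the level B mod 2 pi, the only level at which the sublevel set changes
    shape locally. In the passage to Z((t)), a chain is read through its coordinates along the
    orbits of t. They are Laurent polynomials, so relations are solutions of linear equations that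
    already have coefficients in Z[t]. *)

Section FreegAux.
Variables (F : nzRingType) (K : choiceType).
Implicit Types (c : {freeg K / F}) (P : set K).

Lemma freegUZ a (x : K) : << a *g x >> = a *: << x >> :> {freeg K / F}.
Proof. by apply/eqP/freeg_eqP => y; rewrite coeffZ !coeffU mul1r. Qed.

Lemma submodule_sum (M : lmodType F) (Q : set M) (I : Type) (s : seq I) (p : pred I)
    (f : I -> M) :
  submodule Q -> (forall i, p i -> Q (f i)) -> Q (\sum_(i <- s | p i) f i).
Proof.
move=> [Q0 QD] Qf; elim/big_ind: _ => // x y Qx Qy.
by rewrite -[x]scale1r; exact: QD.
Qed.

Lemma submoduleZ (M : lmodType F) (Q : set M) a x : submodule Q -> Q x -> Q (a *: x).
Proof. by move=> [Q0 QD] Qx; rewrite -[_ *: x]addr0; exact: QD. Qed.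

Lemma submoduleD (M : lmodType F) (Q : set M) x y : submodule Q -> Q x -> Q y -> Q (x + y).
Proof. by move=> [Q0 QD] Qx Qy; rewrite -[x]scale1r; exact: QD. Qed.

Lemma submoduleB (M : lmodType F) (Q : set M) x y : submodule Q -> Q x -> Q y -> Q (x - y).
Proof. by move=> [Q0 QD] Qx Qy; rewrite addrC -scaleN1r; exact: QD. Qed.

(** Chains of a subspace are treated as chains of the whole space supported by simplices that lie in
    it. This avoids subspace topologies and inclusion maps throughout the local arguments. *)
Definition carried P : set {freeg K / F} := [set c | forall x, coeff x c != 0 -> P x].

Lemma carried_submodule P : submodule (carried P).
Proof.
split=> [x|a c d cP dP x]; first by rewrite coeff0 eqxx.
rewrite coeffD coeffZ => h; apply: contrapT => nP.
have c0 : coeff x c = 0 by apply/eqP/negPn/negP => /cP.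
have d0 : coeff x d = 0 by apply/eqP/negPn/negP => /dP.
by move: h; rewrite c0 d0 mulr0 addr0 eqxx.
Qed.

Lemma carried0 P : carried P 0.
Proof. exact: (carried_submodule P).1. Qed.

Lemma carriedU P x : P x -> carried P << x >>.
Proof. by move=> Px y; rewrite coeffU mul1r; case: (x =P y) => [<-//|_]; rewrite eqxx. Qed.

Lemma carriedD P c d : carried P c -> carried P d -> carried P (c + d).
Proof. exact: (submoduleD (carried_submodule P)). Qed.

Lemma carriedB P c d : carried P c -> carried P d -> carried P (c - d).
Proof. exact: (submoduleB (carried_submodule P)). Qed.

Lemma carriedZ P a c : carried P c -> carried P (a *: c).
Proof. exact: (submoduleZ a (carried_submodule P)). Qed.

Lemma carried_sub P P' : P `<=` P' -> carried P `<=` carried P'.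
Proof. by move=> PP' c cP x /cP /PP'. Qed.

Lemma carried_ind P (Q : set {freeg K / F}) :
  submodule Q -> (forall x, P x -> Q << x >>) -> carried P `<=` Q.
Proof.
move=> sQ QP c cP; rewrite -[c]freeg_sumE big_seq; apply: submodule_sum => // x.
by rewrite mem_dom freegUZ => /cP /QP; exact: submoduleZ.
Qed.

Lemma submodule_preim (M : lmodType F) (N : lmodType F) (f : {linear M -> N}) (Q : set N) :
  submodule Q -> submodule (f @^-1` Q).
Proof. by move=> [Q0 QD]; split=> [|a x y]; rewrite /= ?linear0// linearP; exact: QD. Qed.

Lemma carried_map (M : lmodType F) (f : {linear {freeg K / F} -> M}) P (Q : set M) :
  submodule Q -> (forall x, P x -> Q (f << x >>)) -> forall c, carried P c -> Q (f c).
Proof. by move=> sQ ? c; apply: (carried_ind (Q := f @^-1` Q)) => //; exact: submodule_preim. Qed.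

Lemma freeg_map (M : lmodType F) (f : {linear {freeg K / F} -> M}) (Q : set M) :
  submodule Q -> (forall x, Q (f << x >>)) -> forall c, Q (f c).
Proof. by move=> sQ Qf c; exact: (carried_map (P := setT)). Qed.

Lemma submodule_eq (M N : lmodType F) (f g : {linear M -> N}) :
  submodule [set c | f c = g c].
Proof. by split=> [|a x y /= fx fy]; rewrite /= ?linear0// !linearP fx fy. Qed.

Lemma carried_eq (M : lmodType F) (f g : {linear {freeg K / F} -> M}) P :
  (forall x, P x -> f << x >> = g << x >>) -> forall c, carried P c -> f c = g c.
Proof. by move=> fg c /(carried_ind (submodule_eq f g) fg). Qed.

End FreegAux.

(** * Chains of affine simplices *)

(* The list of its vertices stands for an affine simplex; [bd_seq] is the augmented simplicial boundary, the
   degree being the size. The linear maps are locked to keep unification from unfolding [flift]. *)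
Section ListChains.
Variables (F : nzRingType).
Local Notation L E := {freeg (seq E) / F}.

Section One.
Variable E : choiceType.

Definition cone (w : E) : {linear L E -> L E} := @locked {linear L E -> L E} (flift (fun s => << w :: s >> : L E)).

Fixpoint bd_seq (s : seq E) : L E :=
  if s is w :: s' then << s' >> - cone w (bd_seq s') else 0.

Definition bdl : {linear L E -> L E} := @locked {linear L E -> L E} (flift bd_seq).

Lemma coneU w s : cone w << s >> = << w :: s >>.
Proof. by rewrite /cone -lock [LHS]fliftU. Qed.

Lemma bdlU s : bdl << s >> = bd_seq s.
Proof. by rewrite /bdl -lock [LHS]fliftU. Qed.

(** [cone w] contracts the augmented complex, the empty list being the boundary of a point. Hence a
    chain with zero boundary is the boundary of its own cone. *)
Lemma bdl_cone w c : bdl (cone w c) = c - cone w (bdl c).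
Proof.
have := @flift_ext _ _ _ (bdl \o cone w) (idfun \- (cone w \o bdl))%R.
by apply => s /=; rewrite coneU !bdlU.
Qed.

Lemma bdl_bdl c : bdl (bdl c) = 0.
Proof.
apply: (@flift_ext _ _ _ (bdl \o bdl) \0) => s /=; rewrite bdlU.
elim: s => [|w s IH] /=; first by rewrite linear0.
by rewrite linearB/= bdl_cone bdlU IH linear0 subr0 subrr.
Qed.

Definition sized (n : nat) : set (L E) := carried [set s | size s = n].

Lemma sized_cone n w c : sized n c -> sized n.+1 (cone w c).
Proof.
apply: carried_map; first exact: carried_submodule.
by move=> s /= sn; rewrite coneU; apply: carriedU; rewrite /= sn.
Qed.

Lemma sized_bd_seq s : sized (size s).-1 (bd_seq s).
Proof.
elim: s => [|w s IH] /=; first exact: carried0.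
apply: carriedB; first exact: carriedU.
case: s IH => [|v s] IH; first by rewrite /= linear0; exact: carried0.
exact: sized_cone.
Qed.

Lemma sized_bdl n c : sized n c -> sized n.-1 (bdl c).
Proof.
apply: carried_map; first exact: carried_submodule.
by move=> s /= <-; rewrite bdlU; exact: sized_bd_seq.
Qed.

Definition delnth (i : nat) (s : seq E) := take i s ++ drop i.+1 s.

Lemma bd_seqE s : bd_seq s = \sum_(i < size s) (-1) ^+ i *: << delnth i s >>.
Proof.
elim: s => [|w s IH] /=; first by rewrite big_ord0.
rewrite big_ord_recl /delnth /= drop0 expr0 scale1r IH linear_sum -sumrN; congr (_ + _).
by apply: eq_bigr => i _; rewrite linearZ/= coneU exprS mulN1r scaleNr.
Qed.

End One.
Arguments cone {E} w.
Arguments bdl {E}.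

Section Map.
Variables (E E' : choiceType) (f : E -> E').
Definition mapl : {linear L E -> L E'} := @locked {linear L E -> L E'} (flift (fun s => << map f s >> : L E')).
Lemma maplU s : mapl << s >> = << map f s >>.
Proof. by rewrite /mapl -lock [LHS]fliftU. Qed.
Lemma mapl_cone w c : mapl (cone w c) = cone (f w) (mapl c).
Proof. by apply: (@flift_ext _ _ _ (mapl \o cone w) (cone (f w) \o mapl)) => s /=; rewrite coneU !maplU coneU. Qed.
Lemma mapl_bdl c : mapl (bdl c) = bdl (mapl c).
Proof.
apply: (@flift_ext _ _ _ (mapl \o bdl) (bdl \o mapl)) => s /=.
rewrite maplU !bdlU; elim: s => [|w s IH] /=; first by rewrite linear0.
by rewrite linearB/= maplU mapl_cone IH.
Qed.
Lemma sized_mapl n c : sized n c -> sized n (mapl c).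
Proof.
apply: carried_map; first exact: carried_submodule.
by move=> s /= <-; rewrite maplU; apply: carriedU; rewrite /= size_map.
Qed.
End Map.
Arguments mapl {E E'} f.

(* The cone construction behind acyclic models: [phi - psi] is filled in degree by degree *)
Section Fill.
Variables (E E' : choiceType) (b : seq E -> E') (phi psi : {linear L E -> L E'}).

Fixpoint fill_rec (n : nat) : {linear L E -> L E'} :=
  if n is n'.+1 then
    flift (fun s => cone (b s) (phi << s >> - psi << s >> - fill_rec n' (bdl << s >>)))
  else \0.

Definition fill : {linear L E -> L E'} := @locked {linear L E -> L E'} (flift (fun s => fill_rec (size s) << s >>)).

Lemma fill_sized n c : sized n c -> fill c = fill_rec n c.
Proof. by apply: carried_eq => s /= <-; rewrite /fill -lock [LHS]fliftU. Qed.

Lemma fillU s : (0 < size s)%N ->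
  fill << s >> = cone (b s) (phi << s >> - psi << s >> - fill (bdl << s >>)).
Proof.
move=> s0; rewrite {1}/fill -lock [LHS]fliftU; case: s s0 => // w s _.
rewrite [LHS]fliftU; congr (cone _ (_ - _)); apply/esym/fill_sized.
by apply: (@sized_bdl _ (size s).+1); exact: carriedU.
Qed.

Lemma fill_nil : fill << [::] >> = 0.
Proof. by rewrite /fill -lock [LHS]fliftU. Qed.

Hypothesis phi_bd : forall c, bdl (phi c) = phi (bdl c).
Hypothesis psi_bd : forall c, bdl (psi c) = psi (bdl c).
Hypothesis phi_psi : phi << [::] >> = psi << [::] >>.

Lemma fillE c : bdl (fill c) = phi c - psi c - fill (bdl c).
Proof.
have : forall n c, sized n c -> bdl (fill c) = phi c - psi c - fill (bdl c).
  elim=> [|n IH] {}c.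
    apply: (carried_eq (f := bdl \o fill) (g := ((phi \- psi) \- (fill \o bdl)))) => -[|//] _ /=.
    by rewrite fill_nil bdlU linear0 phi_psi subrr sub0r linear0 oppr0.
  apply: (carried_eq (f := bdl \o fill) (g := ((phi \- psi) \- (fill \o bdl)))) => s /= ss.
  (* By the induction hypothesis the chain under the cone has zero boundary, so the correction term
     of [bdl_cone] disappears. *)
  rewrite fillU ?ss// bdl_cone [X in cone _ X](_ : _ = 0); first by rewrite linear0 subr0.
  rewrite !linearB/= phi_bd psi_bd IH; last by apply: (@sized_bdl _ n.+1); exact: carriedU.
  by rewrite bdl_bdl linear0 subr0 subrr.
move=> H; apply: (@flift_ext _ _ _ (bdl \o fill) ((phi \- psi) \- (fill \o bdl))) => s.
by apply: (H (size s)); exact: carriedU.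
Qed.

Lemma fill_deg n c : (forall s, sized (size s) (phi << s >>)) ->
  (forall s, sized (size s) (psi << s >>)) -> sized n c -> sized n.+1 (fill c).
Proof.
move=> hphi hpsi; elim: n c => [|n IH] c; apply: carried_map; try exact: carried_submodule.
  by move=> [|//] _; rewrite fill_nil; exact: carried0.
move=> s /= ss; rewrite fillU ?ss//; apply: sized_cone.
apply: carriedB; [apply: carriedB|].
- by have := hphi s; rewrite ss.
- by have := hpsi s; rewrite ss.
- by apply: IH; apply: (@sized_bdl _ n.+1); exact: carriedU.
Qed.
End Fill.
Arguments fill {E E'} b phi psi.

(** Naturality of the filling rests on naturality of the apex alone. For [f] a face of a prism and
    [b] the barycentre, this is what lets the filling be applied to singular chains. *)
Lemma fill_nat (E1 E1' E2 E2' : choiceType) (b1 : seq E1 -> E1') (b2 : seq E2 -> E2')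
  (phi1 psi1 : {linear L E1 -> L E1'}) (phi2 psi2 : {linear L E2 -> L E2'})
  (f : E1 -> E2) (f' : E1' -> E2') :
  (forall s, (0 < size s)%N -> f' (b1 s) = b2 (map f s)) ->
  (forall c, mapl f' (phi1 c) = phi2 (mapl f c)) ->
  (forall c, mapl f' (psi1 c) = psi2 (mapl f c)) ->
  forall c, mapl f' (fill b1 phi1 psi1 c) = fill b2 phi2 psi2 (mapl f c).
Proof.
move=> hb hphi hpsi.
have H : forall n c, sized n c -> mapl f' (fill b1 phi1 psi1 c) = fill b2 phi2 psi2 (mapl f c).
  elim=> [|n IH] c.
    apply: (carried_eq (f := mapl f' \o fill b1 phi1 psi1) (g := fill b2 phi2 psi2 \o mapl f)) => -[|//] _ /=.
    by rewrite fill_nil maplU /= fill_nil linear0.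
  apply: (carried_eq (f := mapl f' \o fill b1 phi1 psi1) (g := fill b2 phi2 psi2 \o mapl f)) => s /= ss.
  rewrite fillU ?ss// mapl_cone !linearB/= hphi hpsi hb ?ss//.
  rewrite IH; last by apply: (@sized_bdl _ n.+1); exact: carriedU.
  by rewrite maplU [RHS]fillU ?size_map ?ss// -maplU mapl_bdl !linearB.
move=> c; apply: (@flift_ext _ _ _ (mapl f' \o fill b1 phi1 psi1) (fill b2 phi2 psi2 \o mapl f)) => s.
by apply: (H (size s)); exact: carriedU.
Qed.

(* Barycentric subdivision, when [b] is the barycentre *)
Section Sd.
Variables (E : choiceType) (b : seq E -> E).
Fixpoint sd_rec (n : nat) : {linear L E -> L E} :=
  if n is n'.+1 then flift (fun s => cone (b s) (sd_rec n' (bdl << s >>))) else idfun.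
Definition sd : {linear L E -> L E} := @locked {linear L E -> L E} (flift (fun s => sd_rec (size s) << s >>)).

Lemma sd_sized n c : sized n c -> sd c = sd_rec n c.
Proof. by apply: carried_eq => s /= <-; rewrite /sd -lock [LHS]fliftU. Qed.

Lemma sdU s : (0 < size s)%N -> sd << s >> = cone (b s) (sd (bdl << s >>)).
Proof.
move=> s0; rewrite {1}/sd -lock [LHS]fliftU; case: s s0 => // w s _.
rewrite [LHS]fliftU; congr (cone _ _); apply/esym/sd_sized.
by apply: (@sized_bdl _ (size s).+1); exact: carriedU.
Qed.

Lemma sd_nil : sd << [::] >> = << [::] >>.
Proof. by rewrite /sd -lock [LHS]fliftU. Qed.

Lemma sd_deg n c : sized n c -> sized n (sd c).
Proof.
elim: n c => [|n IH] c; apply: carried_map; try exact: carried_submodule.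
  by move=> [|//] _; rewrite sd_nil; exact: carriedU.
move=> s /= ss; rewrite sdU ?ss//; apply: sized_cone.
by apply: IH; apply: (@sized_bdl _ n.+1); exact: carriedU.
Qed.

Lemma sd_bd c : bdl (sd c) = sd (bdl c).
Proof.
have H : forall n c, sized n c -> bdl (sd c) = sd (bdl c).
  elim=> [|n IH] {}c.
    apply: (carried_eq (f := bdl \o sd) (g := sd \o bdl)) => -[|//] _ /=.
    by rewrite sd_nil bdlU linear0.
  apply: (carried_eq (f := bdl \o sd) (g := sd \o bdl)) => s /= ss.
  rewrite sdU ?ss// bdl_cone IH; last by apply: (@sized_bdl _ n.+1); exact: carriedU.
  by rewrite bdl_bdl !linear0 addr0.
apply: (@flift_ext _ _ _ (bdl \o sd) (sd \o bdl)) => s.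
by apply: (H (size s)); exact: carriedU.
Qed.
End Sd.
Arguments sd {E} b.

Lemma sd_nat (E E' : choiceType) (b : seq E -> E) (b' : seq E' -> E') (f : E -> E') :
  (forall s, (0 < size s)%N -> f (b s) = b' (map f s)) ->
  forall c, mapl f (sd b c) = sd b' (mapl f c).
Proof.
move=> hb.
have H : forall n c, sized n c -> mapl f (sd b c) = sd b' (mapl f c).
  elim=> [|n IH] c.
    apply: (carried_eq (f := mapl f \o sd b) (g := sd b' \o mapl f)) => -[|//] _ /=.
    by rewrite sd_nil maplU /= sd_nil.
  apply: (carried_eq (f := mapl f \o sd b) (g := sd b' \o mapl f)) => s /= ss.
  rewrite sdU ?ss// mapl_cone hb ?ss// IH; last by apply: (@sized_bdl _ n.+1); exact: carriedU.
  by rewrite maplU sdU ?size_map ?ss// -maplU mapl_bdl.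
move=> c; apply: (@flift_ext _ _ _ (mapl f \o sd b) (sd b' \o mapl f)) => s.
by apply: (H (size s)); exact: carriedU.
Qed.

End ListChains.
Arguments cone {F E} w.
Arguments bdl {F E}.
Arguments mapl {F E E'} f.
Arguments fill {F E E'} b phi psi.
Arguments sd {F E} b.

Lemma cvg_prod (Z A B : topologicalType) (f : Z -> A * B) (z : Z) :
  (f x).1 @[x --> z] --> (f z).1 -> (f x).2 @[x --> z] --> (f z).2 -> f @ z --> f z.
Proof.
move=> c1 c2; rewrite [f z]surjective_pairing.
have -> : f = (fun x => ((f x).1, (f x).2)) by apply/funext => x; exact: surjective_pairing.
exact: (cvg_pair c1 c2).
Qed.

Lemma cvg_row (R : realType) (Z : topologicalType) n (f : Z -> 'rV[R]_n) (z : Z) :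
  (forall j, f x ord0 j @[x --> z] --> f z ord0 j) -> f @ z --> f z.
Proof.
move=> lcoef A [/= B Bn BA].
have : \forall x \near z, forall ij : 'I_1 * 'I_n, B ij.1 ij.2 (f x ij.1 ij.2).
  apply: filter_forall => -[i j] /=; rewrite (ord1 i); apply: lcoef.
  by have := Bn ord0 j.
by apply: filterS => x Bx; apply: BA => i j; exact: (Bx (i, j)).
Qed.

(** * Affine simplices in prisms and their realisation as singular simplices *)

Section Prism.
Variable R : realType.
Local Notation S := (std_simplex R).

(** The time axis is the whole line, which saves a type for the interval. Subdivision takes place in
    the same space, at time 0, so that it shares its machinery with homotopies. *)
Definition prism m : topologicalType := (S m * R)%type.

Lemma simplex_ge0 m (x : S m) i : 0 <= (set_val x : 'rV_m.+1) ord0 i.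
Proof. by have [] : std_simplex R m (set_val x) by exact: (set_valP x). Qed.

Lemma simplex_sum1 m (x : S m) : \sum_i (set_val x : 'rV_m.+1) ord0 i = 1.
Proof. by have [] : std_simplex R m (set_val x) by exact: (set_valP x). Qed.

Lemma vertex_subproof m (i : 'I_m.+1) : (delta_mx 0 i : 'rV[R]_m.+1) \in std_simplex R m.
Proof.
apply/mem_set; split=> [j|]; first by rewrite mxE; case: (_ && _); rewrite ?ler01.
rewrite (bigD1 i)//= mxE !eqxx big1 ?addr0// => j ji.
by rewrite mxE (negbTE ji) andbF.
Qed.

Definition vertex m (i : 'I_m.+1) : S m := SigSub (vertex_subproof i).

Lemma unif_subproof m : (const_mx m.+1%:R^-1 : 'rV[R]_m.+1) \in std_simplex R m.
Proof.
apply/mem_set; split=> [j|]; first by rewrite mxE invr_ge0 ler0n.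
rewrite (eq_bigr (fun=> m.+1%:R^-1)) => [|i _]; last by rewrite mxE.
by rewrite sumr_const card_ord -[_ *+ _]mulr_natl mulfV// pnatr_eq0.
Qed.

Definition unif m : S m := SigSub (unif_subproof m).

Definition prism0 m : prism m := (vertex ord0, 0).

Lemma comb_subproof m (s : seq (prism m)) j (x : S j) :
  (\sum_i (set_val x : 'rV_j.+1) ord0 i *: (set_val (nth (prism0 m) s i).1 : 'rV_m.+1))
  \in std_simplex R m.
Proof.
apply/mem_set; split=> [k|].
  rewrite summxE sumr_ge0// => i _; rewrite mxE mulr_ge0//; exact: simplex_ge0.
under eq_bigr do rewrite summxE.
rewrite exchange_big -[RHS](simplex_sum1 x); apply: eq_bigr => i _.
under eq_bigr do rewrite mxE.
by rewrite -mulr_sumr simplex_sum1 mulr1.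
Qed.

(* The point of barycentric coordinates [x] in the affine simplex spanned by [s] *)
Definition comb m (s : seq (prism m)) j (x : S j) : prism m :=
  (SigSub (comb_subproof s x),
   \sum_i (set_val x : 'rV_j.+1) ord0 i * (nth (prism0 m) s i).2).

Lemma combE1 m (s : seq (prism m)) j (x : S j) : set_val (comb s x).1 =
  \sum_i (set_val x : 'rV_j.+1) ord0 i *: (set_val (nth (prism0 m) s i).1 : 'rV_m.+1).
Proof. by []. Qed.

Lemma combE2 m (s : seq (prism m)) j (x : S j) : (comb s x).2 =
  \sum_i (set_val x : 'rV_j.+1) ord0 i * (nth (prism0 m) s i).2.
Proof. by []. Qed.

Lemma comb_continuous m (s : seq (prism m)) j : continuous (@comb m s j).
Proof.
have cc i (x : S j) : (fun y : S j => (set_val y : 'rV[R]_j.+1) ord0 i) @ x --> (set_val x : 'rV[R]_j.+1) ord0 i.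
  apply: (@continuous_comp _ _ _ (set_val) (fun M : 'rV[R]_j.+1 => M ord0 i)).
    exact: initial_continuous.
  exact: coord_continuous.
move=> x.
have c2 : (fun y => (comb s y).2) @ x --> (comb s x).2.
    apply: (@cvg_big R^o _ _ _ _ add_continuous _ _ _ _ _ (nbhs_filter x)) => i _.
  by apply: cvgM; [exact: cc|exact: cvg_cst].
suff c1 : continuous ((fun y => (comb s y).1) : S j -> S m) by exact: (cvg_prod (c1 x) c2).
apply: (@continuous_comp_initial _ _ _ set_val (fun y => (comb s y).1)) => y.
have -> : set_val \o (fun y => (comb s y).1) = fun y : S j => 
  \sum_i (set_val y : 'rV_j.+1) ord0 i *: (set_val (nth (prism0 m) s i).1 : 'rV[R]_m.+1) by [].
apply: cvg_row => k; rewrite summxE.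
under eq_cvg do rewrite summxE.
apply: (@cvg_big R^o _ _ _ _ add_continuous _ _ _ _ _ (nbhs_filter y)) => i _.
rewrite mxE; under eq_cvg do rewrite mxE.
by apply: cvgM; [exact: cc|exact: cvg_cst].
Qed.
HB.instance Definition _ m s j := isContinuous.Build _ _ (@comb m s j) (@comb_continuous m s j).

Lemma prism_eq m (p q : prism m) :
  (set_val p.1 : 'rV[R]_m.+1) = set_val q.1 -> p.2 = q.2 -> p = q.
Proof. by case: p q => [p a] [q b] /= pq ->; congr (_, _); exact: val_inj. Qed.

Definition top m : seq (prism m) := [seq (vertex i, 0) | i <- enum 'I_m.+1].

Lemma size_top m : size (top m) = m.+1.
Proof. by rewrite size_map size_enum_ord. Qed.

Lemma nth_top m (i : 'I_m.+1) : nth (prism0 m) (top m) i = (vertex i, 0).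
Proof. by rewrite (nth_map ord0) ?size_enum_ord// nth_ord_enum. Qed.

Definition at_time m a (p : prism m) : prism m := (p.1, a).

Lemma comb_top m a (x : S m) : comb (map (at_time a) (top m)) x = (x, a).
Proof.
have E (i : 'I_m.+1) : nth (prism0 m) (map (at_time a) (top m)) i = (vertex i, a).
  by rewrite (nth_map (prism0 m)) ?size_top// nth_top.
apply: prism_eq => /=.
  rewrite [RHS]row_sum_delta; apply: eq_bigr => i _; by rewrite E.
under eq_bigr do rewrite E /=.
by rewrite -mulr_suml simplex_sum1 mul1r.
Qed.

Definition pface m (i : 'I_m.+2) (p : prism m) : prism m.+1 := (coface R i p.1, p.2).

Lemma pface_continuous m (i : 'I_m.+2) : continuous (@pface m i).
Proof.
move=> p; suff c1 : coface R i q.1 @[q --> p] --> coface R i p.1 by exact: (cvg_pair c1 cvg_snd).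
by apply: (@cvg_comp _ _ _ fst (coface R i)); [exact: cvg_fst|exact: cts_fun].
Qed.
HB.instance Definition _ m i := isContinuous.Build _ _ (@pface m i) (@pface_continuous m i).

Lemma coface_mx_linear m (i : 'I_m.+2) : linear (@coface_mx R m i).
Proof.
move=> a x y; apply/rowP => j; rewrite !mxE.
by case: unliftP => [k _|_]; rewrite ?mxE// mulr0 addr0.
Qed.
HB.instance Definition _ m i := GRing.isLinear.Build R _ _ _ (@coface_mx R m i) (@coface_mx_linear m i).

Lemma pface_comb m (i : 'I_m.+2) (s : seq (prism m)) j (x : S j) : size s = j.+1 ->
  pface i (comb s x) = comb (map (pface i) s) x.
Proof.
move=> sj; have E (k : 'I_j.+1) : nth (prism0 m.+1) (map (pface i) s) k = pface i (nth (prism0 m) s k).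
  by rewrite (nth_map (prism0 m)) ?sj.
apply: prism_eq => /=; last by apply: eq_bigr => k _; rewrite E.
rewrite [LHS](_ : _ = coface_mx i (\sum_k (set_val x : 'rV_j.+1) ord0 k *: (set_val (nth (prism0 m) s k).1 : 'rV_m.+1)))//.
rewrite linear_sum; apply: eq_bigr => k _; rewrite linearZ/=; congr (_ *: _).
by rewrite E.
Qed.

Lemma nth_delnth (T : choiceType) (d : T) (s : seq T) i j : (i < size s)%N ->
  nth d (delnth i s) j = nth d s (bump i j).
Proof.
move=> i_s; rewrite /delnth nth_cat size_take i_s /bump; case: ltnP => ij.
  by rewrite nth_take// leqNgt ij.
by rewrite nth_drop add1n addSn subnKC.
Qed.

Lemma size_delnth (T : choiceType) (s : seq T) i : (i < size s)%N -> size (delnth i s) = (size s).-1.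
Proof. by move=> i_s; rewrite size_cat size_take i_s size_drop; lia. Qed.

Lemma comb_coface m (s : seq (prism m)) j (i : 'I_j.+2) (x : S j) : size s = j.+2 ->
  comb s (coface R i x) = comb (delnth i s) x.
Proof.
move=> sj; have E (k : 'I_j.+1) : nth (prism0 m) (delnth i s) k = nth (prism0 m) s (fintype.lift i k).
  by rewrite nth_delnth// sj.
apply: prism_eq; rewrite ?combE1 ?combE2 (bigD1_ord i)//= mxE unlift_none ?scale0r ?mul0r add0r;
  by apply: eq_bigr => k _; rewrite mxE liftK E.
Qed.

(** The faces of the fundamental simplex are fundamental simplices of faces. This is what turns the
    singular boundary into the boundary of lists. *)
Lemma top_delnth m (i : 'I_m.+2) : delnth i (top m.+1) = map (pface i) (top m).
Proof.
apply: (@eq_from_nth _ (prism0 m.+1)); first by rewrite [RHS]size_map size_delnth !size_top.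
move=> j; rewrite size_delnth size_top// => jm.
rewrite nth_delnth ?size_top// (nth_map (prism0 m)) ?size_top//.
rewrite -[bump i j]/(nat_of_ord (fintype.lift i (Ordinal jm))) nth_top.
rewrite -[j in RHS]/(nat_of_ord (Ordinal jm)) nth_top; apply: prism_eq => //=.
apply/rowP => k; rewrite !mxE eqxx /=; case: unliftP => [k' ->|->].
  by rewrite mxE eqxx /= (inj_eq lift_inj).
by rewrite (negbTE (neq_lift _ _)).
Qed.

Definition bary m (s : seq (prism m)) : prism m := comb s (unif (size s).-1).

Lemma pface_bary m (i : 'I_m.+2) (s : seq (prism m)) : (0 < size s)%N ->
  pface i (bary s) = bary (map (pface i) s).
Proof. by move=> s0; rewrite pface_comb ?prednK// /bary size_map. Qed.

Section Real.
Variables (F : nzRingType) (X : topologicalType).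
Local Notation L m := {freeg (seq (prism m)) / F}.
Local Notation chain := (chain R F).

(* Lists of the wrong size are sent to 0 *)
Definition real m (phi : continuousType (prism m) X) j : {linear L m -> chain X j} :=
  @locked {linear L m -> chain X j} (flift (fun s =>
    if size s == j.+1 then << (phi \o @comb m s j : singular R X j) >> else 0)).

Lemma realU m (phi : continuousType (prism m) X) j s : size s = j.+1 ->
  real phi j << s >> = << (phi \o @comb m s j : singular R X j) >>.
Proof. by move=> sj; rewrite /real -lock [LHS]fliftU sj eqxx. Qed.

(** Lists of size 1 are excluded: their augmented boundary is the empty list, while a singular point
    has boundary 0. *)
Lemma real_bd m (phi : continuousType (prism m) X) j c : sized j.+2 c ->
  bd R F X j.+1 (real phi j.+1 c) = real phi j (bdl c).
Proof.
apply: (carried_eq (f := bd R F X j.+1 \o real phi j.+1) (g := real phi j \o bdl)) => s /= sj.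
rewrite realU// bdU /= bdlU bd_seqE linear_sum sj; apply: eq_bigr => i _.
rewrite linearZ/= realU ?size_delnth ?sj//; congr (_ *: << _ >>).
by apply/continuousEP => x /=; rewrite comb_coface.
Qed.

Lemma real_face m (phi : continuousType (prism m.+1) X) (psi : continuousType (prism m) X)
    (i : 'I_m.+2) j c : (forall p, psi p = phi (pface i p)) -> sized j.+1 c ->
  real psi j c = real phi j (mapl (pface i) c).
Proof.
move=> psiE; apply: (carried_eq (f := real psi j) (g := real phi j \o mapl (pface i))) => s /= sj.
rewrite maplU !realU ?size_map//; congr << _ >>.
by apply/continuousEP => x /=; rewrite psiE pface_comb.
Qed.

End Real.
End Prism.
Arguments comb {R m} s {j} x.
Arguments real {R F X m} phi j.

(** * Operators on singular chains induced by natural operators on affine chains *)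

Section Natural.
Variables (R : realType) (F : nzRingType) (X Y : topologicalType).
Local Notation L m := {freeg (seq (prism R m)) / F}.
Local Notation chain := (chain R F).
Local Notation singular := (singular R).

(* Face-compatible operators of degree [e] on affine chains of the prisms *)
Definition natural (Op : forall m, {linear L m -> L m}) e :=
  [/\ forall m n c, sized n c -> sized (n + e) (Op m c),
      forall m (i : 'I_m.+2) c, mapl (pface i) (Op m c) = Op m.+1 (mapl (pface i) c) &
      forall m, Op m << [::] >> = if e is 0 then << [::] >> else 0].

Variable good : forall m, set (singular X m).
Variable Phi : forall m, singular X m -> continuousType (prism R m) Y.
Hypothesis good_face : forall m (i : 'I_m.+2) s, good s -> good (s \o coface R i : singular X m).
Hypothesis Phi_face : forall m (i : 'I_m.+2) (s : singular X m.+1) p,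
  good s -> Phi (s \o coface R i : singular X m) p = Phi s (pface i p).

(* [Op] is evaluated on the fundamental simplex of the prism over each [s], then pushed to [Y] by [Phi s] *)
Definition sop (Op : forall m, {linear L m -> L m}) m e : {linear chain X m -> chain Y (e + m)} :=
  @locked {linear chain X m -> chain Y (e + m)}
    (flift (fun s => real (Phi s) (e + m) (Op m << top R m >>))).

Lemma sopU Op m e s : sop Op m e << s >> = real (Phi s) (e + m) (Op m << top R m >>).
Proof. by rewrite /sop -lock [LHS]fliftU. Qed.

Lemma sized_top m : sized m.+1 (<< top R m >> : L m).
Proof. by apply: carriedU; rewrite /= size_top. Qed.

Lemma bdl_top m : bdl (<< top R m.+1 >> : L m.+1) =
  \sum_(i < m.+2) (-1) ^+ i *: mapl (pface i) << top R m >>.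
Proof.
rewrite bdlU bd_seqE size_top; apply: eq_bigr => i _.
by rewrite maplU top_delnth.
Qed.

Lemma sop_bd Op e m s : natural Op e -> good s ->
  sop Op m e (bd R F X m.+1 << s >>) = real (Phi s) (e + m) (Op m.+1 (bdl << top R m.+1 >>)).
Proof.
move=> [szOp natOp _] gs; rewrite bdU bdl_top !linear_sum; apply: eq_bigr => i _.
rewrite !linearZ/=; congr (_ *: _); rewrite sopU -natOp.
apply: real_face; first by move=> p; rewrite Phi_face.
by have := szOp _ _ _ (@sized_top m); rewrite addnC -addnS.
Qed.

(** Two natural chain maps that agree on the empty list are homologous on cycles, by filling their
    difference with cones. With the two ends of the prism this gives homotopy invariance; with the
    identity and iterated subdivision it gives the reduction to small simplices. *)
Lemma sop_fill_bd (Op1 Op2 : forall m, {linear L m -> L m}) (b : forall m, seq (prism R m) -> prism R m) :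
  natural Op1 0 -> natural Op2 0 ->
  (forall m c, bdl (Op1 m c) = Op1 m (bdl c)) -> (forall m c, bdl (Op2 m c) = Op2 m (bdl c)) ->
  (forall m (i : 'I_m.+2) s, (0 < size s)%N -> pface i (b m s) = b m.+1 (map (pface i) s)) ->
  let Fl m := fill (b m) (Op1 m) (Op2 m) in
  forall m z, carried (@good m) z -> bd R F X m z = 0 ->
  sop Op1 m 0 z - sop Op2 m 0 z = bd R F Y m.+1 (sop Fl m 1 z).
Proof.
move=> n1 n2 b1 b2 hb Fl.
have nF : natural Fl 1.
  case: n1 => [s1 f1 e1]; case: n2 => [s2 f2 e2]; split.
  - move=> m n c cn; rewrite addn1; apply: fill_deg => // s.
      by have := s1 m (size s) << s >>; rewrite addn0; apply; exact: carriedU.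
    by have := s2 m (size s) << s >>; rewrite addn0; apply; exact: carriedU.
  - by move=> m i c; apply: fill_nat => // s s0; exact: hb.
  - by move=> m; exact: fill_nil.
have szF m : sized m.+2 (Fl m << top R m >>).
  by case: nF => [sF _ _]; have := sF m _ _ (@sized_top m); rewrite addn1.
have FE m s : bd R F Y m.+1 (sop Fl m 1 << s >>) =
    sop Op1 m 0 << s >> - sop Op2 m 0 << s >> - real (Phi s) m (Fl m (bdl << top R m >>)).
  rewrite sopU [LHS]real_bd// fillE// ?linearB/= ?sopU//.
  by case: n1 n2 => [_ _ ->] [_ _ ->].
(* In degree 0 the boundary of the fundamental simplex is the empty list, on which [Fl] vanishes. In
   positive degree the extra term is [sop Fl] of the boundary of [z], which is 0. *)
move=> [|m] z gz bz; apply/eqP; rewrite -subr_eq0; apply/eqP.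
  apply: (carried_eq (f := ((sop Op1 0 0 \- sop Op2 0 0) \- (bd R F Y 1 \o sop Fl 0 1))) (g := \0)) gz => s gs.
  rewrite /= FE opprB addrCA subrr addr0.
  by rewrite bdlU /top enum_ordSl /= enum_ord0 /= linear0 subr0 [Fl 0 _]fill_nil linear0.
rewrite -[LHS]subr0 -[X in _ - X](linear0 (sop Fl m 1)) -bz.
apply: (carried_eq (f := ((sop Op1 m.+1 0 \- sop Op2 m.+1 0) \- (bd R F Y m.+2 \o sop Fl m.+1 1)) \-
  (sop Fl m 1 \o bd R F X m.+1)) (g := \0)) gz => s gs.
by rewrite /= FE sop_bd// opprB addrCA subrr addr0 subrr.
Qed.

Lemma real_in m (phi : continuousType (prism R m) Y) j c :
  carried [set t : singular Y j | range t `<=` range phi] (real (F := F) phi j c).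
Proof.
apply: (freeg_map (f := real phi j) (Q := carried [set t : singular Y j | range t `<=` range phi])) => [|s]; first exact: carried_submodule.
rewrite /real -lock [X in carried _ X]fliftU; case: ifP => [_|_]; last exact: carried0.
by apply: carriedU => _ [x _ <-] /=; exists (comb s x).
Qed.

End Natural.

(** * Homotopy invariance for cycles *)

Section Inside.
Variables (R : realType) (F : nzRingType) (X : topologicalType).
Local Notation L m := {freeg (seq (prism R m)) / F}.

Definition inside (V : set X) m : set (singular R X m) := [set s | range s `<=` V].

Definition mkcont (A B : topologicalType) (f : A -> B) (lcoef : continuous f) : continuousType A B :=
  HB.pack f (isContinuous.Build A B f lcoef).

Lemma inside_face V m (i : 'I_m.+2) (s : singular R X m.+1) :
  inside V s -> inside V (s \o coface R i : singular R X m).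
Proof. by move=> sV _ [x _ <-] /=; apply: sV; exists (coface R i x). Qed.

Lemma sop_in (good : forall m, set (singular R X m)) (Phi : forall m, singular R X m -> continuousType (prism R m) X) V
   (Op : forall m, {linear L m -> L m}) m e c :
  (forall m (s : singular R X m), good m s -> range (Phi m s) `<=` V) -> carried (@good m) c ->
  carried (@inside V (e + m)) (sop Phi Op m e c).
Proof.
move=> gV; apply: (carried_map (f := sop Phi Op m e) (Q := carried (@inside V (e + m)))) => [|s gs].
  exact: carried_submodule.
rewrite sopU; have := @real_in _ F _ _ (Phi m s) (e + m) (Op m << top R m >>).
by apply: carried_sub => t /= ts; apply: subset_trans ts (gV _ _ gs).
Qed.

Lemma fst_continuous m : continuous (fst : prism R m -> std_simplex R m).
Proof. by move=> p; exact: cvg_fst. Qed.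

Definition pfst m : continuousType (prism R m) (std_simplex R m) := mkcont (@fst_continuous m).

(** Continuity of [H] is asked only along simplices inside [U], because the homotopies of the local
    model make sense only above a chart. *)
Theorem homotopy_cycle (H : R -> X -> X) (U V U' : set X) :
  (forall m (s : singular R X m), inside U s ->
     continuous (fun p : prism R m => H p.2 (s p.1))) ->
  (forall y, U y -> H 0 y = y) -> (forall t y, U y -> V (H t y)) ->
  (forall y, U y -> U' (H 1 y)) ->
  forall k (z : chain R F X k), carried (@inside U k) z -> bd R F X k z = 0 ->
  exists z' w, [/\ carried (@inside U' k) z', carried (@inside V k.+1) w &
    z - z' = bd R F X k.+1 w].
Proof.
move=> cH H0 HV H1 k z zU bz.
(* [Phi] must be total, so simplices along which [H] is not continuous get a constant homotopy as a
   dummy value. *)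
pose Phi m (s : singular R X m) : continuousType (prism R m) X :=
  if pselect (continuous (fun p : prism R m => H p.2 (s p.1))) is left c then mkcont c
  else (s \o pfst m).
have PhiE m (s : singular R X m) p : inside U s -> Phi m s p = H p.2 (s p.1).
  by move=> sU; rewrite /Phi; case: pselect => // h; case: (h (cH _ _ sU)).
pose O a m : {linear L m -> L m} := mapl (at_time a).
have nO a : natural (O a) 0.
  split=> [m n c|m i c|m]; last by rewrite /O maplU.
    by rewrite addn0; exact: sized_mapl.
  apply: (@flift_ext _ _ _ (mapl (pface i) \o O a m) (O a m.+1 \o mapl (pface i))) => s /=.
  by rewrite /O !maplU -!map_comp.
have bO a m (c : L m) : bdl (O a m c) = O a m (bdl c) by rewrite /O mapl_bdl.
have face : forall (m : nat) (i : 'I_m.+2) (s : singular R X m.+1) (p : prism R m),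
    inside U s -> Phi m (s \o coface R i : singular R X m) p = Phi m.+1 s (pface i p).
  by move=> m i s p sU; rewrite !PhiE//; exact: inside_face.
have hb : forall m (i : 'I_m.+2) (s : seq (prism R m)), (0 < size s)%N ->
    pface i (bary s) = bary (map (pface i) s) by move=> *; exact: pface_bary.
have := sop_fill_bd (F := F) (good := inside U) face (nO 0) (nO 1) (bO 0) (bO 1) hb zU bz.
set w := sop _ (fun m => fill _ _ _) _ _ _ => E; exists (sop Phi (O 1) k 0 z), w.
have OU a s : sop Phi (O a) k 0 << s >> = << (Phi k s \o comb (map (at_time a) (top R k)) : singular R X k) >>.
  by rewrite sopU /O maplU; apply: realU; rewrite size_map size_top.
split.
- move: (zU); apply: (carried_map (f := sop Phi (O 1) k 0) (Q := carried (@inside U' k))) => [|s sU].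
    exact: carried_submodule.
  rewrite OU; apply: carriedU => _ [x _ <-] /=; rewrite comb_top PhiE//=; apply: H1.
  by apply: sU; exists x.
- apply: (sop_in (e := 1%N) (m := k) (Phi := Phi) (good := inside U)) zU => m s sU _ [p _ <-]; rewrite PhiE//.
  by apply: HV; apply: sU; exists p.1.
rewrite -E; congr (_ - _); apply: (carried_eq (f := idfun) (g := sop Phi (O 0) k 0)) zU => s sU.
rewrite OU /=; congr << _ >>; apply/continuousEP => x /=.
by rewrite comb_top PhiE//= H0//; apply: sU; exists x.
Qed.

End Inside.
Arguments inside {R X} V m.

(** * Barycentric subdivision and chains of small simplices *)

Section Small.
Variables (R : realType) (F : nzRingType).
Local Notation S := (std_simplex R).
Local Notation L m := {freeg (seq (prism R m)) / F}.

(** The time coordinate is ignored, as it is by the map [s \o pfst] through which subdivided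
    simplices are realised. *)
Definition close m (r : R) (s : seq (prism R m)) :=
  forall p q, p \in s -> q \in s -> `| (set_val p.1 : 'rV[R]_m.+1) - set_val q.1 | <= r.

(* Convex hulls enter only through the closed balls that contain them *)
Definition hull m (s s' : seq (prism R m)) := forall (u : 'rV[R]_m.+1) rho,
  (forall p, p \in s -> `| set_val p.1 - u | <= rho) -> forall p, p \in s' -> `| set_val p.1 - u | <= rho.

Lemma comb_dist m (s : seq (prism R m)) j (x : S j) (u : 'rV[R]_m.+1) rho : size s = j.+1 ->
  (forall p, p \in s -> `| set_val p.1 - u | <= rho) -> `| set_val (comb s x).1 - u | <= rho.
Proof.
move=> sj sp; rewrite combE1.
have -> : u = \sum_i (set_val x : 'rV_j.+1) ord0 i *: u by rewrite -scaler_suml simplex_sum1 scale1r.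
rewrite -sumrB; apply: (le_trans (ler_norm_sum _ _ _)).
rewrite -[leRHS]mul1r -(simplex_sum1 x) mulr_suml; apply: ler_sum => i _.
rewrite -scalerBr normrZ ger0_norm ?simplex_ge0//; apply: ler_wpM2l; first exact: simplex_ge0.
by apply: sp; rewrite mem_nth// sj.
Qed.

Lemma bary_hull m (s : seq (prism R m)) : (0 < size s)%N -> hull s [:: bary s].
Proof. by move=> s0 u rho H p; rewrite inE => /eqP ->; apply: comb_dist => //; rewrite prednK. Qed.

(** In the average of the differences from [p] to the n + 1 vertices, the one at [p] itself is 0;
    the n others are at most [r] and have weight 1/(n + 1). *)
Lemma bary_dist m n (s : seq (prism R m)) r p : size s = n.+1 -> close r s -> p \in s ->
  `| set_val p.1 - set_val (bary s).1 | <= n%:R / n.+1%:R * r :> R.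
Proof.
move=> sn cs ps; have r0 : 0 <= r by have := cs _ _ ps ps; rewrite subrr normr0.
rewrite /bary sn combE1.
have E : (set_val p.1 : 'rV[R]_m.+1) = \sum_i (set_val (unif R n) : 'rV_n.+1) ord0 i *: set_val p.1.
  by rewrite -scaler_suml simplex_sum1 scale1r.
rewrite [X in X - _]E -sumrB; apply: (le_trans (ler_norm_sum _ _ _)).
have kn : (index p s < n.+1)%N by rewrite -sn index_mem.
rewrite (bigD1 (Ordinal kn))//= nth_index// subrr normr0 add0r.
apply: (@le_trans _ _ (\sum_(i < n.+1 | i != Ordinal kn) n.+1%:R^-1 * r)).
  apply: ler_sum => i _; rewrite -scalerBr normrZ mxE ger0_norm ?invr_ge0//.
  by apply: ler_wpM2l; rewrite ?invr_ge0//; apply: cs => //; rewrite mem_nth// sn.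
rewrite sumr_const (_ : #|_| = n); last by rewrite cardC1 card_ord.
by rewrite -[X in X <= _]mulr_natl mulrA.
Qed.

Lemma bdl_del m (s : seq (prism R m)) (Q : set (seq (prism R m))) :
  (forall i, (i < size s)%N -> Q (delnth i s)) -> carried Q (bdl << s >> : L m).
Proof.
move=> Qs; rewrite bdlU bd_seqE; apply: submodule_sum; first exact: carried_submodule.
by move=> i _; apply: carriedZ; apply: carriedU; exact: Qs.
Qed.

Lemma mem_delnth m i (s : seq (prism R m)) p : p \in delnth i s -> p \in s.
Proof. by rewrite mem_cat => /orP[/mem_take|/mem_drop]. Qed.

(** Needed for the cones in [sd_close]: the distance from the apex to the subdivided faces is
    bounded by its distance to the original vertices. *)
Lemma sd_hull m n (s : seq (prism R m)) : size s = n ->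
  carried (hull s) (sd (@bary R m) << s >> : L m).
Proof.
elim: n s => [|n IH] s sn; first by case: s sn => // _; rewrite sd_nil; apply: carriedU.
rewrite sdU ?sn//; set c := sd _ _.
have cs : carried (hull s) c.
  apply: (carried_map (f := sd (@bary R m)) (Q := carried (hull s)) _ _
    (bdl_del (Q := [set t | exists i, (i < size s)%N /\ t = delnth i s]) _)).
  - exact: carried_submodule.
  - move=> _ [i [im ->]]; have := IH (delnth i s); rewrite size_delnth// sn => /(_ erefl).
    by apply: carried_sub => t ht u rho H p pt; apply: (ht u rho) pt => q /mem_delnth; exact: H.
  - by move=> i im; exists i.
move: cs; apply: (carried_map (f := cone (bary s)) (Q := carried (hull s))); first exact: carried_submodule.
move=> t ht; rewrite coneU; apply: carriedU => u rho H p; rewrite inE => /orP[/eqP ->|]; last exact: (ht u).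
by apply: (bary_hull _ H); rewrite ?sn// inE.
Qed.

Lemma sd_close m n (s : seq (prism R m)) r : size s = n.+1 -> close r s ->
  carried [set t | close (n%:R / n.+1%:R * r) t] (sd (@bary R m) << s >> : L m).
Proof.
elim: n s => [|n IH] s sn cs.
  rewrite sdU ?sn//; case: s sn cs => [//|p [|//]] _ cs.
  rewrite bdlU /= linear0 subr0 sd_nil coneU; apply: carriedU => x y.
  by rewrite !inE => /eqP -> /eqP ->; rewrite subrr normr0 mul0r mul0r.
have r0 : 0 <= r.
  by case: s sn cs => [//|p s] _ /(_ p p); rewrite mem_head subrr normr0; apply.
rewrite sdU ?sn//; set c := sd _ _.
have cs' : carried [set t | close (n.+1%:R / n.+2%:R * r) t /\ hull s t] c.
  apply: (carried_map (f := sd (@bary R m)) (Q := carried _) _ _ (bdl_del (Q := [set t | exists i, (i < size s)%N /\ t = delnth i s]) _)).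
  - exact: carried_submodule.
  - move=> _ [i [im ->]]; have sz : size (delnth i s) = n.+1 by rewrite size_delnth// sn.
    have cd : close r (delnth i s) by move=> p q /mem_delnth ps /mem_delnth qs; exact: cs.
    move=> t tc; split; last first.
      have := sd_hull (n := n.+1) sz tc => ht u rho H p pt; apply: (ht u rho) pt => q /mem_delnth; exact: H.
    have := IH _ sz cd _ tc => ct p q pt qt; apply: (le_trans (ct p q pt qt)).
    (* The contraction factor n/(n + 1) obtained for a face is at most (n + 1)/(n + 2). *)
    apply: ler_wpM2r => //; rewrite ler_pdivrMr// mulrAC ler_pdivlMr//.
    by rewrite -!natrM ler_nat; lia.
  - by move=> i im; exists i.
move: cs'; apply: (carried_map (f := cone (bary s)) (Q := carried _)); first exact: carried_submodule.
move=> t [ct ht]; rewrite coneU; apply: carriedU => p q.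
have H x : x \in t -> `|set_val x.1 - set_val (bary s).1| <= n.+1%:R / n.+2%:R * r :> R.
  by apply: ht => y ys; exact: bary_dist.
rewrite !inE => /orP[/eqP ->|pt] /orP[/eqP ->|qt].
- by rewrite subrr normr0 mulr_ge0// divr_ge0.
- by rewrite distrC; exact: H.
- exact: H.
- exact: ct.
Qed.

Fixpoint sdn N m : {linear L m -> L m} :=
  if N is N'.+1 then sd (@bary R m) \o sdn N' m else idfun.

Lemma sdn_nat N : natural (sdn N) 0.
Proof.
elim: N => [|N [s1 f1 e1]]; first by split=> [m n c||]; rewrite ?addn0.
split=> [m n c /s1|m i c|m] /=; rewrite ?addn0; first exact: sd_deg.
  by rewrite -f1; apply: sd_nat => s; exact: pface_bary.
by rewrite e1 sd_nil.
Qed.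

Lemma sdn_bd N m (c : L m) : bdl (sdn N m c) = sdn N m (bdl c).
Proof. by elim: N => //= N IH; rewrite sd_bd IH. Qed.

Lemma sdn_close N m n (s : seq (prism R m)) r : size s = n.+1 -> close r s ->
  carried [set t | size t = n.+1 /\ close ((n%:R / n.+1%:R) ^+ N * r) t] (sdn N m << s >> : L m).
Proof.
move=> sn cs; elim: N => [|N IH] /=; first by apply: carriedU; rewrite /= expr0 mul1r.
move: IH; apply: (carried_map (f := sd (@bary R m)) (Q := carried _)); first exact: carried_submodule.
move=> t [tn ct] t' ht'; split; first by apply: (sd_deg (b := @bary R m)) ht'; exact: carriedU.
by rewrite exprS -mulrA; exact: (sd_close tn ct).
Qed.

Lemma near_simplex m (x : S m) (A : set (S m)) : nbhs x A ->
  exists2 e : R, 0 < e & forall y : S m, `| (set_val x : 'rV[R]_m.+1) - set_val y | < e -> A y.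
Proof.
rewrite nbhsE => -[W [[B oB BW] Wx] WA].
have Bx : B (set_val x) by move: Wx; rewrite -BW.
have /nbhs_ballP[e /= e0 eB] : nbhs (set_val x : 'rV[R]_m.+1) B by exact: open_nbhs_nbhs.
exists e => // y xy; apply: WA; rewrite -BW; apply: eB.
by rewrite -ball_normE.
Qed.

Lemma row_norm_le n (x : 'rV[R]_n) r : 0 <= r -> (forall i, `|x ord0 i| <= r) -> `|x| <= r.
Proof.
move=> r0 xr; rewrite /Num.norm /= mx_normrE; apply: bigmax_le => // -[i j] _ /=.
by rewrite (ord1 i).
Qed.

Lemma simplex_norm m (x : 'rV[R]_m.+1) : std_simplex R m x -> `|x| <= 1.
Proof.
move=> [x0 x1]; apply: row_norm_le => // i; rewrite ger0_norm// -x1 (bigD1 i)//= lerDl.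
by apply: sumr_ge0.
Qed.

Lemma compact_simplex m : compact (std_simplex R m).
Proof.
apply: bounded_closed_compact.
  by exists 1; split=> // r r1 x /simplex_norm x1; apply/ltW; apply: le_lt_trans r1.
have -> : std_simplex R m = (\bigcap_(i in [set: 'I_m.+1]) [set x | 0 <= x ord0 i]) `&` [set x | \sum_i x ord0 i = 1].
  by apply/seteqP; split=> x [x0 x1]; split=> // i; [move=> _|]; exact: x0.
apply: closedI.
  apply: closed_bigI => i _.
  apply: (@closed_comp _ _ (fun x : 'rV[R]_m.+1 => x ord0 i) [set t | 0 <= t]); last exact: closed_ge.
  by move=> x _; exact: coord_continuous.
apply: (@closed_comp _ _ (fun x : 'rV[R]_m.+1 => \sum_i x ord0 i) [set t | t = 1]); last exact: closed_eq.
move=> x _; apply: (@cvg_big R^o _ _ _ _ add_continuous _ _ _ _ _ (nbhs_filter x)) => i _.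
exact: coord_continuous.
Qed.

(** A Lebesgue number for the cover of the simplex by the preimages of [U1] and [U2]. Near-covering
    compactness makes the local radii uniform. *)
Lemma lebesgue_two m (X : topologicalType) (s : singular R X m) (U1 U2 : set X) :
  open U1 -> open U2 -> inside (U1 `|` U2) m s ->
  exists2 e : R, 0 < e & forall x : S m,
    (forall y : S m, `| (set_val x : 'rV[R]_m.+1) - set_val y | < e -> U1 (s y)) \/
    (forall y : S m, `| (set_val x : 'rV[R]_m.+1) - set_val y | < e -> U2 (s y)).
Proof.
move=> oU1 oU2 sU.
pose P (e : R) (u : 'rV[R]_m.+1) := forall x : S m, set_val x = u ->
    (forall y : S m, `| u - set_val y | < e -> U1 (s y)) \/
    (forall y : S m, `| u - set_val y | < e -> U2 (s y)).
have /compact_near_coveringP/(_ R (0^'+)%R P) := @compact_simplex m.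
have key (U : set X) (x : S m) : open U -> U (s x) -> exists2 e : R, 0 < e & 
    forall u (y : S m), `| (set_val x : 'rV[R]_m.+1) - u | < e -> `| u - set_val y | < e -> U (s y).
  move=> oU Ux; have : nbhs x (s @^-1` U) by apply: (@cts_fun _ _ s x); exact: open_nbhs_nbhs.
  move=> /near_simplex[e e0 eU]; exists (e / 2) => [|u y xu uy]; first by rewrite divr_gt0.
  apply: eU; rewrite -[X in `|X|](subrKA u); apply: le_lt_trans (ler_normD _ _) _.
  by rewrite [e]splitr ltrD.
case=> [u /mem_set uS|e].
  pose x : S m := SigSub uS.
  have : (U1 `|` U2) (s x) by apply: sU; exists x.
  have cx U : open U -> U (s x) -> \forall u' \near u & e \near (0:R)^'+, 
      forall y : S m, `| u' - set_val y | < e -> U (s y).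
    move=> oU Ux; have [e e0 eU] := key _ _ oU Ux.
    near=> u' d.
    have ue : `|u - u'| < e by near: u'; exact: cvgr_dist_lt.
    have de : d < e by near: d; exact: nbhs_right_lt.
    by move=> y uy; apply: (eU u') => //; exact: lt_trans uy de.
  move=> [/(cx _ oU1)|/(cx _ oU2)]; apply: filterS => -[u' d] /= H y _; [left|right]; exact: H.
move=> e0 eP; exists (e / 2) => [|x]; first by rewrite divr_gt0.
have e2 : 0 < e / 2 by rewrite divr_gt0.
apply: (eP (e / 2)) => //.
  by rewrite /= sub0r normrN gtr0_norm// ltr_pdivrMr// ltr_pMr// ltr1n.
exact: (set_valP x).
Unshelve. all: by end_near. Qed.

Lemma expr_small (q r e : R) : 0 <= q < 1 -> 0 < e -> exists N0, forall N, (N0 <= N)%N -> q ^+ N * r < e.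
Proof.
move=> /andP[q0 q1] e0.
have : q ^+ N * r @[N --> \oo] --> 0 * r.
  by apply: cvgM; [apply: cvg_expr; rewrite ger0_norm|exact: cvg_cst].
rewrite mul0r => /cvgr_lt /(_ _ e0) [N0 _ H]; by exists N0 => N; exact: H.
Qed.

Theorem small_cycle (X : topologicalType) (U1 U2 : set X) : open U1 -> open U2 ->
  forall k (z : chain R F X k), carried (inside (U1 `|` U2) k) z -> bd R F X k z = 0 ->
  exists c1 c2 w, [/\ carried (inside U1 k) c1, carried (inside U2 k) c2,
    carried (inside (U1 `|` U2) k.+1) w & z - (c1 + c2) = bd R F X k.+1 w].
Proof.
move=> oU1 oU2 k z zU bz.
pose Phi m (s : singular R X m) : continuousType (prism R m) X := s \o pfst R m.
pose Sd N : {linear chain R F X k -> chain R F X k} := sop Phi (sdn N) k 0.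
pose Q : set (chain R F X k) := [set c | exists c1 c2, [/\ carried (inside U1 k) c1,
  carried (inside U2 k) c2 & c = c1 + c2]].
have sQ : submodule Q.
  split=> [|a _ _ [c1 [c2 [h1 h2 ->]]] [d1 [d2 [g1 g2 ->]]]].
    by exists 0, 0; split; [exact: carried0|exact: carried0|rewrite addr0].
  exists (a *: c1 + d1), (a *: c2 + d2); split; first exact: (carriedD (carriedZ h1) g1).
    exact: (carriedD (carriedZ h2) g2).
  by rewrite scalerDr addrACA.
(* Asking for all large [N], and not for some [N], makes [P] a submodule, so that a single number of
   subdivisions serves all simplices of a chain. *)
pose P : set (chain R F X k) := [set c | exists N0, forall N, (N0 <= N)%N -> Q (Sd N c)].
have sP : submodule P.
  split=> [|a x y [N Nx] [M My]]; first by exists 0%N => N _; rewrite linear0; exact: sQ.1.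
  exists (maxn N M) => K; rewrite geq_max => /andP[NK MK]; rewrite linearP.
  by apply: sQ.2; [exact: Nx|exact: My].
have [N0 /(_ N0 (leqnn _))[c1 [c2 [h1 h2 zE]]]] : P z.
  move: zU; apply: carried_ind => // s sU.
  have [e e0 eP] := lebesgue_two oU1 oU2 sU.
  (* One subdivision shrinks by k/(k + 1), and 2 bounds the diameter of the standard simplex, whose
     points have norm at most 1. *)
  have [|N0 NP] := @expr_small (k%:R / k.+1%:R) 2 e _ e0.
    by rewrite divr_ge0//= ltr_pdivrMr// mul1r ltr_nat.
  exists N0 => N /NP Ne; rewrite /Sd sopU.
  have ct : close 2 (top R k).
    move=> p q _ _; apply: le_trans (ler_normB _ _) _; rewrite -[2]/(1 + 1).
    by apply: lerD; apply: simplex_norm; exact: (set_valP _).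
  have := sdn_close (N := N) (size_top R k) ct; apply: (carried_map (f := real (Phi k s) k) (Q := Q)) => // t [tk tc].
  rewrite realU//.
  have t0 : nth (prism0 R k) t 0 \in t by rewrite mem_nth// tk.
  have near_t (y : S k) : `| set_val (nth (prism0 R k) t 0).1 - set_val (comb t y).1 | < e :> R.
    rewrite distrC; apply: le_lt_trans Ne; apply: comb_dist => // p pt; exact: tc.
  case: (eP (nth (prism0 R k) t 0).1) => H; [exists << (Phi k s \o comb t : singular R X k) >>, 0|
      exists 0, << (Phi k s \o comb t : singular R X k) >>]; split; rewrite ?addr0 ?add0r //.
  - by apply: carriedU => _ [y _ <-]; exact: H (near_t y).
  - exact: carried0.
  - exact: carried0.
  - by apply: carriedU => _ [y _ <-]; exact: H (near_t y).
have n0 : natural (R := R) (fun m => idfun : {linear L m -> L m}) 0 by split=> // m n c; rewrite addn0.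
have face m (i : 'I_m.+2) (s : singular R X m.+1) (p : prism R m) :
    inside (U1 `|` U2) m.+1 s -> Phi m (s \o coface R i : singular R X m) p = Phi m.+1 s (pface i p) by [].
have hb : forall m (i : 'I_m.+2) (s : seq (prism R m)), (0 < size s)%N ->
    pface i (bary s) = bary (map (pface i) s) by move=> *; exact: pface_bary.
have := sop_fill_bd (F := F) (good := inside (U1 `|` U2)) face n0 (sdn_nat N0) (fun m c => erefl) (sdn_bd N0) hb zU bz.
set w := sop _ (fun m => fill _ _ _) _ _ _ => E; exists c1, c2, w; split=> //.
  apply: (sop_in (e := 1%N) (m := k) (Phi := Phi) (good := inside (U1 `|` U2))) zU => m s sU _ [p _ <-].
  by apply: sU; exists p.1.
rewrite -zE -E; congr (_ - _); apply: (carried_eq (f := idfun) (g := sop Phi (fun m => idfun : {linear L m -> L m}) k 0)) zU => s sU.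
rewrite sopU /= [RHS]realU ?size_top//; congr << _ >>; apply/continuousEP => x.
have topE : map (at_time 0) (top R k) = top R k by rewrite /top -map_comp; exact: eq_map.
by have := congr1 (fun p => s p.1) (comb_top 0 x); rewrite topE => /= ->.
Qed.

End Small.

(** * Chains as modules over the polynomials in the shift *)

(* [pmod tau] is [V] with ['X] acting by [tau] *)
Section PolyAction.
Variables (F : comNzRingType) (V : lmodType F) (tau : {linear V -> V}).

Definition pmod (t : {linear V -> V}) : Type := V.
HB.instance Definition _ t := GRing.Zmodule.on (pmod t).

Definition pact (p : {poly F}) (v : pmod tau) : pmod tau := \sum_(i < size p) p`_i *: iter i tau v.

Lemma pactE n (p : {poly F}) (v : pmod tau) : (size p <= n)%N -> pact p v = \sum_(i < n) p`_i *: iter i tau v.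
Proof.
move=> pn; rewrite /pact (big_ord_widen n (fun i => p`_i *: iter i tau v)) //.
rewrite [RHS](bigID (fun i : 'I_n => (i < size p)%N)) /= [X in _ + X]big1 ?addr0// => i.
by rewrite -leqNgt => /(nth_default 0) ->; rewrite scale0r.
Qed.

Lemma iter_tau_linear i : linear (iter i tau).
Proof. by move=> a x y; elim: i => //= i ->; rewrite linearP. Qed.

Lemma pactDl p q v : pact (p + q) v = pact p v + pact q v.
Proof.
pose n := maxn (size p) (size q).
rewrite (@pactE n (p + q)) ?size_polyD// (@pactE n p) ?leq_maxl// (@pactE n q) ?leq_maxr//.
by rewrite -big_split; apply: eq_bigr => i _; rewrite coefD scalerDl.
Qed.

Lemma pactDr p u v : pact p (u + v) = pact p u + pact p v.
Proof.
rewrite -big_split; apply: eq_bigr => i _.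
by have := iter_tau_linear i 1 u v; rewrite !scale1r => ->; rewrite scalerDr.
Qed.

Lemma pactC c v : pact c%:P v = c *: v.
Proof. by rewrite (@pactE 1) ?size_polyC ?leq_b1// big_ord1 coefC. Qed.

Lemma pactMX p v : pact (p * 'X) v = tau (pact p v).
Proof.
rewrite (@pactE (size p).+1) ?(leq_trans (size_polyMleq _ _)) ?size_polyX ?addn2//.
rewrite big_ord_recl coefMX scale0r add0r linear_sum; apply: eq_bigr => i _.
by rewrite coefMX linearZ.
Qed.

Lemma pactM p q v : pact p (pact q v) = pact (p * q) v.
Proof.
elim/poly_ind: p q v => [|p c IH] q v.
  by rewrite mul0r {1}/pact size_poly0 big_ord0 /pact size_poly0 big_ord0.
rewrite mulrDl -mulrA ['X * q]mulrC mulrA !pactDl !pactMX IH; congr (_ + _).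
elim/poly_ind: q v => [|q d IH'] v.
  by rewrite mulr0 pactC /pact size_poly0 !big_ord0 scaler0.
rewrite mulrDr mulrA !pactDl !pactC !pactMX -IH' pactC linearZ scalerDr; congr (_ + _).
by rewrite -polyCM pactC scalerA.
Qed.

Lemma pact1 v : pact 1 v = v.
Proof. by rewrite pactC scale1r. Qed.

HB.instance Definition _ := GRing.Zmodule_isLmodule.Build {poly F} (pmod tau)
  pactM pact1 pactDr (fun v p q => pactDl p q v).

Lemma pmodE (p : {poly F}) (v : pmod tau) : p *: v = pact p v. Proof. by []. Qed.

Lemma pmod_submodule (Q : set V) : submodule Q -> (forall v, Q v -> Q (tau v)) ->
  submodule (Q : set (pmod tau)).
Proof.
move=> sQ Qt; split=> [|p x y Qx Qy]; first exact: sQ.1.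
apply: (submoduleD sQ) Qy; rewrite pmodE; apply: submodule_sum => // i _.
by apply: submoduleZ => //; elim: (nat_of_ord i) => //= j; exact: Qt.
Qed.

End PolyAction.
Arguments pmod {F V} t.

Lemma pmod_linear (F : comNzRingType) (V W : lmodType F) (tau : {linear V -> V})
    (sigma : {linear W -> W}) (f : {linear V -> W}) :
  (forall v, f (tau v) = sigma (f v)) -> linear (f : pmod tau -> pmod sigma).
Proof.
move=> ft p x y; rewrite [LHS]linearD; congr (_ + _).
rewrite !pmodE /pact linear_sum; apply: eq_bigr => i _; rewrite linearZ.
have -> : f (iter i tau x) = iter i sigma (f x); last by [].
by elim: (nat_of_ord i) => //= j <-; rewrite ft.
Qed.

(** * Submodules of free modules over F[t], and noetherianity *)

Section PID.
Variable F : fieldType.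
Local Notation R := {poly F}.

(** Induction on the rank. The first coordinates form an ideal; if it is not zero, an element [x0]
    of [N] with first coordinate of least degree splits off by Euclidean division, and the rest of
    [N] has first coordinate 0. *)
Lemma poly_submodule_basis r (N : set 'rV[R]_r) : submodule N ->
  exists r' (M : 'M[R]_(r', r)), [/\ forall y, N (y *m M),
    forall x, N x -> exists y, x = y *m M & forall y : 'rV_r', y *m M = 0 -> y = 0].
Proof.
elim: r N => [N sN|r IH].
  exists 0%N, 0; split=> [y|x _|y _]; last by rewrite thinmx0.
    by rewrite mulmx0; exact: sN.1.
  by exists 0; rewrite mulmx0 thinmx0.
rewrite -[r.+1]/(1 + r)%N => N sN.
pose emb (x : 'rV[R]_r) : 'rV[R]_(1 + r) := row_mx 0 x.
have embL : linear emb by move=> a x y; rewrite /emb scale_row_mx add_row_mx scaler0 addr0.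
have sN' : submodule (emb @^-1` N).
  split=> [|a x y Nx Ny]; rewrite /preimage /=; first by rewrite /emb row_mx0; exact: sN.1.
  by rewrite embL; exact: sN.2.
have [r' [M [MN NM Minj]]] := IH _ sN'.
have [allz|] := pselect (forall x : 'rV[R]_(1 + r), N x -> lsubmx x = 0).
  exists r', (row_mx 0 M : 'M[R]_(r', 1 + r)); split=> [y|x Nx|y].
  - by rewrite mul_mx_row mulmx0; exact: MN.
  - have [|y yE] := NM (rsubmx (x : 'rV_(1 + r))).
      by rewrite /preimage /= /emb -(allz _ Nx) hsubmxK.
    by exists y; rewrite mul_mx_row mulmx0 -yE -(allz _ Nx) hsubmxK.
  - by rewrite mul_mx_row mulmx0 -row_mx0 => /eq_row_mx[_ /Minj].
move=> /existsNP[x1 /not_implyP[Nx1 x10]].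
pose deg (x : 'rV[R]_(1 + r)) := size (lsubmx x 0 0).
have nz (x : 'rV[R]_(1 + r)) : lsubmx x <> 0 -> lsubmx x 0 0 != 0.
  by move=> h; apply/eqP => h0; apply: h; apply/matrixP => i j; rewrite !ord1 h0 mxE.
pose Pd d : bool := `[< exists x, [/\ N x, lsubmx (x : 'rV_(1 + r)) <> 0 & deg x = d] >].
have exd : exists d, Pd d.
  by exists (deg x1); apply/asboolP; exists x1.
case: (ex_minnP exd) => m /asboolP[x0 [Nx0 x00 degx0]] mmin.
pose a := lsubmx (x0 : 'rV_(1 + r)) 0 0.
have redu x : N x -> exists c y, N (emb y) /\ x = c *: x0 + emb y.
  move=> Nx; pose b := lsubmx (x : 'rV_(1 + r)) 0 0; pose c := b %/ a.
  pose z : 'rV[R]_(1 + r) := x - c *: x0.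
  have Nz : N z by rewrite /z addrC -scaleNr; exact: sN.2.
  have zl : lsubmx z 0 0 = b %% a.
    have -> : lsubmx z 0 0 = b - c * a by rewrite /z /b /a !mxE.
    by rewrite {1}(divp_eq b a) addrC addKr.
  have z0 : lsubmx z = 0.
    apply: contrapT => /[dup] z0 /nz zn0.
    have : (m <= deg z)%N by apply: mmin; apply/asboolP; exists z.
    by rewrite leqNgt -degx0 /deg zl ltn_modp nz.
  exists c, (rsubmx z); rewrite /emb -z0 hsubmxK; split=> //.
  by rewrite /z addrC subrK.
exists (1 + r')%N, (col_mx x0 (row_mx 0 M) : 'M[R]_(1 + r', 1 + r)); split=> [y|x Nx|y].
- rewrite -[y]hsubmxK mul_row_col mul_mx_row mulmx0 [lsubmx y]mx11_scalar mul_scalar_mx.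
  by apply: sN.2 => //; exact: MN.
- have [c [y [Ny ->]]] := redu _ Nx; have [w ->] := NM _ Ny.
  exists (row_mx c%:M w); rewrite mul_row_col mul_scalar_mx; congr (_ + _).
  by rewrite /emb mul_mx_row mulmx0.
rewrite -[y]hsubmxK mul_row_col mul_mx_row mulmx0 [lsubmx y]mx11_scalar mul_scalar_mx.
set c := lsubmx y 0 0 => E.
have c0 : c = 0.
  have : c * a = 0.
    have := congr1 (fun v : 'rV[R]_(1 + r) => lsubmx v 0 0) E.
    by rewrite linearD/= linearZ/= row_mxKl addr0 linear0 !mxE => <-; rewrite /a !mxE.
  by move/eqP; rewrite mulf_eq0 (negbTE (nz _ x00)) orbF => /eqP.
move: E; rewrite c0 scale0r add0r -row_mx0 => /eq_row_mx[_ /Minj ->].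
by rewrite -[RHS]row_mx0; congr row_mx; apply/matrixP => i j; rewrite !mxE mul0rn.
Qed.

End PID.

Section Fg.
Variables (F : fieldType).
Local Notation R := {poly F}.
Variable M : lmodType R.
Implicit Types (P N : set M).

(* The image of [P] in [M / N] is finitely generated; [N] need not lie in [P] *)
Definition fgmod P N := exists r (g : 'I_r -> M),
  (forall i, P (g i)) /\ forall z, P z -> exists a : 'I_r -> R, N (z - \sum_i a i *: g i).

(** The [g i] need not lie in [P]. The coefficient vectors whose combination is congruent to an
    element of [P] modulo [N] form a submodule of a free module, and lifts of its basis are
    generators inside [P]. *)
Lemma fgmod_noeth P N r (g : 'I_r -> M) : submodule P -> submodule N ->
  (forall z, P z -> exists a : 'I_r -> R, N (z - \sum_i a i *: g i)) -> fgmod P N.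
Proof.
move=> sP sN gP.
pose comb (a : 'rV[R]_r) := \sum_i a 0 i *: g i.
have combP k (a b : 'rV[R]_r) : comb (k *: a + b) = k *: comb a + comb b.
  rewrite /comb scaler_sumr -big_split; apply: eq_bigr => i _.
  by rewrite !mxE scalerDl scalerA.
pose K : set 'rV[R]_r := [set a | exists z, P z /\ N (z - comb a)].
have sK : submodule K.
  split=> [|k a b [z [Pz Nz]] [w [Pw Nw]]].
    exists 0; split; first exact: sP.1.
    by rewrite /comb big1 ?subrr => [|i _]; [exact: sN.1|rewrite mxE scale0r].
  exists (k *: z + w); split; first exact: sP.2.
  rewrite combP [X in N X](_ : _ = k *: (z - comb a) + (w - comb b)); first exact: sN.2.
  by rewrite scalerBr addrACA opprD.
have [r' [A [AK KA _]]] := poly_submodule_basis sK.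
have /choice[h hP] : forall q : 'I_r', exists z, P z /\ N (z - comb (row q A)).
  by move=> q; have := AK (delta_mx 0 q); rewrite -rowE.
exists r', h; split=> [q|z Pz]; first by have [] := hP q.
have [a Na] := gP _ Pz; have [|y aE] := KA (\row_i a i).
  exists z; split=> //; rewrite /comb; under eq_bigr do rewrite mxE; exact: Na.
exists (y 0); rewrite [X in N X](_ : _ = (z - \sum_i a i *: g i) - \sum_q y 0 q *: (h q - comb (row q A))).
  apply: submoduleB => //; apply: submodule_sum => // q _; apply: submoduleZ => //.
  by have [] := hP q.
have -> : \sum_i a i *: g i = \sum_q y 0 q *: comb (row q A).
  transitivity (comb (y *m A)); first by rewrite -aE; apply: eq_bigr => i _; rewrite mxE.
  rewrite mulmx_sum_row (big_morph comb (id1 := 0) (op1 := +%R)).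
  - apply: eq_bigr => q _; have := combP (y 0 q) (row q A) 0; rewrite !addr0 => ->.
    by rewrite [X in _ + X]/comb big1 ?addr0// => i _; rewrite mxE scale0r.
  - by move=> u v; have := combP 1 u v; rewrite !scale1r.
  - by rewrite /comb big1// => i _; rewrite mxE scale0r.
rewrite [X in _ - _ - X](eq_bigr (fun q => y 0 q *: h q - y 0 q *: comb (row q A))) => [|q _]; last by rewrite scalerBr.
by rewrite sumrB opprB addrA subrK.
Qed.

Definition gcat r1 r2 (T : Type) (g1 : 'I_r1 -> T) (g2 : 'I_r2 -> T) (i : 'I_(r1 + r2)) : T :=
  match fintype.split i with inl j => g1 j | inr j => g2 j end.

Lemma gcat_span N r1 r2 (g1 : 'I_r1 -> M) (g2 : 'I_r2 -> M) z1 z2 : submodule N ->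
  (exists a : 'I_r1 -> R, N (z1 - \sum_i a i *: g1 i)) ->
  (exists a : 'I_r2 -> R, N (z2 - \sum_i a i *: g2 i)) ->
  exists a : 'I_(r1 + r2) -> R, N (z1 + z2 - \sum_i a i *: gcat g1 g2 i).
Proof.
move=> sN [a1 h1] [a2 h2]; exists (gcat a1 a2).
rewrite big_split_ord /= [X in N X](_ : _ = (z1 - \sum_i a1 i *: g1 i) + (z2 - \sum_i a2 i *: g2 i)).
  exact: submoduleD.
rewrite opprD addrACA; congr (_ - _ + (_ - _)); apply: eq_bigr => i _; rewrite /gcat.
  by rewrite (unsplitK (inl i)).
by rewrite (unsplitK (inr i)).
Qed.

Lemma fgmod_sub P P' N : submodule P' -> submodule N -> P' `<=` P -> fgmod P N -> fgmod P' N.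
Proof.
move=> sP' sN P'P [r [g [_ gP]]]; apply: (@fgmod_noeth _ _ r g) => // z Pz; exact/gP/P'P.
Qed.

End Fg.

Section PolyChain.
Variables (R : realType) (F : comNzRingType) (X : topologicalType) (tau : continuousType X X).
Local Notation chain := (chain R F X).
Local Notation bd := (bd R F X).

Definition pchain k : lmodType {poly F} := pmod (chain_map R F tau k).

Lemma pbd_linear k : linear (bd k : pchain k -> pchain k.-1).
Proof. by apply: pmod_linear => c; rewrite bd_chain_map. Qed.
Definition pbd k : {linear pchain k -> pchain k.-1} :=
  HB.pack (bd k : pchain k -> pchain k.-1) (GRing.isLinear.Build _ _ _ _ _ (@pbd_linear k)).

Lemma pbdP k (p : {poly F}) (c e : pchain k) :
  bd k (p *: c + e) = p *: (bd k c : pchain k.-1) + (bd k e : pchain k.-1) :> pchain k.-1.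
Proof. exact: pbd_linear. Qed.

End PolyChain.

(** * Finite generation of images in homology, and Mayer-Vietoris *)

Section TopFg.
Variables (R : realType) (F : fieldType) (X : topologicalType) (tau : continuousType X X).
Local Notation chain := (chain R F X).
Local Notation bd := (bd R F X).
Local Notation pchain := (@pchain R F X tau).
Local Notation pbd := (pbd R F tau).

Definition stable (V : set X) := forall y, V y -> V (tau y).

Lemma inside_submodule V k : stable V -> submodule (carried (inside (R := R) V k) : set (pchain k)).
Proof.
move=> sV; apply: pmod_submodule => [|c]; first exact: carried_submodule.
apply: (carried_map (f := chain_map R F tau k) (Q := carried (inside V k))) => [|s ss].
  exact: carried_submodule.
by rewrite chain_mapU; apply: carriedU => _ [x _ <-] /=; apply/sV/ss; exists x.
Qed.

Lemma bd_in V k c : carried (inside (R := R) V k) c -> carried (inside V k.-1) (bd k c).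
Proof.
apply: (carried_map (f := bd k) (Q := carried (inside V k.-1))) => [|s]; first exact: carried_submodule.
rewrite /preimage bdU; case: k s {c} => [|k] s ss /=; first exact: carried0.
apply: submodule_sum => [|i _]; first exact: carried_submodule.
by apply: carriedZ; apply: carriedU; exact: inside_face.
Qed.

Lemma bd0 c : bd 0 c = 0.
Proof.
apply: (freeg_map (f := bd 0) (Q := [set 0])) => [|x]; last by rewrite bdU.
by split=> // a x y -> ->; rewrite scaler0 addr0.
Qed.

(** Every singular simplex is the realisation of the fundamental affine simplex, so the identity is
    inherited from [bdl_bdl]. *)
Lemma bd_bd k c : bd k (bd k.+1 c) = 0.
Proof.
case: k c => [|k] c; first exact: bd0.
apply: (flift_ext (f := bd k.+1 \o bd k.+2) (g := \0)) => s.
change (bd k.+1 (bd k.+2 << s >>) = 0).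
have -> : << s >> = real (F := F) (s \o pfst R k.+2 : continuousType _ _) k.+2 << top R k.+2 >>.
  rewrite realU ?size_top//; congr << _ >>; apply/continuousEP => x.
  have topE : map (at_time 0) (top R k.+2) = top R k.+2 by rewrite /top -map_comp; exact: eq_map.
  by have := congr1 (fun p => s p.1) (comb_top 0 x); rewrite topE => /= ->.
have st : sized k.+3 (<< top R k.+2 >> : {freeg _ / F}) by apply: carriedU; rewrite /= size_top.
rewrite real_bd// real_bd ?bdl_bdl ?linear0//; exact: (sized_bdl (n := k.+3)).
Qed.

Definition cyc U k : set (pchain k) := [set c | carried (inside (R := R) U k) c /\ bd k c = 0].
Definition bnd V k : set (pchain k) := [set c | exists2 w, carried (inside (R := R) V k.+1) w & c = bd k.+1 w].

Lemma cyc_submodule U k : stable U -> submodule (@cyc U k).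
Proof.
move=> sU; split=> [|p x y [xU bx] [yU by_]]; first by split; [exact: carried0|rewrite linear0].
split; first exact: (inside_submodule k sU).2.
by rewrite pbdP bx by_ scaler0 addr0.
Qed.

Lemma bnd_submodule V k : stable V -> submodule (@bnd V k).
Proof.
move=> sV; split=> [|p _ _ [v vV ->] [w wV ->]]; first by exists 0; [exact: carried0|rewrite linear0].
exists ((p *: (v : pchain k.+1) : pchain k.+1) + w); first exact: (inside_submodule k.+1 sV).2.
by rewrite pbdP.
Qed.

Lemma cyc_sub U V k : U `<=` V -> @cyc U k `<=` @cyc V k.
Proof.
move=> UV c [cU bc]; split=> //; apply: carried_sub cU => s sU; exact: subset_trans sU UV.
Qed.

Lemma bnd_sub U V k : U `<=` V -> @bnd U k `<=` @bnd V k.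
Proof.
move=> UV _ [w wU ->]; exists w => //; apply: carried_sub wU => s sU; exact: subset_trans sU UV.
Qed.

(* The image of [H_k(U)] in [H_k(V)] is finitely generated *)
Definition fgH k U V := fgmod (@cyc U k) (@bnd V k).

Lemma fgH_sub k U U' V V' : stable U' -> stable V' -> U' `<=` U -> V `<=` V' ->
  fgH k U V -> fgH k U' V'.
Proof.
move=> sU' sV' UU' VV' [r [g [_ gP]]]; apply: (@fgmod_noeth _ _ _ _ r g).
- exact: cyc_submodule.
- exact: bnd_submodule.
by move=> z /(cyc_sub UU') /gP[a az]; exists a; exact: bnd_sub az.
Qed.

Lemma fgH_empty k U V : stable V -> U `<=` set0 -> fgH k U V.
Proof.
move=> sV U0; exists 0%N, (fun=> 0); split=> [[]//|z [zU _]]; exists (fun=> 0).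
have -> : z = 0; last by rewrite big_ord0 subr0; exact: (bnd_submodule k sV).1.
apply: (carried_eq (f := idfun : {linear chain k -> chain k}) (g := \0)) zU => s sU.
by case: (U0 (s (vertex R ord0))); apply: sU; exists (vertex R ord0).
Qed.

(* Mayer-Vietoris: a cycle of the union splits as [c1 + c2], and the classes of [bd c1] form a finitely generated
   submodule by the hypothesis in degree [k.-1] *)
Lemma fgH_union k U1 U2 V1 V2 V W :
  stable U1 -> stable U2 -> stable V1 -> stable V2 -> stable V -> stable W ->
  open U1 -> open U2 -> U1 `<=` V1 -> U2 `<=` V2 -> V1 `<=` V -> V2 `<=` V ->
  U1 `&` U2 `<=` W ->
  fgH k V1 V -> fgH k V2 V -> ((0 < k)%N -> fgH k.-1 W (V1 `&` V2)) ->
  fgH k (U1 `|` U2) V.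
Proof.
move=> sU1 sU2 sV1 sV2 sV sW oU1 oU2 UV1 UV2 VV1 VV2 UW [r1 [g1 [_ G1]]] [r2 [g2 [_ G2]]] GW.
have sV12 : stable (V1 `&` V2) by move=> y [y1 y2]; split; [exact: sV1|exact: sV2].
have [r [e1 [e2 [eP GD]]]] : exists r (e1 e2 : 'I_r -> pchain k),
  (forall i, [/\ carried (inside U1 k) (e1 i), carried (inside U2 k) (e2 i) & bd k (e1 i + e2 i) = 0]) /\
  forall c1 c2 : pchain k, carried (inside U1 k) c1 -> carried (inside U2 k) c2 -> bd k (c1 + c2) = 0 ->
  exists a : 'I_r -> {poly F}, exists2 e : pchain k, carried (inside (V1 `&` V2) k) e &
    bd k (c1 - \sum_i a i *: e1 i) = bd k e.
  case: k {G1 G2 g1 g2} GW => [|k] GW.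
    exists 0%N, (fun=> 0), (fun=> 0); split=> [[]//|c1 c2 _ _ _].
    by exists (fun=> 0), 0; [exact: carried0|rewrite !bd0].
  pose D : set (pchain k) := [set d | exists c1 c2 : pchain k.+1, [/\ carried (inside U1 k.+1) c1, carried (inside U2 k.+1) c2,
    bd k.+1 (c1 + c2) = 0 & d = bd k.+1 c1]].
  have sD : submodule D.
    split=> [|p _ _ [c1 [c2 [h1 h2 h3 ->]]] [e1 [e2 [f1 f2 f3 ->]]]].
      by exists 0, 0; split; rewrite ?addr0 ?linear0//; exact: carried0.
    exists (p *: c1 + e1), (p *: c2 + e2); split.
    - exact: (inside_submodule k.+1 sU1).2.
    - exact: (inside_submodule k.+1 sU2).2.
    - by rewrite addrACA -scalerDr pbdP h3 f3 scaler0 addr0.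
    - by rewrite pbdP.
  have [r [d [dD Gd]]] : fgmod D (@bnd (V1 `&` V2) k).
    have sB := bnd_submodule k sV12; have := GW isT; apply: fgmod_sub => // _ [c1 [c2 [h1 h2 h3 ->]]].
    split; last exact: bd_bd.
    apply: carried_sub (_ : carried (inside (U1 `&` U2) k) _) => [s ss|]; first exact: subset_trans ss UW.
    move=> s sc; rewrite /inside /= subsetI; split; first exact: (bd_in h1) sc.
    (* The boundary of [c1] is minus that of [c2], so it is carried by [U2] as well. *)
    have := bd_in h2; apply; move: h3; rewrite linearD => /eqP; rewrite addr_eq0 => /eqP h3.
    by move: sc; rewrite h3 coeffN oppr_eq0.
  have /choice[e1 /choice[e2 eP]] : forall i, exists c1 c2 : pchain k.+1, [/\ carried (inside U1 k.+1) c1, carried (inside U2 k.+1) c2,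
    bd k.+1 (c1 + c2) = 0 & d i = bd k.+1 c1] by exact: dD.
  exists r, e1, e2; split=> [i|c1 c2 h1 h2 h3]; first by have [] := eP i.
  have [|a [w wV aw]] := Gd (bd k.+1 c1); first by exists c1, c2.
  exists a, w => //; rewrite -aw linearB; congr (_ - _).
  have := linear_sum (pbd k.+1) => /= ->; apply: eq_bigr => i _.
  by have := pbdP (a i) (e1 i) 0; rewrite linear0 !addr0 => ->; have [_ _ _ ->] := eP i.
have sB := bnd_submodule k sV.
apply: (@fgmod_noeth _ _ _ _ _ (gcat (fun i => e1 i + e2 i) (gcat g1 g2))) => //.
  by apply: cyc_submodule => y [/sU1|/sU2]; [left|right].
move=> z [zU bz].
have [c1 [c2 [w [h1 h2 wU zw]]]] : exists (c1 c2 : pchain k) (w : pchain k.+1),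
    [/\ carried (inside U1 k) c1, carried (inside U2 k) c2,
    carried (inside (U1 `|` U2) k.+1) w & z - (c1 + c2) = bd k.+1 w].
  by have [c1 [c2 [w [h1 h2 wU zw]]]] := small_cycle oU1 oU2 zU bz; exists c1, c2, w.
have bc : bd k (c1 + c2) = 0 by rewrite -[_ + c2](subKr z) zw linearB bz bd_bd subrr.
have [a [e eV ae]] := GD c1 c2 h1 h2 bc.
set S1 := \sum_i _ in ae; pose S2 : pchain k := \sum_i a i *: e2 i.
(* [c1 - S1] and [e] have the same boundary, and [e] lies in both [V1] and [V2]. Moving [e] from one
   summand to the other turns both summands into cycles without changing the sum. *)
pose u1 : pchain k := c1 - S1 - e; pose u2 : pchain k := c2 - S2 + e.
have S12 : S1 + S2 = \sum_i a i *: (e1 i + e2 i).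
  by rewrite /S1 /S2 -big_split; apply: eq_bigr => i _; rewrite scalerDr.
have uE : u1 + u2 = (c1 + c2) - (S1 + S2) by rewrite /u1 /u2 addrACA addNr addr0 addrACA -opprD.
have zE : z - bd k.+1 w = (S1 + S2) + (u1 + u2) :> pchain k by rewrite -zw subKr uE [RHS]addrC subrK.
have sub1 := inside_submodule k sV1; have sub2 := inside_submodule k sV2.
have bS : bd k (S1 + S2) = 0.
  rewrite S12; have := linear_sum (pbd k) => /= ->; rewrite big1// => i _.
  have := pbdP (a i) (e1 i + e2 i) 0; rewrite linear0 !addr0 => ->.
  by have [_ _ ->] := eP i; rewrite scaler0.
have cV (A B : set X) (c : pchain k) : A `<=` B -> carried (inside A k) c -> carried (inside B k) c.
  by move=> AB; apply: carried_sub => s sA; exact: subset_trans sA AB.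
have bu1 : bd k u1 = 0 by rewrite /u1 linearB ae subrr.
have c1u : cyc V1 u1.
  split=> //; apply: (submoduleB sub1); last by apply: cV eV => y [].
  apply: (submoduleB sub1); first exact: cV h1.
  rewrite /S1; apply: (@submodule_sum {poly F} (pchain k) (carried (inside V1 k))) => // i _.
  apply: (submoduleZ (a i) sub1); have [hi _ _] := eP i; exact: cV hi.
have c2u : cyc V2 u2.
  split; last first.
    have : bd k (u1 + u2) = 0 by rewrite uE linearB bc bS subrr.
    by rewrite linearD bu1 add0r.
  apply: (submoduleD sub2); last by apply: cV eV => y [].
  apply: (submoduleB sub2); first exact: cV h2.
  rewrite /S2; apply: (@submodule_sum {poly F} (pchain k) (carried (inside V2 k))) => // i _.
  apply: (submoduleZ (a i) sub2); have [_ hi _] := eP i; exact: cV hi.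
have := gcat_span sB (_ : exists b, bnd V (S1 + S2 - \sum_i b i *: (e1 i + e2 i))) (gcat_span sB (G1 _ c1u) (G2 _ c2u)).
case=> [|b]; first by exists a; rewrite S12 subrr; exact: sB.1.
rewrite -zE => hb; exists b; rewrite -[z](subrK (bd k.+1 w)) addrAC.
apply: (submoduleD sB) hb _; exists w => //; apply: carried_sub wU => s sU.
by move=> y /sU [/UV1/VV1|/UV2/VV2].
Qed.

End TopFg.
Arguments inside_submodule {R F X tau V} k.
Arguments cyc_submodule {R F X tau U} k.
Arguments bnd_submodule {R F X tau V} k.

(** * Finite generation above a chart *)

(* Composed with [clamp], a homotopy on the unit interval is defined for all times *)
Section Clamp.
Variable R : realType.

Definition clamp (t : R) : R := (`|t| - `|t - 1| + 1) / 2.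

Lemma clamp_continuous : continuous clamp.
Proof.
move=> t; apply: cvgM; last exact: cvg_cst.
apply: cvgD; last exact: cvg_cst.
apply: cvgB; first by apply: cvg_norm; exact: cvg_id.
by apply: cvg_norm; apply: cvgB; [exact: cvg_id|exact: cvg_cst].
Qed.

Lemma clamp_itv t : 0 <= clamp t <= 1.
Proof. by rewrite /clamp; apply/andP; split; case: (ler0P t); case: (ler0P (t - 1)) => *; lra. Qed.

Lemma clamp_id t : 0 <= t <= 1 -> clamp t = t.
Proof. by move=> /andP[t0 t1]; rewrite /clamp ger0_norm// ler0_norm; lra. Qed.

(** Connectedness of the simplex: along the segment from [x] to [y], [h] read as a real function has
    derivative 0, hence is constant. *)
Lemma simplex_locally_const k (h : std_simplex R k -> int) :
  (forall x, \forall y \near x, h y = h x) -> forall x y, h x = h y.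
Proof.
move=> hl x y.
have seg t : (1 - clamp t) *: (set_val x : 'rV[R]_k.+1) + clamp t *: set_val y \in std_simplex R k.
  have /andP[c0 c1] := clamp_itv t; apply/mem_set; split=> [i|].
    by rewrite !mxE; apply: addr_ge0; apply: mulr_ge0; rewrite ?simplex_ge0 ?subr_ge0.
  under eq_bigr do rewrite !mxE; rewrite big_split -!mulr_sumr !simplex_sum1.
  by rewrite !mulr1; exact: subrK.
pose gam t : std_simplex R k := SigSub (seg t).
have cgam : continuous gam.
  apply: (@continuous_comp_initial _ _ _ set_val) => t.
  have -> : set_val \o gam = fun t => (1 - clamp t) *: (set_val x : 'rV[R]_k.+1) + clamp t *: set_val y by [].
  apply: cvg_row => j; rewrite !mxE; under eq_cvg do rewrite !mxE.
  apply: cvgD; apply: cvgM; try exact: cvg_cst; last exact: clamp_continuous.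
  by apply: cvgB; [exact: cvg_cst|exact: clamp_continuous].
pose g (t : R) : R := (h (gam t))%:~R.
have dg (t : R) : is_derive t 1 g 0.
  have d : is_derive t (1 : R^o) (cst (g t) : R^o -> R^o) 0 by exact: is_derive_cst.
  apply: near_eq_is_derive d.
  have near1 : \forall r \near t, h (gam r) = h (gam t) := cgam t _ (hl (gam t)).
  by apply: filterS near1 => r /= hr; rewrite /g /cst hr.
have : g 0 = g 1 by apply: is_derive_0_is_cst.
rewrite /g => /intr_inj.
have e0 : gam 0 = x by apply: val_inj; rewrite /= clamp_id ?lexx ?ler01// subr0 scale1r scale0r addr0.
have e1 : gam 1 = y by apply: val_inj; rewrite /= clamp_id ?lexx ?ler01// subrr scale1r scale0r add0r.
by rewrite e0 e1.
Qed.

End Clamp.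

(* [Q] is the part of [X] above a chart: its points correspond to the valid pairs [(w, i)], and [tau] shifts [i] *)
Section LocalModel.
Variables (R : realType) (F : fieldType) (n : nat) (X : topologicalType) (tau : continuousType X X).
Variables (Q : set X) (Om : set 'rV[R]_n) (B P : R) (f : 'rV[R]_n -> R).
Variables (u : X -> 'rV[R]_n) (m : X -> int) (pt : 'rV[R]_n -> int -> X).

Definition valid (w : 'rV[R]_n) (i : int) := Om w /\ f w - P * i%:~R <= B.

Hypothesis P0 : 0 < P.
Hypothesis Qopen : open Q.
Hypothesis Q_valid : forall y, Q y -> valid (u y) (m y) /\ pt (u y) (m y) = y.
Hypothesis pt_valid : forall w i, valid w i ->
  [/\ Q (pt w i), u (pt w i) = w, m (pt w i) = i & tau (pt w i) = pt w (i + 1)].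
Hypothesis u_cont : forall y, Q y -> u @ y --> u y.
Hypothesis m_const : forall y, Q y -> \forall z \near y, m z = m y.
Hypothesis pt_cont : forall (Z : topologicalType) (phi : Z -> 'rV[R]_n) z0 i,
  phi @ z0 --> phi z0 -> (\forall z \near z0, valid (phi z) i) ->
  pt (phi z) i @[z --> z0] --> pt (phi z0) i.
Hypothesis Om_open : open Om.
Hypothesis f_cont : forall w, Om w -> f @ w --> f w.

Local Notation fgH := (@fgH R F X tau).

Lemma valid_le w i j : i <= j -> valid w i -> valid w j.
Proof.
move=> ij [wO wB]; split=> //; apply: le_trans wB.
by rewrite lerD2l lerN2 ler_pM2l// ler_int.
Qed.

(** A motion [eta] in the chart lifts to [X] by keeping the index [m y] fixed. The lift is
    continuous because the index is locally constant. *)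
Lemma local_homotopy (eta : R -> 'rV[R]_n -> 'rV[R]_n) (U V U' : set X) :
  U `<=` Q -> (forall t w, (fun p : R * 'rV[R]_n => eta p.1 p.2) @ (t, w) --> eta t w) ->
  (forall t y, U y -> valid (eta t (u y)) (m y)) ->
  (forall y, U y -> eta 0 (u y) = u y) ->
  (forall t y, U y -> V (pt (eta t (u y)) (m y))) ->
  (forall y, U y -> U' (pt (eta 1 (u y)) (m y))) ->
  forall k (z : chain R F X k), carried (inside U k) z -> bd R F X k z = 0 ->
  exists z' w, [/\ carried (inside U' k) z', carried (inside V k.+1) w &
    z - z' = bd R F X k.+1 w].
Proof.
move=> UQ ceta veta eta0 etaV eta1.
apply: (@homotopy_cycle R F X (fun t y => pt (eta t (u y)) (m y)) U V U') => //; last first.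
  by move=> y Uy; rewrite eta0//; have [] := Q_valid (UQ _ Uy).
move=> k s sU p0.
have Us p : U (s p) by apply: sU; exists p.
have cs : s p.1 @[p --> p0] --> s p0.1.
  by apply: (@cvg_comp _ _ _ fst s); [exact: cvg_fst|exact: cts_fun].
have mc : \forall p \near p0, m (s p.1) = m (s p0.1).
  exact: cs (m_const (UQ _ (Us p0.1))).
pose phi (p : prism R k) := eta p.2 (u (s p.1)).
have cphi : phi @ p0 --> phi p0.
  have c1 : u (s p.1) @[p --> p0] --> u (s p0.1).
    by apply: (@cvg_comp _ _ _ (fun p : prism R k => s p.1) u); [exact: cs|exact/u_cont/UQ/Us].
  have c2 : (p.2, u (s p.1)) @[p --> p0] --> (p0.2, u (s p0.1)) by exact: (cvg_pair cvg_snd c1).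
  by apply: (@cvg_comp _ _ _ (fun p : prism R k => (p.2, u (s p.1))) (fun p : R * 'rV[R]_n => eta p.1 p.2)); [exact: c2|exact: ceta].
have cp : pt (phi p) (m (s p0.1)) @[p --> p0] --> pt (phi p0) (m (s p0.1)).
  by apply: pt_cont => //; apply: filterS mc => p <-; exact: veta.
apply: cvg_trans cp; apply: near_eq_cvg.
by apply: filterS mc => p <-.
Qed.

(** When [G] satisfies the inequality at index [i], this is a disjoint union of copies of [G], one
    for each index from [i] on, which the shift moves along by one. *)
Definition Ybox (G : set 'rV[R]_n) (i : int) : set X := [set y | [/\ Q y, G (u y) & i <= m y]].
Definition over (U : set 'rV[R]_n) : set X := [set y | Q y /\ U (u y)].

Lemma tauE y : Q y -> [/\ Q (tau y), u (tau y) = u y & m (tau y) = m y + 1].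
Proof.
move=> /Q_valid[vy yE].
have vy1 : valid (u y) (m y + 1) by apply: valid_le vy; rewrite lerDl.
have [_ _ _ E] := pt_valid vy; rewrite yE in E; rewrite E.
by have [] := pt_valid vy1.
Qed.

Lemma stable_Ybox G i : stable tau (Ybox G i).
Proof.
move=> y [Qy Gy iy]; have [Qt ut mt] := tauE Qy; split; rewrite ?ut ?mt//.
by apply: (le_trans iy); rewrite lerDl.
Qed.

Lemma stable_over U : stable tau (over U).
Proof. by move=> y [Qy Uy]; have [Qt ut mt] := tauE Qy; split; rewrite ?ut. Qed.

Lemma open_Ybox G i : open G -> open (Ybox G i).
Proof.
move=> oG; rewrite openE => y [Qy Gy iy]; rewrite /interior.
have nQ : nbhs y Q by exact: open_nbhs_nbhs.
have nG : \forall z \near y, G (u z) by apply: (u_cont Qy); exact: open_nbhs_nbhs.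
have nm := m_const Qy.
near=> z; split; [by near: z|by near: z|].
by rewrite (_ : m z = m y)//; near: z.
Unshelve. all: by end_near. Qed.

Definition cvx (G : set 'rV[R]_n) := forall a b t, G a -> G b -> 0 <= t <= 1 -> G ((1 - t) *: a + t *: b).

Lemma cvx_ball a r : cvx (ball a r).
Proof.
move=> x y t; rewrite -ball_normE /ball_ /= => ax ay /andP[t0 t1].
have -> : a - ((1 - t) *: x + t *: y) = (1 - t) *: (a - x) + t *: (a - y).
  by rewrite !scalerBr opprD addrACA -scalerDl subrK scale1r.
apply: le_lt_trans (ler_normD _ _) _; rewrite !normrZ !ger0_norm ?subr_ge0//.
have [->|t_n0] := eqVneq t 0; first by rewrite mul0r addr0 subr0 mul1r.
apply: (@lt_le_trans _ _ ((1 - t) * r + t * r)); last by rewrite -mulrDl subrK mul1r.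
apply: ler_ltD; first by apply: ler_wpM2l; rewrite ?subr_ge0// ltW.
by rewrite ltr_pM2l// lt_neqAle eq_sym t_n0.
Qed.

Lemma cvxI G G' : cvx G -> cvx G' -> cvx (G `&` G').
Proof. by move=> cG cG' a b t [? ?] [? ?] ?; split; [exact: cG|exact: cG']. Qed.

(** The index is locally constant along a simplex, hence constant, and together with [w] it
    determines the point. *)
Lemma simplex_discrete k (s : singular R X k) w i0 : valid w i0 ->
  inside [set y | exists i, i0 <= i /\ y = pt w i] k s ->
  exists i, i0 <= i /\ forall x, s x = pt w i.
Proof.
move=> vw sU.
have sP x : exists2 i, i0 <= i & s x = pt w i by have [|i [i1 i2]] := sU (s x); [exists x|exists i].
have mE x : s x = pt w (m (s x)).
  by have [i ii ->] := sP x; have [_ _ -> _] := pt_valid (valid_le ii vw).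
have h : forall x y, m (s x) = m (s y).
  apply: (@simplex_locally_const R k (fun x => m (s x))) => x.
  have Qx : Q (s x) by have [i ii ->] := sP x; have [] := pt_valid (valid_le ii vw).
  exact: (@cts_fun _ _ s x _ (m_const Qx)).
exists (m (s (vertex R ord0))); split; last by move=> x; rewrite mE (h x (vertex R ord0)).
have [i ii E] := sP (vertex R ord0); rewrite E.
by have [_ _ -> _] := pt_valid (valid_le ii vw).
Qed.

(** Contracting [G] to [p0] leaves only simplices in the discrete set of points above [p0]. These
    are constant and are t-multiples of [cst_s i0], so one generator suffices. It need not be a
    cycle, which [fgmod_noeth] permits. *)
Lemma fgH_Ybox k G i0 : open G -> G `<=` Om -> cvx G -> (forall w, G w -> f w - P * i0%:~R <= B) ->
  fgH k (Ybox G i0) (Ybox G i0).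
Proof.
move=> oG GO cG Gi0.
have [[p0 Gp0]|nG] := pselect (exists p, G p); last first.
  by apply: fgH_empty; [exact: stable_Ybox|move=> y [_ Gy _]; apply: nG; exists (u y)].
have vG w i : G w -> i0 <= i -> valid w i.
  by move=> Gw ii; apply: (valid_le ii); split; [exact: GO|exact: Gi0].
pose eta t w : 'rV[R]_n := (1 - clamp t) *: w + clamp t *: p0.
have Geta t w : G w -> G (eta t w) by move=> Gw; apply: cG => //; exact: clamp_itv.
pose cst_s i : singular R X k := mkcont (@cst_continuous _ _ (pt p0 i)).
have cstE j : 'X^j *: (<< cst_s i0 >> : pchain R F tau k) = << cst_s (i0 + j%:Z) >>.
  elim: j => [|j IH]; first by rewrite expr0 scale1r addr0.
  rewrite exprS -scalerA IH pmodE -['X]mul1r pactMX pact1 /= chain_mapU.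
  congr << _ >>; apply/continuousEP => x /=.
  have [_ _ _ ->] := pt_valid (vG p0 (i0 + j%:Z) Gp0 (lerDl _ _)).
  by congr pt; lia.
apply: (@fgmod_noeth F (pchain R F tau k) _ _ 1%N (fun=> << cst_s i0 >>)).
- exact/cyc_submodule/stable_Ybox.
- exact/bnd_submodule/stable_Ybox.
move=> z [zU bz].
have [] := @local_homotopy eta (Ybox G i0) (Ybox G i0) [set y | exists i, i0 <= i /\ y = pt p0 i] _ _ _ _ _ _ k z zU bz.
- by move=> y [].
- move=> t w; rewrite /eta.
  have cc : clamp p.1 @[p --> (t, w)] --> clamp t.
    by apply: (@cvg_comp _ _ _ fst (@clamp R)); [exact: cvg_fst|exact: clamp_continuous].
  apply: (@cvg_row R _ n (fun p : R * 'rV[R]_n => (1 - clamp p.1) *: p.2 + clamp p.1 *: p0) (t, w)) => j.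
  rewrite [X in X @ _](_ : _ = fun p : R * 'rV[R]_n => (1 - clamp p.1) * p.2 ord0 j + clamp p.1 * p0 ord0 j); last first.
    by apply/funext => p; rewrite !mxE.
  rewrite !mxE /=.
  have cj : (fun p : R * 'rV[R]_n => p.2 ord0 j) @ (t, w) --> w ord0 j.
    by apply: (@cvg_comp _ _ _ snd (fun v : 'rV[R]_n => v ord0 j)); [exact: cvg_snd|exact: coord_continuous].
  apply: cvgD; apply: cvgM => //; last exact: cvg_cst.
  by apply: cvgB => //; exact: cvg_cst.
- by move=> t y [Qy Gy iy]; apply: vG => //; exact: Geta.
- by move=> y _; rewrite /eta clamp_id ?lexx ?ler01// subr0 scale1r scale0r addr0.
- move=> t y [Qy Gy iy]; have v := vG _ _ (Geta t _ Gy) iy.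
  by have [q1 q2 q3 _] := pt_valid v; split=> //; rewrite ?q2 ?q3//; exact: Geta.
- move=> y [Qy Gy iy]; exists (m y); split=> //.
  by rewrite /eta clamp_id ?lexx ?ler01// subrr scale1r scale0r add0r.
move=> z' [w [z'U wV zw]].
have [p pE] : exists p : {poly F}, z' = p *: (<< cst_s i0 >> : pchain R F tau k).
  move: z'U; apply: (carried_ind (Q := [set c | exists p : {poly F}, c = p *: (<< cst_s i0 >> : pchain R F tau k)])) => [|s sU].
    split=> [|a x y [p ->] [q ->]]; first by exists 0; rewrite scale0r.
    by exists (a%:P * p + q); rewrite scalerDl -scalerA [in RHS]pmodE pactC.
  have [i [ii si]] := simplex_discrete (vG _ _ Gp0 (lexx i0)) sU.
  exists 'X^(`|i - i0|%N); rewrite cstE; congr << _ >>; apply/continuousEP => x /=.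
  by rewrite si; congr pt; lia.
by exists (fun=> p); rewrite big_ord1 -pE; exists w.
Qed.

Definition Ybox_union N (G : nat -> set 'rV[R]_n) (i : nat -> int) : set X :=
  [set y | exists2 j, (j < N)%N & Ybox (G j) (i j) y].

(** Boxes are closed under intersection: convex sets intersect and indices take the maximum. The
    induction on [N] must therefore range over all degrees and all families, since Mayer-Vietoris
    calls for the intersections one degree lower. *)
Lemma fgH_Ybox_union N k (G : nat -> set 'rV[R]_n) (i : nat -> int) :
  (forall j, (j < N)%N -> [/\ open (G j), G j `<=` Om, cvx (G j) & forall w, G j w -> f w - P * (i j)%:~R <= B]) ->
  fgH k (Ybox_union N G i) (Ybox_union N G i).
Proof.
elim: N k G i => [|N IH] k G i HG.
  by apply: fgH_empty => y [].
have [oN GN cN bN] := HG N (ltnSn N).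
have sY M G' i' : stable tau (Ybox_union M G' i').
  by move=> y [j jM Gy]; exists j => //; exact: stable_Ybox.
pose W := Ybox_union N (fun j => G j `&` G N) (fun j => Num.max (i j) (i N)).
have YE : Ybox_union N.+1 G i = Ybox_union N G i `|` Ybox (G N) (i N).
  apply/seteqP; split=> y.
    by move=> [j]; rewrite ltnS leq_eqVlt => /orP[/eqP ->|jN] h; [right|left; exists j].
  by move=> [[j jN h]|h]; [exists j => //; exact: ltnW|exists N].
have WE : Ybox_union N G i `&` Ybox (G N) (i N) = W.
  apply/seteqP; split=> y.
    by move=> [[j jN [Qy Gy iy]] [_ Gy' iy']]; exists j => //; split; rewrite // ge_max iy.
  move=> [j jN [Qy [Gy Gy']]]; rewrite ge_max => /andP[iy iy'].
  by split=> //; exists j.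
have HG' j : (j < N)%N -> [/\ open (G j), G j `<=` Om, cvx (G j) & forall w, G j w -> f w - P * (i j)%:~R <= B].
  by move=> jN; apply: HG; exact: ltnW.
rewrite YE; apply: (@fgH_union R F X tau k _ _ (Ybox_union N G i) (Ybox (G N) (i N)) _ W) => //.
- exact: stable_Ybox.
- exact: stable_Ybox.
- by rewrite -YE.
- exact: sY.
- rewrite openE => y [j jN Gy]; rewrite /interior.
  have [oj _ _ _] := HG' j jN.
  have : nbhs y (Ybox (G j) (i j)) by apply: open_nbhs_nbhs; split=> //; exact: open_Ybox.
  by apply: filterS => z Gz; exists j.
- exact: open_Ybox.
- by rewrite WE.
- apply: (@fgH_sub R F X tau k (Ybox_union N G i) _ (Ybox_union N G i)) => //; last exact: IH.
  by rewrite -YE.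
- apply: (@fgH_sub R F X tau k (Ybox (G N) (i N)) _ (Ybox (G N) (i N))) => //; last exact: fgH_Ybox.
  + exact: stable_Ybox.
  + by rewrite -YE.
- move=> _; rewrite WE; apply: IH => j jN; have [oj Gj cj bj] := HG' j jN; split.
  + exact: openI.
  + by move=> w [/Gj].
  + exact: cvxI.
  + move=> w [/bj bw _]; apply: le_trans bw.
    by rewrite lerD2l lerN2 ler_pM2l// ler_int le_max lexx.
Qed.

Lemma compact_thicken (C V : set 'rV[R]_n) : compact C -> open V -> C `<=` V ->
  exists2 d : R, 0 < d & forall c w, C c -> `| c - w | < d -> V w.
Proof.
move=> /compact_near_coveringP/(_ R (0^'+)%R (fun d c => forall w, `| c - w | < d -> V w)) H oV CV.
have := H _; case=> [c Cc|e /= e0 eP].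
  have /nbhs_ballP[e /= e0 eV] : nbhs c V by apply: open_nbhs_nbhs; split=> //; exact: CV.
  near=> c' d => /= w c'w; apply: eV; rewrite -ball_normE /ball_ /=.
  rewrite -[c - w](subrKA c'); apply: le_lt_trans (ler_normD _ _) _.
  rewrite [e]splitr; apply: ltrD.
    by near: c'; apply: cvgr_dist_lt => //; rewrite divr_gt0.
  apply: lt_trans c'w _; near: d; apply: nbhs_right_lt; by rewrite divr_gt0.
exists (e / 2) => [|c w Cc]; first by rewrite divr_gt0.
apply: (eP (e / 2)) => //; last by rewrite divr_gt0.
by rewrite /= sub0r normrN gtr0_norm ?divr_gt0// ltr_pdivrMr// ltr_pMr// ltr1n.
Unshelve. all: by end_near. Qed.

(* Pushing along [v] makes the inequality strict, so that a compact part of the chart is pushed into finitely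
   many boxes *)
Lemma local_fg (v : 'rV[R]_n) (s0 : R) : 0 < s0 ->
  (forall s w (i : int), 0 < s -> s <= s0 -> Om w -> Om (w + s *: v) ->
    f w - P * i%:~R <= B -> f (w + s *: v) - P * i%:~R < B) ->
  forall k (C V : set 'rV[R]_n), compact C -> open V -> C `<=` V -> V `<=` Om ->
  exists U, [/\ open U, C `<=` U, U `<=` V & fgH k (over U) (over V)].
Proof.
move=> s00 push k C V cC oV CV VO.
have [d d0 dV] := compact_thicken cC oV CV.
have d3 : 0 < d / 3 by rewrite divr_gt0.
have v1 : 0 < `|v| + 1 by rewrite ltr_pwDr.
(* The push then moves points by less than d/3. Added to a radius of at most d/3 around points of
   [C], everything stays within [d] of [C], hence in [V]. *)
pose s := Num.min s0 (d / 3 / (`|v| + 1)).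
have s_gt0 : 0 < s by rewrite lt_min s00 divr_gt0.
have s_le : s <= s0 by rewrite ge_min lexx.
have sv t : 0 <= t <= s -> `|t *: v| < d / 3.
  move=> /andP[t0 ts]; rewrite normrZ ger0_norm//.
  apply: (@le_lt_trans _ _ (d / 3 / (`|v| + 1) * `|v|)).
    by apply: ler_wpM2r => //; apply: (le_trans ts); rewrite ge_min lexx orbT.
  by rewrite mulrAC ltr_pdivrMr// ltr_pM2l// ltrDl.
have Vin c w t : C c -> `|c - w| < d / 3 -> 0 <= t <= s -> V (w + t *: v).
  move=> Cc cw /sv tv; apply: (dV c) => //; rewrite opprD addrA.
  apply: le_lt_trans (ler_normB _ _) _.
  by apply: (lt_trans (ltrD cw tv)); lra.
have t0s : (0 : R) <= 0 <= s by rewrite lexx ltW.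
have tss : 0 <= s <= s by rewrite lexx ltW.
have Cv c t : C c -> 0 <= t <= s -> V (c + t *: v) by move=> Cc ts; apply: (Vin c) => //; rewrite subrr normr0.
have near_lt w (a : R) : Om w -> f w < a -> exists2 e : R, 0 < e & forall w', `|w - w'| < e -> f w' < a.
  move=> Ow fw; move: (f_cont Ow) => /cvgr_lt /(_ _ fw) /nbhs_ballP[e /= e0 eV].
  by exists e => // w' ww'; apply: eV; rewrite -ball_normE.
have near_gt w (a : R) : Om w -> a < f w -> exists2 e : R, 0 < e & forall w', `|w - w'| < e -> a < f w'.
  move=> Ow fw; move: (f_cont Ow) => /cvgr_gt /(_ _ fw) /nbhs_ballP[e /= e0 eV].
  by exists e => // w' ww'; apply: eV; rewrite -ball_normE.
(* [ri.2] is an index for which the box around the pushed point [c + s *: v] satisfies the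
   inequality strictly, while no point above the ball around [c] has a smaller index. So the push
   sends everything above that ball into the box. Outside [C] the value is a dummy. *)
have /choice[ri riP] : forall c, exists ri : R * int, C c -> [/\ 0 < ri.1, ri.1 <= d / 3,
    (forall w, `|c + s *: v - w| < ri.1 -> f w - P * ri.2%:~R < B) &
    (forall w, `|c - w| < ri.1 -> B < f w - P * (ri.2 - 1)%:~R)].
  move=> c; have [Cc|nC] := pselect (C c); last by exists (0, 0).
  pose w := c + s *: v; have Ow : Om w by exact/VO/Cv.
  have Oc : Om c by exact/VO/CV.
  pose i : int := Num.floor ((f w - B) / P) + 1.
  have i1 : f w - P * i%:~R < B.
    have := floorD1_gt ((f w - B) / P); rewrite -/i ltr_pdivrMr// => h.
    by rewrite ltrBlDr -ltrBlDl mulrC.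
  have i2 : B <= f w - P * (i - 1)%:~R.
    have := floor_le ((f w - B) / P); rewrite /i addrK ler_pdivlMr// => h.
    by rewrite lerBrDr -lerBrDl mulrC.
  (* If [c] were valid at index [i - 1], its push [w] would satisfy the strict inequality there,
     against [i2]. *)
  have i3 : B < f c - P * (i - 1)%:~R.
    rewrite ltNge; apply/negP => h; have := push s c (i - 1) s_gt0 s_le Oc Ow h.
    by rewrite ltNge i2.
  have [e1 e10 E1] := @near_lt w (B + P * i%:~R) Ow ltac:(by rewrite -ltrBlDr).
  have [e2 e20 E2] := @near_gt c (B + P * (i - 1)%:~R) Oc ltac:(by rewrite -ltrBrDr).
  exists (Num.min (d / 3) (Num.min e1 e2), i) => _; split=> /=.
  - by rewrite !lt_min d3 e10.
  - by rewrite ge_min lexx.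
  - by move=> w'; rewrite !lt_min => /and3P[_ h _]; rewrite ltrBlDr E1.
  - by move=> w'; rewrite !lt_min => /and3P[_ _ h]; rewrite ltrBrDr E2.
have oball (c : 'rV[R]_n) : C c -> open (ball c (ri c).1) by move=> _; exact: ball_open.
have [D' D'C Ccov] : finite_subset_cover C (fun c => ball c (ri c).1) C.
  move: cC; rewrite compact_cover => /(_ _ C (fun c => ball c (ri c).1) oball); apply.
  by move=> c Cc; exists c => //; apply: ballxx; have [] := riP c Cc.
pose l := finmap.enum_fset D'.
have lC j : (j < size l)%N -> C (nth 0 l j) by move=> jl; apply/set_mem/D'C; exact: mem_nth.
pose U : set 'rV[R]_n := [set w | exists2 j, (j < size l)%N & ball (nth 0 l j) (ri (nth 0 l j)).1 w].
pose G j := ball (nth 0 l j + s *: v) (ri (nth 0 l j)).1.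
pose ii j := (ri (nth 0 l j)).2.
have UV t w : U w -> 0 <= t <= s -> V (w + t *: v).
  move=> [j jl]; rewrite -ball_normE /= => h ts; apply: (Vin (nth 0 l j)) => //; first exact: lC.
  by apply: (lt_le_trans h); have [] := riP _ (lC _ jl).
have UV0 w : U w -> V w by move=> Uw; have := UV 0 w Uw t0s; rewrite scale0r addr0.
have GV j : (j < size l)%N -> G j `<=` V.
  move=> jl w; rewrite /G -ball_normE /= => h; have -> : w = (w - s *: v) + s *: v by rewrite subrK.
  apply: (Vin (nth 0 l j)) => //; first exact: lC.
  by rewrite opprB addrA; apply: (lt_le_trans h); have [] := riP _ (lC _ jl).
exists U; split.
- rewrite openE => w [j jl h]; rewrite /interior.
  have : nbhs w (ball (nth 0 l j) (ri (nth 0 l j)).1).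
    by apply: open_nbhs_nbhs; split=> //; apply: oball; exact: lC.
  by apply: filterS => w' h'; exists j.
- move=> c /Ccov[c' /= c'D h]; exists (index c' l); first by rewrite index_mem.
  by rewrite nth_index.
- exact: UV0.
have GYok j : (j < size l)%N -> [/\ open (G j), G j `<=` Om, cvx (G j) & forall w, G j w -> f w - P * (ii j)%:~R <= B].
  move=> jl; split; [exact: ball_open|by move=> w /(GV _ jl)/VO|exact: cvx_ball|].
  by move=> w; rewrite /G -ball_normE /= => h; apply: ltW; have [_ _ H _] := riP _ (lC _ jl); exact: H.
have [r [g [_ gP]]] := fgH_Ybox_union k GYok.
apply: (@fgmod_noeth F (pchain R F tau k) _ _ r g).
- exact/cyc_submodule/stable_over.
- exact/bnd_submodule/stable_over.
move=> z [zU bz].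
pose eta t w : 'rV[R]_n := w + (clamp t * s) *: v.
have cs t : 0 <= clamp t * s <= s.
  have /andP[c0 c1] := clamp_itv t; apply/andP; split.
    by apply: mulr_ge0 => //; exact: ltW.
  by rewrite ler_piMl// ltW.
have veta t y : over U y -> valid (eta t (u y)) (m y).
  move=> [Qy Uy]; have [[_ vy] _] := Q_valid Qy; split; first exact/VO/UV.
  have /andP[c0 c1] := cs t; move: c0; rewrite le_eqVlt => /orP[/eqP c0|c0].
    by rewrite /eta -c0 scale0r addr0.
  apply: ltW; apply: push => //; [exact: le_trans c1 s_le|exact/VO/UV0|exact/VO/UV].
have [] := @local_homotopy eta (over U) (over V) (Ybox_union (size l) G ii) _ _ _ _ _ _ k z zU bz.
- by move=> y [].
- move=> t w.
  apply: (@cvg_row R _ n (fun p : R * 'rV[R]_n => p.2 + (clamp p.1 * s) *: v) (t, w)) => j.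
  rewrite [X in X @ _](_ : _ = fun p : R * 'rV[R]_n => p.2 ord0 j + (clamp p.1 * s) * v ord0 j); last first.
    by apply/funext => p; rewrite !mxE.
  rewrite !mxE /=.
  have cj : (fun p : R * 'rV[R]_n => p.2 ord0 j) @ (t, w) --> w ord0 j.
    by apply: (@cvg_comp _ _ _ snd (fun v : 'rV[R]_n => v ord0 j)); [exact: cvg_snd|exact: coord_continuous].
  have cc : clamp p.1 @[p --> (t, w)] --> clamp t.
    by apply: (@cvg_comp _ _ _ fst (@clamp R)); [exact: cvg_fst|exact: clamp_continuous].
  apply: cvgD => //; apply: cvgM; last exact: cvg_cst.
  by apply: cvgM => //; exact: cvg_cst.
- exact: veta.
- by move=> y _; rewrite /eta clamp_id ?lexx ?ler01// mul0r scale0r addr0.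
- move=> t y oy; have [q1 q2 _ _] := pt_valid (veta t y oy); split=> //.
  by rewrite q2; apply: UV => //; have [] := oy.
- move=> y oy; have [q1 q2 q3 _] := pt_valid (veta 1 y oy).
  have e1 : eta 1 (u y) = u y + s *: v by rewrite /eta clamp_id ?lexx ?ler01// mul1r.
  have [Qy [j jl h]] := oy; exists j => //; split; rewrite ?q2 ?q3//.
    move: h; rewrite /G e1 -!ball_normE /=; by rewrite opprD addrACA subrr addr0.
  have [[_ vy] _] := Q_valid Qy.
  have [_ _ _ H] := riP _ (lC _ jl).
  have : B < f (u y) - P * (ii j - 1)%:~R by apply: H; move: h; rewrite -ball_normE.
  move=> /(le_lt_trans vy); by rewrite ltrD2l ltrN2 ltr_pM2l// ltr_int ltrBlDr ltzD1.
move=> z' [w [z'Y wV zw]].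
have bz' : bd R F X k z' = 0.
  by rewrite -[z'](subKr z) zw linearB bz bd_bd subrr.
have [a [w' w'Y aw]] := gP z' (conj z'Y bz').
exists a; rewrite -[z](subrK z') -addrA aw zw.
have -> : bd R F X k.+1 w + bd R F X k.+1 w' = bd R F X k.+1 (w + w') by rewrite linearD.
exists (w + w') => //; apply: carriedD => //; apply: carried_sub w'Y => t tY.
apply: (subset_trans tY) => y [j jl [Qy Gy _]]; split=> //; exact: GV Gy.
Qed.

End LocalModel.

(** * Finite generation of the homology of the sublevel set *)

Section Global.
Variables (R : realType) (F : fieldType) (X L : topologicalType) (tau : continuousType X X) (p : X -> L).
Hypothesis p_cont : continuous p.
Hypothesis p_tau : forall y, p (tau y) = p y.
Hypothesis L_haus : hausdorff_space L.
Hypothesis L_comp : compact [set: L].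
Local Notation fgH := (@fgH R F X tau).

Definition tame k (C : set L) := forall V, open V -> C `<=` V ->
  exists U, [/\ open U, C `<=` U, U `<=` V & fgH k (p @^-1` U) (p @^-1` V)].

Lemma stable_preim V : stable tau (p @^-1` V).
Proof. by move=> y; rewrite /preimage /= p_tau. Qed.

Lemma open_preim V : open V -> open (p @^-1` V).
Proof. by move=> oV; apply: open_comp => // x _; exact: p_cont. Qed.

(** Mayer-Vietoris needs neighbourhoods of [C1] and [C2] whose intersection lies in the
    neighbourhood [W] of [C1 & C2]. Normality of [L] separates the disjoint closed sets left outside
    [W] by [T1] and [T2]; [V1] and [V2] are cut down to [T1] or [W], respectively [T2] or [W]. *)
Lemma tame_union k C1 C2 : closed C1 -> closed C2 -> tame k C1 -> tame k C2 ->
  ((0 < k)%N -> tame k.-1 (C1 `&` C2)) -> tame k (C1 `|` C2).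
Proof.
move=> cC1 cC2 t1 t2 t12 V oV CV.
have [V1 [oV1 CV1 VV1 f1]] := t1 V oV (fun x h => CV x (or_introl h)).
have [V2 [oV2 CV2 VV2 f2]] := t2 V oV (fun x h => CV x (or_intror h)).
have C12 : C1 `&` C2 `<=` V1 `&` V2 by move=> x [/CV1 ? /CV2 ?].
have [W [oW CW WV fW]] : exists W, [/\ open W, C1 `&` C2 `<=` W, W `<=` V1 `&` V2 &
    ((0 < k)%N -> fgH k.-1 (p @^-1` W) (p @^-1` (V1 `&` V2)))].
  have [->|k0] := posnP k; first by exists (V1 `&` V2); split=> //; exact: openI.
  by have [W [h1 h2 h3 h4]] := t12 k0 _ (openI oV1 oV2) C12; exists W.
have nL := compact_normal L_haus L_comp.
have cD C : closed C -> closed (C `\` W) by move=> cC; rewrite setDE; apply: closedI => //; exact: open_closedC.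
have D12 : (C1 `\` W) `&` (C2 `\` W) = set0.
  by apply/seteqP; split=> // x [[h1 h2] [h3 h4]]; apply: h2; exact: CW.
have [T1 [T2 [oT1 oT2 A1 A2 T12]]] := (@normal_openP R L).1 nL _ _ (cD _ cC1) (cD _ cC2) D12.
pose U1 := V1 `&` (T1 `|` W); pose U2 := V2 `&` (T2 `|` W).
have oU1 : open U1 by apply: openI => //; exact: openU.
have oU2 : open U2 by apply: openI => //; exact: openU.
exists (U1 `|` U2); split.
- exact: openU.
- move=> x [Cx|Cx]; [left|right]; split; [exact: CV1| |exact: CV2|].
    by have [Wx|nW] := pselect (W x); [right|left; apply: A1].
  by have [Wx|nW] := pselect (W x); [right|left; apply: A2].
- by move=> x [[/VV1]|[/VV2]].
rewrite preimage_setU; apply: (@fgH_union R F X tau k _ _ (p @^-1` V1) (p @^-1` V2) _ (p @^-1` W));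
  try exact: stable_preim; try exact: open_preim; try by move=> //.
- by move=> y [].
- by move=> y [].
- by move=> y /VV1.
- by move=> y /VV2.
- move=> y [[h1 h2] [h3 h4]]; case: h2 => // h2; case: h4 => // h4.
  have : (T1 `&` T2) (p y) by []. by rewrite T12.
Qed.

(* Heredity is what lets the intersections met in Mayer-Vietoris be tame *)
Definition htame C := forall C', closed C' -> C' `<=` C -> forall k, tame k C'.

Lemma htame_union C1 C2 : closed C1 -> closed C2 -> htame C1 -> htame C2 -> htame (C1 `|` C2).
Proof.
move=> cC1 cC2 h1 h2 C cC CC k.
have -> : C = (C `&` C1) `|` (C `&` C2) by rewrite -setIUr; apply/esym/setIidl.
have c1 : closed (C `&` C1) by exact: closedI.
have c2 : closed (C `&` C2) by exact: closedI.
apply: tame_union => //; [by apply: h1 => // x []|by apply: h2 => // x []|move=> _].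
by apply: h1; [exact: closedI|move=> x [[]]].
Qed.

Hypothesis local : forall x, exists Q, [/\ open Q, Q x &
  forall C V, closed C -> C `<=` Q -> open V -> C `<=` V -> forall k,
  exists U, [/\ open U, C `<=` U, U `<=` V & fgH k (p @^-1` U) (p @^-1` V)]].

Lemma htame_set0 : htame set0.
Proof.
move=> C cC; rewrite subset0 => -> k V oV _; exists set0; split=> //; first exact: open0.
by rewrite preimage_set0; apply: fgH_empty => //; exact: stable_preim.
Qed.

Theorem fgH_global k : fgH k setT setT.
Proof.
pose good (A : set L) := exists C, [/\ closed C, A `<=` C & htame C].
have goodU A B : good A -> good B -> good (A `|` B).
  move=> [C [cC AsC hC]] [D [cD BD hD]]; exists (C `|` D); split; first exact: closedU.
    by apply: setUSS.
  exact: htame_union.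
(* Regularity places a closed neighbourhood of [x] inside [Q], and all closed subsets of it are tame
   by [local]. *)
have good_nbhs (x : L) : exists2 O, nbhs x O & good O.
  have [Q [oQ Qx HQ]] := local x.
  have reg : {for x, regular_space L} by apply: (compact_regular L_haus L_comp); exact: filterT.
  have [U [V [oU oV Ux QV UV]]] := (regular_openP x).1 reg (~` Q) (open_closedC oQ) (fun h => h Qx).
  exists U; first by apply: open_nbhs_nbhs.
  exists (~` V); split; first exact: open_closedC.
    by move=> y Uy Vy; have : (U `&` V) y by []; rewrite UV. 
  move=> C cC CV j W oW CW; apply: HQ => // y /CV nVy.
  by apply: contrapT => /QV.
suff [C [cC TC hC]] : good setT.
  have CT : C = setT by apply/seteqP; split.
  have [U [_ TU _ f]] := hC C cC (@subset_refl _ C) k setT openT (fun _ _ => I).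
  have UT : U = setT by apply/seteqP; split=> // x _; apply: TU; rewrite CT.
  by move: f; rewrite UT preimage_setT.
apply: contrapT => ngood.
(* If [L] itself were not good, the complements of the good sets would form a proper filter. A
   cluster point of it would have a good neighbourhood, whose complement belongs to the filter. *)
pose G : set_system L := [set B | good (~` B)].
have GF : ProperFilter G.
  split.
    rewrite /G /= setC0; exact: ngood.
  split.
  - rewrite /G /= setCT; exists set0; split=> //; [exact: closed0|exact: htame_set0].
  - by move=> A B gA gB; rewrite /G /= setCI; exact: goodU.
  - move=> A B AB [C [cC AsC hC]]; exists C; split=> // y nBy; apply: AsC => /AB; exact: nBy.
have [x [_ cx]] := L_comp GF (filterT : G setT).
have [W nW gW] := good_nbhs x.
have [|y [h1 h2]] := cx (~` W) W _ nW; first by rewrite /G /= setCK.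
exact: h1.
Qed.
End Global.

Lemma open_within_continuous (T U : topologicalType) (D : set T) (f : T -> U) x :
  open D -> {within D, continuous f} -> D x -> f @ x --> f x.
Proof.
move=> oD; rewrite continuous_open_subspace// => lcoef Dx; exact: lcoef (mem_set Dx).
Qed.

Lemma cvg_set_val (T Z : topologicalType) (D : set T) (f : Z -> D) z0 :
  set_val (f z) @[z --> z0] --> (set_val (f z0) : T) -> f @ z0 --> f z0.
Proof.
move=> lcoef N nN.
have [W [[V oV VW] Wx] WN] : exists2 W, open_nbhs (f z0) W & W `<=` N by move: nN; rewrite nbhsE.
have nV : nbhs (set_val (f z0) : T) V by apply: open_nbhs_nbhs; split=> //; move: Wx; rewrite -VW.
have h : nbhs z0 (fun z => V (set_val (f z))) := lcoef _ nV.
suff : nbhs z0 (f @^-1` N) by [].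
by apply: filterS h => z Vz; apply: WN; rewrite -VW.
Qed.

(** * Derivatives along lines *)

Section Deriv.
Variables (R : realType) (n : nat).

Lemma line_quot (f : 'rV[R]_n -> R) w (e : 'rV[R]_n) t :
  (fun h : R => h^-1 *: (((fun t => f (w + t *: e)) \o shift t) (h *: 1) - f (w + t *: e))) =
  (fun h => h^-1 *: ((f \o shift (w + t *: e)) (h *: e) - f (w + t *: e))).
Proof.
apply/funext => h /=; congr (_ *: (f _ - _)).
have -> : h *: (1 : R^o) = h by exact: mulr1.
by rewrite scalerDl addrCA.
Qed.

Lemma line_derive (f : 'rV[R]_n -> R) w (e : 'rV[R]_n) t : derivable f (w + t *: e) e ->
  is_derive t 1 (fun t => f (w + t *: e) : R) ('D_e f (w + t *: e)).
Proof.
move=> df; apply: DeriveDef; rewrite /derivable /derive line_quot //; exact: df.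
Qed.

Lemma line_mvt (f : 'rV[R]_n -> R) w (e : 'rV[R]_n) s : 0 < s ->
  (forall t, 0 <= t <= s -> derivable f (w + t *: e) e) ->
  exists2 t, 0 <= t <= s & f (w + s *: e) - f w = 'D_e f (w + t *: e) * s.
Proof.
move=> s0 df.
have dl t : 0 <= t <= s -> is_derive t 1 (fun t => f (w + t *: e) : R) ('D_e f (w + t *: e)).
  by move=> /df; exact: line_derive.
have [] := @MVT R (fun t => f (w + t *: e)) (fun t => 'D_e f (w + t *: e)) 0 s s0.
- move=> t; rewrite in_itv /= => /andP[t0 ts]; apply: dl; by rewrite !ltW.
- apply: derivable_within_continuous => t; rewrite in_itv /= => /dl h; exact: ex_derive.
move=> t; rewrite in_itv /= => /andP[t0 ts]; rewrite scale0r addr0 subr0 => E.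
by exists t => //; rewrite !ltW.
Qed.

Lemma derive_add_cst (f : 'rV[R]_n -> R) a v (c : R) : 'D_v (fun x => f x + c) a = 'D_v f a.
Proof.
rewrite /derive (_ : (fun h : R => _) = (fun h : R => h^-1 *: ((f \o shift a) (h *: v) - f a)))//.
by apply/funext => h /=; rewrite opprD addrACA subrr addr0.
Qed.

End Deriv.

Lemma cvg_subr (R : realType) (Z : topologicalType) (f g : Z -> R) (z : Z) (a b : R) :
  f @ z --> a -> g @ z --> b -> f x - g x @[x --> z] --> a - b.
Proof. by move=> fa gb; exact: cvgB. Qed.

Lemma floor_mulK (R : realType) (P : R) (i : int) : 0 < P -> Num.floor (P * i%:~R / P) = i.
Proof. by move=> P0; rewrite mulrAC mulfV ?gt_eqF// mul1r intrKfloor. Qed.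

(** * Charts of the sublevel set *)

Section Sublevel.
Variables (R : realType) (L : topologicalType) (theta : continuousType L (circle R)) (B : R).
Let X : topologicalType := sublevel theta B.
Let P : R := 2 * pi.
Let tau := sublevel_shift theta B.

Definition sl_proj (y : X) : L := cover_proj (set_val y).
Definition sl_height (y : X) : R := cover_height (set_val y).

Lemma cover_proj_continuous : continuous (@cover_proj R L theta).
Proof.
move=> y; apply: (@continuous_comp _ _ _ (set_val : cover theta -> (L * R)%type) fst).
  exact: initial_continuous.
exact: cvg_fst.
Qed.

Lemma cover_height_continuous : continuous (@cover_height R L theta).
Proof.
move=> y; apply: (@continuous_comp _ _ _ (set_val : cover theta -> (L * R)%type) snd).
  exact: initial_continuous.
exact: cvg_snd.
Qed.

Lemma sl_proj_continuous : continuous sl_proj.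
Proof.
move=> y; apply: (@continuous_comp _ _ _ (set_val : X -> cover theta) (@cover_proj R L theta)).
  exact: initial_continuous.
exact: cover_proj_continuous.
Qed.

Lemma sl_height_continuous : continuous sl_height.
Proof.
move=> y; apply: (@continuous_comp _ _ _ (set_val : X -> cover theta) (@cover_height R L theta)).
  exact: initial_continuous.
exact: cover_height_continuous.
Qed.

Lemma sl_theta y : to_circle (sl_height y) = theta (sl_proj y).
Proof. exact: (set_valP (set_val y : cover theta)). Qed.

Lemma sl_le y : sl_height y <= B.
Proof. exact: (set_valP y). Qed.

Lemma sl_cvg (Z : topologicalType) (f : Z -> X) z0 :
  sl_proj (f z) @[z --> z0] --> sl_proj (f z0) ->
  sl_height (f z) @[z --> z0] --> sl_height (f z0) -> f @ z0 --> f z0.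
Proof.
move=> cp ch; apply: cvg_set_val; apply: (@cvg_set_val _ _ _ (fun z => set_val (f z) : cover theta)).
exact: (@cvg_prod _ _ _ (fun z => set_val (set_val (f z) : cover theta) : (L * R)%type) z0 cp ch).
Qed.

Lemma sl_inj y z : sl_proj y = sl_proj z -> sl_height y = sl_height z -> y = z.
Proof.
move=> h1 h2; apply: val_inj; apply: val_inj.
move: h1 h2; rewrite /sl_proj /sl_height /cover_proj /cover_height.
by move=> h1 h2; rewrite [LHS]surjective_pairing [RHS]surjective_pairing; congr pair.
Qed.

Lemma cover_exists x s : to_circle s = theta x ->
  exists y : cover theta, cover_proj y = x /\ cover_height y = s.
Proof.
move=> xs; have h : (x, s) \in [set y : L * R | to_circle y.2 = theta y.1] by exact: mem_set.
by exists (SigSub h).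
Qed.

Lemma sl_exists x s : to_circle s = theta x -> s <= B ->
  exists y, sl_proj y = x /\ sl_height y = s.
Proof.
move=> xs sB; have [y [yx ys]] := cover_exists xs.
have h : y \in [set y : cover theta | cover_height y <= B] by apply: mem_set; rewrite /= ys.
by exists (SigSub h).
Qed.

Lemma sl_proj_tau y : sl_proj (tau y) = sl_proj y. Proof. by []. Qed.

Lemma sl_height_tau y : sl_height (tau y) = sl_height y - P.
Proof. by rewrite /sl_height /= /cover_height /= mulr1. Qed.

Section Chart.
Variables (n : nat) (Q : set L) (kap : L -> 'rV[R]_n) (par : 'rV[R]_n -> L) (Om : set 'rV[R]_n)
  (f : 'rV[R]_n -> R) (y0 : X).
Hypothesis Qopen : open Q.
Hypothesis Om_open : open Om.
Hypothesis kapQ : forall x, Q x -> [/\ Om (kap x), par (kap x) = x & kap @ x --> kap x].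
Hypothesis parO : forall w, Om w -> [/\ Q (par w), kap (par w) = w & par @ w --> par w].
Hypothesis f_lift : forall w, Om w -> theta (par w) = to_circle (f w).
Hypothesis f_cont : forall w, Om w -> f @ w --> f w.

Let P0 : 0 < P. Proof. by rewrite mulr_gt0// pi_gt0. Qed.

Definition sl_u (y : X) := kap (sl_proj y).
(* The number of periods by which [y] lies below the local lift [f] *)
Definition sl_m (y : X) : int := Num.floor ((f (sl_u y) - sl_height y) / P).
(** [y0] is a dummy value, taken when no point of the sublevel set has these coordinates. *)
Definition sl_pt w (i : int) : X :=
  if pselect (exists y, sl_proj y = par w /\ sl_height y = f w - P * i%:~R) is left e then projT1 (cid e) else y0.
Let XQ := [set y : X | Q (sl_proj y)].

Lemma sl_mP y : XQ y -> f (sl_u y) - sl_height y = P * (sl_m y)%:~R.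
Proof.
move=> /kapQ[Oy py _]; have [i E] : exists i : int, f (sl_u y) - sl_height y = P * i%:~R.
  by apply/to_circleP; rewrite -f_lift// py sl_theta.
by rewrite /sl_m E floor_mulK.
Qed.

Lemma sl_ptP w i : valid Om B P f w i -> sl_proj (sl_pt w i) = par w /\ sl_height (sl_pt w i) = f w - P * i%:~R.
Proof.
move=> [Ow wB]; rewrite /sl_pt; case: pselect => [e|]; first by case: (cid e).
case; apply: sl_exists => //; rewrite f_lift//; apply/to_circleP; exists (- i).
by rewrite addrAC subrr add0r mulrNz mulrN.
Qed.

Lemma sl_local_fg (v : 'rV[R]_n) (s0 : R) : 0 < s0 ->
  (forall s w (i : int), 0 < s -> s <= s0 -> Om w -> Om (w + s *: v) ->
    f w - P * i%:~R <= B -> f (w + s *: v) - P * i%:~R < B) ->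
  compact [set: L] -> forall (F : fieldType) C V, closed C -> C `<=` Q -> open V -> C `<=` V -> forall k,
  exists U, [/\ open U, C `<=` U, U `<=` V & @fgH R F X tau k (sl_proj @^-1` U) (sl_proj @^-1` V)].
Proof.
move=> s00 push Lc F C V cC CQ oV CV k.
have vle w i j : i <= j -> valid Om B P f w i -> valid Om B P f w j by exact: valid_le.
pose V' : set 'rV[R]_n := [set w | Om w /\ V (par w)].
have oV' : open V'.
  rewrite openE => w [Ow Vw]; rewrite /interior.
  have [_ _ cw] := parO Ow.
  have h1 : nbhs w Om by apply: open_nbhs_nbhs.
  have h2 : nbhs w (par @^-1` V) by apply: cw; apply: open_nbhs_nbhs.
  by apply: filterS (filterI h1 h2) => z [].
have cC' : compact (kap @` C).
  apply: continuous_compact; last by apply: subclosed_compact cC Lc _.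
  by apply: continuous_in_subspaceT => x /set_mem/CQ/kapQ[].
have [U' [oU' CU' UV' fU]] : exists U, [/\ open U, kap @` C `<=` U, U `<=` V' & @fgH R F X tau k (over XQ sl_u U) (over XQ sl_u V')].
  apply: (@local_fg R F n X tau XQ Om B P f sl_u sl_m sl_pt P0 _ _ _ _ _ _ f_cont v s0 s00 push k _ _ cC' oV').
  - by apply: open_comp => // x _; exact: sl_proj_continuous.
  - move=> y Qy; have [Oy py _] := kapQ Qy; have vy : valid Om B P f (sl_u y) (sl_m y).
      by split=> //; rewrite -sl_mP// subKr sl_le.
    split=> //; have [h1 h2] := sl_ptP vy; apply: sl_inj; first by rewrite h1.
    by rewrite h2 -sl_mP// subKr.
  - move=> w i vw; have [h1 h2] := sl_ptP vw; have [Ow wB] := vw; have [Qw kw _] := parO Ow.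
    have uw : sl_u (sl_pt w i) = w by rewrite /sl_u h1.
    split=> //; first by rewrite /XQ /= h1.
      by rewrite /sl_m uw h2 subKr floor_mulK.
    have vw1 : valid Om B P f w (i + 1) by apply: vle vw; rewrite lerDl.
    have [h3 h4] := sl_ptP vw1; apply: sl_inj; first by rewrite sl_proj_tau h1.
    by rewrite sl_height_tau h2 h4 intrD mulrDr mulr1 opprD addrA.
  - move=> y Qy; apply: (@cvg_comp _ _ _ sl_proj kap); first exact: sl_proj_continuous.
    by have [] := kapQ Qy.
  - move=> y Qy; have [Oy py ky] := kapQ Qy.
    have cq : (fun z => f (sl_u z) - sl_height z) @ y --> f (sl_u y) - sl_height y.
      have c1 : f (sl_u z) @[z --> y] --> f (sl_u y).
        apply: (@cvg_comp _ _ _ sl_u f); last exact: f_cont.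
        by apply: (@cvg_comp _ _ _ sl_proj kap); [exact: sl_proj_continuous|exact: ky].
      exact: (cvg_subr c1 (@sl_height_continuous y)).
    have nQ : \forall z \near y, XQ z by apply: sl_proj_continuous; apply: open_nbhs_nbhs.
    (* [f (sl_u z) - sl_height z] is [P] times the integer [sl_m z]. By continuity it varies by less
       than [P], so the integer is locally constant. *)
    have nd : \forall z \near y, `|(f (sl_u y) - sl_height y) - (f (sl_u z) - sl_height z)| < P.
      by move/cvgr_dist_lt : cq; apply.
    apply: filterS (filterI nQ nd) => z [Qz].
    rewrite !sl_mP// -mulrBr normrM gtr0_norm// -[ltRHS]mulr1 ltr_pM2l// -intrB -intr_norm.
    by rewrite -[1]/(1%:~R) ltr_int => ?; lia.
  - move=> Z phi z0 i cphi vphi; have v0 : valid Om B P f (phi z0) i by exact: nbhs_singleton vphi.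
    have [p0 q0] := sl_ptP v0; have [Ow wB] := v0; have [Qw kw cw] := parO Ow.
    apply: sl_cvg; rewrite ?p0 ?q0.
      have : par (phi z) @[z --> z0] --> par (phi z0) by apply: (@cvg_comp _ _ _ phi par); [exact: cphi|exact: cw].
      apply: cvg_trans; apply: near_eq_cvg; apply: filterS vphi => z vz.
      by have [-> _] := sl_ptP vz.
    have : f (phi z) - P * i%:~R @[z --> z0] --> f (phi z0) - P * i%:~R.
      apply: (@cvg_subr R Z (fun z => f (phi z)) (fun=> P * i%:~R)); last exact: cvg_cst.
      by apply: (@cvg_comp _ _ _ phi f); [exact: cphi|exact: f_cont].
    apply: cvg_trans; apply: near_eq_cvg; apply: filterS vphi => z vz.
    by have [_ ->] := sl_ptP vz.
  - by move=> _ [x Cx <-]; have [Ox px _] := kapQ (CQ _ Cx); split=> //; rewrite px; exact: CV.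
  - by move=> w [].
pose U : set L := [set x | Q x /\ U' (kap x)].
exists U; split.
- rewrite openE => x [Qx Ux]; rewrite /interior; have [_ _ cx] := kapQ Qx.
  have h1 : nbhs x Q by apply: open_nbhs_nbhs.
  have h2 : nbhs x (kap @^-1` U') by apply: cx; apply: open_nbhs_nbhs.
  by apply: filterS (filterI h1 h2) => z [].
- by move=> x Cx; split; [exact: CQ|apply: CU'; exists x].
- by move=> x [Qx /UV'[_]]; have [_ -> _] := kapQ Qx.
apply: (@fgH_sub R F X tau k (over XQ sl_u U') _ (over XQ sl_u V')) => //.
by move=> y [Qy [_]]; rewrite /preimage /sl_u; have [_ -> _] := kapQ Qy.
Qed.

End Chart.
End Sublevel.

(** * Pushing below the regular level *)

Section PushChart.
Variables (R : realType) (n : nat) (L : topologicalType) (atl : set (chart R n L))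
  (theta : continuousType L (circle R)) (A : R).
Let P : R := 2 * pi.
Let P0 : 0 < P. Proof. by rewrite mulr_gt0// pi_gt0. Qed.

(* Moving along [v] strictly decreases [f] where this matters, near the level [B] mod [2 pi]; [v = 0] works when
   [f] avoids this level *)
Definition pushable (Om : set 'rV[R]_n) (f : 'rV[R]_n -> R) (B : R) :=
  exists v s0, 0 < s0 /\ forall s w (i : int), 0 < s -> s <= s0 -> Om w -> Om (w + s *: v) ->
    f w - P * i%:~R <= B -> f (w + s *: v) - P * i%:~R < B.

(** Near [w] the function stays strictly between two consecutive levels [B + P * k] and
    [B + P * (k + 1)], so the inequality is strict without any motion. *)
Lemma pushable_away (f : 'rV[R]_n -> R) (w : 'rV[R]_n) B : f @ w --> f w ->
  (forall i : int, f w - P * i%:~R != B) ->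
  exists2 r : R, 0 < r & forall r', r' <= r -> pushable (ball w r') f B.
Proof.
move=> lcoef fB; pose a := (f w - B) / P; pose k := Num.floor a.
have fE : f w = B + P * a by rewrite /a mulrCA mulfV ?gt_eqF// mulr1 addrC subrK.
have k1 : k%:~R < a.
  rewrite lt_neqAle floor_le andbT; apply/eqP => ka; have := fB k; rewrite ka fE addrK eqxx.
  by [].
have k2 : a < (k + 1)%:~R by exact: floorD1_gt.
have nl : \forall z \near w, B + P * k%:~R < f z.
  by move/cvgr_gt : lcoef; apply; rewrite fE ltrD2l ltr_pM2l.
have nr : \forall z \near w, f z < B + P * (k + 1)%:~R.
  by move/cvgr_lt : lcoef; apply; rewrite fE ltrD2l ltr_pM2l.
have /nbhs_ballP[r /= r0 rb] : nbhs w [set z | B + P * k%:~R < f z /\ f z < B + P * (k + 1)%:~R] by exact: filterI nl nr.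
exists r => // r' r'r; exists 0, 1; split=> // s z i _ _ zw _ zB; rewrite scaler0 addr0.
have [h1 h2] : B + P * k%:~R < f z /\ f z < B + P * (k + 1)%:~R by apply: rb; apply: le_ball zw.
rewrite lt_neqAle zB andbT; apply/eqP => zE.
have fz : f z = B + P * i%:~R by rewrite -zE subrK.
move: h1 h2; rewrite fz !ltrD2l !ltr_pM2l// !ltr_int; lia.
Qed.

(** The push goes against the sign of the nonzero partial derivative, and the mean value theorem
    makes [f] decrease strictly. Balls are used because convexity keeps the segment where that sign
    is known. *)
Lemma pushable_regular (f : 'rV[R]_n -> R) (U : set 'rV[R]_n) (w : 'rV[R]_n) B (i : 'I_n) :
  open U -> U w -> Ck_on 1 U f -> partial f i w != 0 ->
  exists2 r : R, 0 < r & forall r', r' <= r -> pushable (ball w r') f B.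
Proof.
move=> oU Uw [_ /(_ i)[df [cd _]]] fi0.
have cdw := cd w (mem_set Uw).
pose e : 'rV[R]_n := delta_mx 0 i.
pose sg : R := Num.sg (partial f i w).
have ng : \forall z \near w, 0 < sg * partial f i z.
  have : (fun z => sg * partial f i z) @ w --> sg * partial f i w by exact: (cvgM (cvg_cst _) cdw).
  by move/cvgr_gt; apply; rewrite /sg -normrEsg normr_gt0.
have nU : nbhs w U by exact: open_nbhs_nbhs.
have /nbhs_ballP[r /= r0 rb] : nbhs w [set z | 0 < sg * partial f i z /\ U z] by exact: filterI ng nU.
exists r => // r' r'r; exists (- sg *: e), 1; split=> // s z j s0 _ zw zsw zB.
have sg2 : sg * sg = 1 by rewrite /sg -expr2 sqr_sg fi0.
have seg a t : ball w r' a -> ball w r' (a + s *: e) -> 0 <= t <= s -> ball w r (a + t *: e).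
  move=> aw asw /andP[t0 ts]; apply: (le_ball r'r).
  have -> : a + t *: e = (1 - t / s) *: a + (t / s) *: (a + s *: e).
    by rewrite scalerDr addrA -scalerDl subrK scale1r scalerA divfK ?gt_eqF.
  apply: cvx_ball => //; apply/andP; split; first by apply: divr_ge0 => //; exact: ltW.
  by rewrite ler_pdivrMr// mul1r.
apply: lt_le_trans zB; rewrite ltrD2r.
(* The mean value theorem is applied in the positive direction [e]: for [sg = 1] the segment is
   therefore run backwards, from the pushed point to [z]. *)
have [sg1|sg1] : sg = 1 \/ sg = -1.
  by rewrite /sg; case: sgrP fi0 => //; [left|right].
- have zE : z + s *: (- sg *: e) + s *: e = z by rewrite sg1 scaleN1r scalerN subrK.
  have H t : 0 <= t <= s -> ball w r (z + s *: (- sg *: e) + t *: e).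
    by apply: seg => //; rewrite zE.
  have [|t ts] := @line_mvt R n f (z + s *: (- sg *: e)) e s s0.
    by move=> t /H /rb[_ /df].
  rewrite zE => E; rewrite -subr_gt0 E pmulr_lgt0//.
  by have [+ _] := rb _ (H _ ts); rewrite sg1 mul1r.
- have zE : z + s *: (- sg *: e) = z + s *: e by rewrite sg1 opprK scale1r.
  rewrite zE in zsw *.
  have [|t ts] := @line_mvt R n f z e s s0; first by move=> t /(seg _ _ zw zsw) /rb[_ /df].
  move=> E; rewrite -subr_lt0 E pmulr_llt0//.
  by have [+ _] := rb _ (seg _ _ zw zsw ts); rewrite sg1 mulN1r oppr_gt0.
Qed.

Definition chart_img (c : chart R n L) (W : set L) := chart_coord c @` (W `&` chart_dom c).

Lemma chart_imgP (c : chart R n L) W : is_chart c -> open W ->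
  open (chart_img c W) /\ forall w, chart_img c W w ->
  [/\ W (chart_param c w), chart_dom c (chart_param c w), chart_coord c (chart_param c w) = w &
   chart_param c @ w --> chart_param c w].
Proof.
move=> [od oi cc cp cK] oW.
have H w : chart_img c W w ->
  [/\ W (chart_param c w), chart_dom c (chart_param c w), chart_coord c (chart_param c w) = w &
   chart_param c @ w --> chart_param c w].
  move=> [x [Wx dx] <-]; rewrite (cK _ (mem_set dx)); split=> //.
  by have := open_within_continuous oi cp (imageP _ dx); rewrite (cK _ (mem_set dx)).
split=> //; rewrite openE => w iw; have [Ww dw kw pw] := H w iw; rewrite /interior.
have h1 : nbhs w (chart_coord c @` chart_dom c) by apply: open_nbhs_nbhs; split=> //; case: iw => x [_ dx] <-; exists x.
have h2 : nbhs w (chart_param c @^-1` W) by apply: pw; exact: open_nbhs_nbhs.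
apply: filterS (filterI h1 h2) => z [[x dx <-]]; rewrite /preimage /= (cK _ (mem_set dx)) => Wx.
by exists x.
Qed.

Hypothesis atlas : smooth_atlas atl.
Hypothesis morse : circle_morse atl theta.
Hypothesis A_regular : regular_value (pullback_atlas (@cover_proj R L theta) atl)
                               (@cover_height R L theta) A.
Let B : R := A + P.

Lemma pushable_chart x0 : exists c W g, [/\ atl c, chart_dom c x0, open W, W x0 &
  [/\ {in W, forall y, theta y = to_circle (g y)}, smooth_on (chart_img c W) (g \o chart_param c) &
  exists2 r : R, 0 < r & forall r', r' <= r -> pushable (ball (chart_coord c x0) r') (g \o chart_param c) B]].
Proof.
have [ach acov _] := atlas; have [W [g [oW Wx gW mg]]] := morse x0.
have fx c : atl c -> chart_dom c x0 -> chart_param c (chart_coord c x0) = x0.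
  by move=> /ach[_ _ _ _ cK] cx; rewrite cK//; exact: mem_set.
(* Off the levels [B + P * i] critical points are harmless. On such a level the cover has a point
   above [x0] at height [A], which is regular by assumption. *)
have [[i0 iB]|nB] := pselect (exists i : int, g x0 - P * i%:~R = B); last first.
  have [c ac cx] := acov x0; exists c, W, g; split=> //; split=> //; first by have [] := mg c ac.
  apply: pushable_away; last by move=> i; rewrite /= fx//; apply/eqP => h; apply: nB; exists i.
  have [/(_ 0%N)[lcoef _] _] := mg c ac; apply: lcoef; apply: mem_set; by exists x0.
have [y [yx yA]] : exists y : cover theta, cover_proj y = x0 /\ cover_height y = A.
  apply: cover_exists; rewrite gW ?mem_set//; apply/to_circleP; exists (- (i0 + 1)).
  by move: iB; rewrite /B /P mulrNz intrD => iB; lra.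
have /existsNP[e /not_implyP[[che [c ac ec]] /not_implyP[ey /existsNP[i /eqP pi0]]]] := A_regular yA.
have cx : chart_dom c x0 by rewrite -yx; have [] := ec y ey.
have eu : chart_coord e y = chart_coord c x0 by rewrite -yx; have [] := ec y ey.
exists c, W, g; split=> //; have [sm _] := mg c ac; split=> //.
have [oU HU] := chart_imgP (ach _ ac) oW.
have Ux : chart_img c W (chart_coord c x0) by exists x0.
have pr := @pushable_regular (g \o chart_param c) (chart_img c W) (chart_coord c x0) B i oU Ux (sm 1%N).
apply: pr.
suff -> : partial (g \o chart_param c) i (chart_coord c x0) = partial (@cover_height R L theta \o chart_param e) i (chart_coord e y) by [].
(* Read in the chart, the height differs from [g] by an integer multiple of [P], locally constant by
   continuity and equal to [A - g x0] at the point. So both have the same partial derivatives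
   there. *)
rewrite /partial -eu -(derive_add_cst _ _ _ (A - g x0)); apply: near_eq_derive.
have [oe oie cce cpe cKe] := che.
have py : chart_param e (chart_coord e y) = y by apply: cKe; exact: mem_set.
have cpy : chart_param e @ chart_coord e y --> y.
  by rewrite -{2}py; apply: (open_within_continuous oie cpe); exists y.
have n1 : nbhs (chart_coord e y) (chart_coord e @` chart_dom e) by apply: open_nbhs_nbhs; split=> //; exists y.
have cpp : cover_proj (chart_param e u) @[u --> chart_coord e y] --> x0.
  rewrite -yx; exact: (@cvg_comp _ _ _ (chart_param e) (@cover_proj R L theta) _ _ _ cpy (@cover_proj_continuous _ _ _ _)).
have n2 : \forall u \near chart_coord e y, W (cover_proj (chart_param e u)).
  by apply: cpp; exact: open_nbhs_nbhs.
have ch : cover_height (chart_param e u) @[u --> chart_coord e y] --> A.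
  rewrite -yA; exact: (@cvg_comp _ _ _ (chart_param e) (@cover_height R L theta) _ _ _ cpy (@cover_height_continuous _ _ _ _)).
have cg : g (chart_param c u) @[u --> chart_coord e y] --> g x0.
  have [lcoef _] := sm 0%N; rewrite eu -{2}(fx c ac cx); apply: lcoef; exact: mem_set.
have cd := cvg_subr ch cg.
have n3 : \forall u \near chart_coord e y, `|(A - g x0) - (cover_height (chart_param e u) - g (chart_param c u))| < P.
  by move/cvgr_dist_lt : cd; apply.
near=> u.
have [y' ey' uE] : (chart_coord e @` chart_dom e) u by near: u.
have pu : chart_param e u = y' by rewrite -uE; apply: cKe; exact: mem_set.
have [cy' cy'E] := ec _ ey'.
have pcu : chart_param c u = cover_proj y'.
  by rewrite -uE cy'E; have [_ _ _ _ cK] := ach _ ac; rewrite cK//; exact: mem_set.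
have Wy' : W (cover_proj y') by rewrite -pu; near: u.
have : `|(A - g x0) - (cover_height (chart_param e u) - g (chart_param c u))| < P by near: u.
have [j jE] : exists j : int, cover_height y' - g (cover_proj y') = P * j%:~R.
  apply/to_circleP; rewrite -gW ?mem_set//; exact: (set_valP y').
have [j0 j0E] : exists j : int, A - g x0 = P * j%:~R.
  by exists (- (i0 + 1)); move: iB; rewrite /B /P mulrNz intrD => iB; lra.
rewrite /= pu pcu jE j0E -mulrBr normrM gtr0_norm// -[ltRHS]mulr1 ltr_pM2l// -intrB -intr_norm.
rewrite -[1]/(1%:~R) ltr_int => h; have -> : j0 = j by lia.
by rewrite -jE addrC subrK.
Unshelve. all: by end_near. Qed.

Hypothesis L_haus : hausdorff_space L.
Hypothesis L_comp : compact [set: L].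

Theorem fgH_sublevel (F : fieldType) k :
  @fgH R F (sublevel theta B) (sublevel_shift theta B) k setT setT.
Proof.
apply: (@fgH_global R F (sublevel theta B) L (sublevel_shift theta B) (@sl_proj R L theta B)) => //.
  exact: sl_proj_continuous.
move=> x0; have [c [W [g [ac cx oW Wx [gW sm [r r0 rp]]]]]] := pushable_chart x0.
have [ach _ _] := atlas; have [oU HU] := chart_imgP (ach _ ac) oW.
have [od oi cc cp cK] := ach _ ac.
have Ux : chart_img c W (chart_coord c x0) by exists x0.
have /nbhs_ballP[r1 /= r10 r1U] : nbhs (chart_coord c x0) (chart_img c W) by exact: open_nbhs_nbhs.
pose r' := Num.min r r1; have r'0 : 0 < r' by rewrite lt_min r0.
pose Om : set 'rV[R]_n := ball (chart_coord c x0) r'.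
have OU : Om `<=` chart_img c W by move=> w h; apply: r1U; apply: le_ball h; rewrite ge_min lexx orbT.
have [v [s0 [s00 push]]] : pushable Om (g \o chart_param c) B by apply: rp; rewrite ge_min lexx.
have ccx x : chart_dom c x -> chart_coord c @ x --> chart_coord c x by exact: open_within_continuous.
pose Q : set L := [set x | [/\ W x, chart_dom c x & Om (chart_coord c x)]].
have oQ : open Q.
  rewrite openE => x [Qx dx Ox]; rewrite /interior.
  have h1 : nbhs x (chart_coord c @^-1` Om) by apply: (ccx _ dx); apply: open_nbhs_nbhs; split=> //; exact: ball_open.
  have h2 : nbhs x W by exact: open_nbhs_nbhs.
  have h3 : nbhs x (chart_dom c) by exact: open_nbhs_nbhs.
  by apply: filterS (filterI h1 (filterI h2 h3)) => z [? []].
exists Q; split=> //; first by split=> //; exact: ballxx.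
(* Some point of the sublevel set is needed as the dummy value of [sl_pt]; [g x0] lowered by enough
   periods is the height of one above [x0]. *)
have [y0 _] : exists y : sublevel theta B, sl_proj y = x0 /\ sl_height y = g x0 - P * (Num.floor ((g x0 - B) / P) + 1)%:~R.
  apply: sl_exists.
    rewrite gW ?mem_set//; apply/to_circleP; eexists (- _); rewrite addrAC subrr add0r mulrNz mulrN; reflexivity.
  have := floorD1_gt ((g x0 - B) / P); rewrite ltr_pdivrMr// => h.
  by rewrite lerBlDr -lerBlDl mulrC ltW.
move=> C V cC CQ oV CV k'.
apply: (@sl_local_fg R L theta B n Q (chart_coord c) (chart_param c) Om (g \o chart_param c) y0 oQ _ _ _ _ _ v s0 s00 push) => //.
- exact: ball_open.
- by move=> x [Wx' dx Ox]; split=> //; [rewrite cK//; exact: mem_set|exact: ccx].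
- by move=> w Ow; have [h1 h2 h3 h4] := HU w (OU _ Ow); split=> //; split=> //; rewrite h3.
- by move=> w Ow; have [h1 h2 h3 h4] := HU w (OU _ Ow); rewrite gW// mem_set.
- by move=> w Ow; have [lcoef _] := sm 0%N; apply: lcoef; apply: mem_set; exact: OU.
Qed.

End PushChart.

(** * Presentations over the polynomials, and ranks *)

(** Elimination without division: a row with pivot [p] clears the first column of the other rows
    after they are multiplied by [p]. The absence of zero divisors is a hypothesis, and not a
    structure on the ring, so that the lemma also applies to [laurent]. *)
Lemma left_kernel (R : comNzRingType) n m (A : 'M[R]_(n, m)) :
  (forall x y : R, x * y = 0 -> x = 0 \/ y = 0) -> (m < n)%N ->
  exists2 a : 'rV[R]_n, a <> 0 & a *m A = 0.
Proof.
move=> nzd; elim: m n A => [|m IH] [|n] A // mn.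
  exists (const_mx 1); last by rewrite thinmx0.
  by move/rowP/(_ 0); rewrite !mxE => /eqP; rewrite oner_eq0.
have [allz|/existsNP[i0 p0]] := pselect (forall i, A i 0 = 0).
  have [|a a0 aA] := IH n.+1 (\matrix_(i, j) A i (fintype.lift 0 j)); first exact: ltnW.
  exists a => //; apply/rowP => j; rewrite !mxE; case: (unliftP 0 j) => [j' ->|->].
    by have /rowP/(_ j') := aA; rewrite !mxE => E; rewrite -[RHS]E; apply: eq_bigr => i _; rewrite mxE.
  by rewrite big1 // => i _; rewrite allz mulr0.
pose p := A i0 0.
have [|a a0 aA] := IH n (\matrix_(i, j)
    (p * A (fintype.lift i0 i) (fintype.lift 0 j) - A (fintype.lift i0 i) 0 * A i0 (fintype.lift 0 j))); first by [].
pose s := \sum_i a 0 i * A (fintype.lift i0 i) 0.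
pose b : 'rV[R]_n.+1 := \row_i if unlift i0 i is Some i' then p * a 0 i' else - s.
have bA j : (b *m A) 0 j = p * (\sum_i a 0 i * A (fintype.lift i0 i) j) - s * A i0 j.
  rewrite mxE (bigD1_ord i0) //= mxE unlift_none mulNr addrC; congr (_ - _).
  by rewrite mulr_sumr; apply: eq_bigr => i _; rewrite mxE liftK mulrA.
exists b.
  move=> b0; apply: a0; apply/rowP => i; have /rowP/(_ (fintype.lift i0 i)) := b0.
  by rewrite !mxE liftK => /nzd[/p0|].
apply/rowP => j; rewrite bA mxE; case: (unliftP 0 j) => [j' ->|->]; last by rewrite -/s -/p mulrC subrr.
have /rowP/(_ j') := aA; rewrite !mxE => E; rewrite -[RHS]E mulr_sumr mulr_suml -sumrB.
by apply: eq_bigr => i _; rewrite !mxE mulrBr; congr (_ - _); rewrite -?mulrA //; ring.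
Qed.

Section IDomain.
Variable R : idomainType.
Local Notation Fr := {fraction R}.
Local Notation fr := (@tofrac R).

Lemma clear_denominators m n (A : 'M[Fr]_(m, n)) :
  exists2 d : R, d != 0 & exists B : 'M[R]_(m, n), map_mx fr B = fr d *: A.
Proof.
have fracE x : exists p : R * R, p.2 != 0 /\ fr p.1 = fr p.2 * x.
  elim/quotW: x => y; exists (val y); split; first exact: denom_ratioP.
  have dy := denom_ratioP y; rewrite -[RHS]/(FracField.mul _ _) /= !piE.
  apply/eqmodP; rewrite /= FracField.equivfE /FracField.mulf !numden_Ratio ?mulf_neq0 ?oner_eq0//.
  by apply/eqP; ring.
have /choice[p pP] := fracE.
pose d := \prod_i \prod_j (p (A i j)).2.
have d0 : d != 0 by apply/prodf_neq0 => i _; apply/prodf_neq0 => j _; have [] := pP (A i j).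
pose w i j := (\prod_(i' | i' != i) \prod_j' (p (A i' j')).2) * \prod_(j' | j' != j) (p (A i j')).2.
exists d => //; exists (\matrix_(i, j) (w i j * (p (A i j)).1)).
apply/matrixP => i j; rewrite !mxE [LHS]rmorphM; have [_ E] := pP (A i j); rewrite [X in _ * X]E.
rewrite mulrA -rmorphM; congr (fr _ * _).
by rewrite /d (bigD1 i) //= (bigD1 j (P := xpredT)) //= /w; ring.
Qed.

Lemma map_tofrac_inj m n (A B : 'M[R]_(m, n)) : map_mx fr A = map_mx fr B -> A = B.
Proof.
move=> /matrixP E; apply/matrixP => i j; have := E i j; rewrite !mxE.
by move=> /eqP; rewrite tofrac_eq => /eqP.
Qed.

End IDomain.

(** [M] is the quotient by the row space of [A], so a basis of a complement of that space maps to a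
    basis of [M]. *)
Lemma has_rank_coker (F : fieldType) (M : lmodType F) r m (A : 'M[F]_(m, r))
    (f : {linear 'rV[F]_r -> M}) :
  (forall x, exists e, f e = x) -> (forall e, f e = 0 <-> (e <= A)%MS) ->
  has_rank M (r - \rank A).
Proof.
move=> fs fk; rewrite -mxrank_compl.
have sumE n (B : 'M[F]_(n, r)) (a : 'I_n -> F) :
    \sum_i a i *: f (row i B) = f ((\row_i a i) *m B).
  by rewrite mulmx_sum_row linear_sum; apply: eq_bigr => i _; rewrite linearZ mxE.
split.
  exists (fun i => f (row i (row_base (A^C)%MS))) => a; rewrite sumE => /fk h i.
  have : (\row_i a i) *m row_base (A^C)%MS = 0.
    apply/eqP; rewrite -submx0 -(capmx_compl A) sub_capmx h.
    by rewrite (submx_trans (submxMl _ _)) // eq_row_base.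
  move/eqP; rewrite -submx0 => /submx0null.
  rewrite -[RHS](mul0mx _ (row_base (A^C)%MS)) => /(row_free_inj (row_base_free _)).
  by move=> /rowP/(_ i); rewrite !mxE.
case=> v vi; have /choice[e ev] : forall i, exists e, f e = v i by move=> i; exact: fs.
pose E : 'M[F]_(_, r) := \matrix_(i, j) e i 0 j.
have /rowV0Pn[a /sub_kermxP aE /eqP a0] : kermx (E *m cokermx A) != 0.
  rewrite -mxrank_eq0 mxrank_ker -lt0n subn_gt0 (leq_ltn_trans (mxrankM_maxr _ _))//.
  by rewrite mxrank_coker mxrank_compl.
apply: a0; apply/rowP => i; rewrite mxE; apply: (vi (a 0)).
transitivity (\sum_i a 0 i *: f (row i E)).
  by apply: eq_bigr => j _; rewrite -ev; congr (_ *: f _); apply/rowP => l; rewrite !mxE.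
rewrite sumE (_ : \row_i _ = a); last by apply/rowP => l; rewrite mxE.
by apply/fk; rewrite submxE -mulmxA aE.
Qed.

Section Presentation.
Variables (F : fieldType) (H : lmodType F) (t : {linear H -> H}).
Local Notation P := {poly F}.
Variables (r : nat) (G : 'I_r -> pmod t).

Definition pcomb (a : 'rV[P]_r) : pmod t := \sum_i a 0 i *: G i.

Lemma pcomb_linear : linear pcomb.
Proof.
move=> k a b; rewrite /pcomb scaler_sumr -big_split; apply: eq_bigr => i _.
by rewrite !mxE scalerDl scalerA.
Qed.
HB.instance Definition _ := GRing.isLinear.Build P 'rV[P]_r (pmod t) _ pcomb pcomb_linear.

Variables (r' : nat) (M : 'M[P]_(r', r)).
Hypothesis Ggen : forall h : pmod t, exists a, h = pcomb a.
Hypothesis GM : forall a, pcomb a = 0 <-> exists y, a = y *m M.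
Hypothesis Minj : forall y : 'rV[P]_r', y *m M = 0 -> y = 0.

Lemma relations_le : (r' <= r)%N.
Proof.
rewrite leqNgt; apply/negP => /(left_kernel M)[|y y0 /Minj //] x z /eqP.
by rewrite mulf_eq0 => /orP[] /eqP; [left|right].
Qed.

Let ev0 : {rmorphism P -> F} := horner_eval (0 : F).
Let M0 := map_mx ev0 M.

Lemma poly_split0 (m n : nat) (a : 'M[P]_(m, n)) :
  a = map_mx polyC (map_mx ev0 a) + 'X *: map_mx (drop_poly 1) a.
Proof.
apply/matrixP => i j; rewrite !mxE; apply/polyP => l.
rewrite coefD coefC coefXM coef_drop_poly /ev0 /= horner_evalE horner_coef0.
by case: l => [|l]; rewrite /= ?addr0 ?add0r ?addn1.
Qed.

Lemma pcombX a : pcomb ('X *: a) = t (pcomb a).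
Proof. by rewrite linearZ /= pmodE -['X]mul1r pactMX pact1. Qed.

Lemma pcomb_split a :
  pcomb a = pcomb (map_mx polyC (map_mx ev0 a)) + t (pcomb (map_mx (drop_poly 1) a)) :> H.
Proof. by rewrite -pcombX {1}(poly_split0 a); exact: linearD. Qed.

Lemma pcombC (e : F) a : pcomb (e%:P *: a) = e *: (pcomb a : H).
Proof. by rewrite linearZ /= pmodE pactC. Qed.

Lemma pcombP (e : F) a b : pcomb (e%:P *: a + b) = e *: (pcomb a : H) + (pcomb b : H) :> H.
Proof. by rewrite [LHS]linearD; congr (_ + _); exact: pcombC. Qed.

Lemma ev0C m n (e : 'M[F]_(m, n)) : map_mx ev0 (map_mx polyC e) = e.
Proof. by apply/matrixP => i j; rewrite !mxE /ev0 /= horner_evalE hornerC. Qed.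

Lemma ev0X m n (a : 'M[P]_(m, n)) : map_mx ev0 ('X *: a) = 0.
Proof. by apply/matrixP => i j; rewrite !mxE /ev0 /= horner_evalE hornerM hornerX mul0r. Qed.

(** By [pcomb_split] a combination equals that of its constant terms modulo the range of t. So
    constant vectors generate the cokernel, and they vanish there exactly when they lie in the row
    space of [M0]. *)
Lemma has_rank_coker_t : has_rank (quotmod (range t)) (r - \rank M0).
Proof.
pose f (e : 'rV[F]_r) : quotmod (range t) := quot_proj (range t) (pcomb (map_mx polyC e) : H).
have fL : linear f.
  move=> k a b; rewrite /f.
  have -> : map_mx polyC (k *: a + b) = k%:P *: map_mx polyC a + map_mx polyC b.
    by apply/rowP => i; rewrite !mxE polyCD polyCM.
  by rewrite pcombP linearP.
pose fl : {linear 'rV[F]_r -> quotmod (range t)} := HB.pack f (GRing.isLinear.Build _ _ _ _ _ fL).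
apply: (@has_rank_coker _ _ _ _ _ fl).
  move=> x; rewrite -[x]quot_reprK; have [a ->] := Ggen (repr x).
  exists (map_mx ev0 a); apply/quot_proj_eq; rewrite (pcomb_split a).
  rewrite opprD addrA subrr sub0r rpredN; apply: sub_span; exact: imageT.
move=> e; rewrite -[fl e]/(f e).
have -> : f e = 0 <-> exists h, (pcomb (map_mx polyC e) : H) = t h.
  rewrite /f -(linear0 (quot_proj (range t))); split=> [/quot_proj_eq|[h hE]].
    rewrite subr0 => h; suff : range t (pcomb (map_mx polyC e)) by case=> g _ <-; exists g.
    move: h; apply: span_min => //; split=> [|k _ _ [x _ <-] [y _ <-]]; first by exists 0; rewrite ?linear0.
    by exists (k *: x + y); rewrite ?linearP.
  by apply/quot_proj_eq; rewrite subr0 hE; apply: sub_span; exact: imageT.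
split=> [[h]|/submxP[y yE]].
  have [a ->] := Ggen h; rewrite -pcombX => /eqP; rewrite -subr_eq0 -linearB => /eqP/GM[y yE].
  have := congr1 (map_mx ev0) yE; rewrite map_mxM map_mxB.
  by rewrite ev0C ev0X subr0 => ->; exact: submxMl.
pose z := map_mx polyC y *m M.
have z0 : map_mx ev0 z = e.
  by rewrite /z map_mxM yE ev0C.
have : pcomb z = 0 by apply/GM; exists (map_mx polyC y).
move=> h; have := pcomb_split z; rewrite h z0 => /esym/eqP; rewrite addr_eq0 => /eqP ->.
by eexists (- _); rewrite linearN.
Qed.

(** The computation of Tor_1: if a constant vector [e] satisfies [e *m M0 = 0], then [e *m M] is
    divisible by 'X, and the quotient represents an element killed by t. Every such element arises
    once, because the rows of [M] are independent. *)
Lemma has_rank_ker_t : has_rank (kermod t) (r' - \rank M0).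
Proof.
pose K := row_base (kermx M0).
have KM0 : K *m M0 = 0 by apply/sub_kermxP; rewrite eq_row_base.
rewrite -mxrank_ker.
pose f0 (e : 'rV[F]_(\rank (kermx M0))) : H := pcomb (map_mx (drop_poly 1) (map_mx polyC (e *m K) *m M)).
have Xf0 (e : 'rV[F]_(\rank (kermx M0))) : 'X *: map_mx (drop_poly 1) (map_mx polyC (e *m K) *m M) = map_mx polyC (e *m K) *m M.
  by rewrite [RHS]poly_split0 (map_mxM ev0) ev0C -mulmxA -/M0 KM0 mulmx0 map_mx0 add0r.
have Xinj (a b : 'rV[P]_r) : 'X *: a = 'X *: b -> a = b.
  by move=> /rowP E; apply/rowP => i; have := E i; rewrite !mxE; apply: mulfI; rewrite polyX_eq0.
have f0L : linear f0.
  move=> k a b; rewrite /f0 -pcombC -linearD; congr pcomb; apply: Xinj.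
  rewrite scalerDr [X in _ = X + _]scalerA ['X * _]mulrC -scalerA !Xf0.
  rewrite scalemxAl -mulmxDl; congr (_ *m _); rewrite mulmxDl -scalemxAl.
  by apply/rowP => i; rewrite !mxE polyCD polyCM.
have f0k e : f0 e \in ker_pred t.
  apply/eqP; rewrite /f0 -pcombX Xf0; apply/GM; by eexists.
pose f e := KerMod (f0k e).
have fL : linear f by move=> k a b; apply: val_inj; exact: f0L.
pose fl : {linear 'rV[F]_(\rank (kermx M0)) -> kermod t} := HB.pack f (GRing.isLinear.Build _ _ _ _ _ fL).
have := @has_rank_coker _ _ _ _ (0 : 'M[F]_(\rank (kermx M0), _)) fl; rewrite mxrank0 subn0; apply.
  case=> h hk; have /eqP th := hk; have [x xE] := Ggen h.
  have /GM[y yE] : pcomb ('X *: x) = 0 by rewrite pcombX -xE.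
  have /submxP[e eE] : (map_mx ev0 y <= K)%MS.
    rewrite eq_row_base; apply/sub_kermxP; rewrite -map_mxM -yE.
    exact: ev0X.
  exists e; apply: val_inj => /=; rewrite /f0 xE.
  apply/eqP; rewrite -subr_eq0 -linearB; apply/eqP/GM; exists (- map_mx (drop_poly 1) y).
  apply: Xinj; rewrite scalerBr Xf0 -eE yE {2}(poly_split0 y) mulmxDl -scalemxAl opprD addrA subrr sub0r.
  by rewrite mulNmx scalerN.
move=> e; rewrite submx0; split=> [|/eqP ->]; last exact: linear0.
move=> /(congr1 (@ker_val _ _ _ t)) /= /GM[y yE].
have /Minj E : (map_mx polyC (e *m K) - 'X *: y) *m M = 0.
  by rewrite mulmxBl -Xf0 yE scalemxAl subrr.
have : e *m K = 0.
  by have := congr1 (map_mx ev0) E; rewrite map_mx0 map_mxB ev0C ev0X subr0.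
by rewrite -[RHS](mul0mx _ K) => /(row_free_inj (row_base_free _)) ->.
Qed.

End Presentation.

Section HomologyPresentation.
Variables (R : realType) (F : fieldType) (X : topologicalType) (tau : continuousType X X) (k : nat).
Local Notation P := {poly F}.
Local Notation Ch := (pchain R F tau k).
Local Notation Bd := (@bnd R F X tau setT k).
Local Notation dk := (Defs.bd R F X k).

Definition presents r (g : 'I_r -> Ch) r' (M : 'M[P]_(r', r)) :=
  [/\ forall i, dk (g i) = 0,
      forall z : Ch, dk z = 0 -> exists a : 'rV[P]_r, Bd (z - \sum_i a 0 i *: g i),
      forall a : 'rV[P]_r, Bd (\sum_i a 0 i *: g i) <-> exists y, a = y *m M &
      forall y : 'rV[P]_r', y *m M = 0 -> y = 0].

Lemma fg_presents : @fgH R F X tau k setT setT ->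
  exists r (g : 'I_r -> Ch) r' (M : 'M[P]_(r', r)), presents g M.
Proof.
have sT : stable tau setT by [].
move=> [r [g [gc gs]]]; pose f (a : 'rV[P]_r) : Ch := \sum_i a 0 i *: g i.
have fP c a b : f (c *: a + b) = c *: f a + f b.
  rewrite /f scaler_sumr -big_split; apply: eq_bigr => i _.
  by rewrite !mxE scalerDl scalerA.
have sB := bnd_submodule k sT : submodule (Bd : set Ch).
have sN : submodule [set a | Bd (f a)].
  split=> [|c a b]; rewrite /= ?fP; last exact: sB.2.
  by rewrite /f big1 => [|i _]; [exact: sB.1|rewrite mxE scale0r].
have [r' [M [MN NM Minj]]] := poly_submodule_basis sN.
exists r, g, r', M; split=> // [i|z bz|a]; first by have [] := gc i.
  have [|a aB] := gs z; first by split=> // s _ y.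
  by exists (\row_i a i); under eq_bigr do rewrite mxE.
by split=> [/NM//|[y ->]]; exact: MN.
Qed.

Variables (r : nat) (g : 'I_r -> Ch) (r' : nat) (M : 'M[P]_(r', r)).
Hypothesis gM : presents g M.
Local Notation t := (homology_push R F tau k).

Theorem presents_pitcher : exists q s : nat,
  [/\ has_rank (quotmod (range t)) q, has_rank (kermod t) s, (r' <= r)%N & q%:Z - s%:Z = (r - r')%:Z].
Proof.
have [gc gs gr gi] := gM.
pose tK : {linear kermod dk -> kermod dk} := ker_map (bd_chain_map tau (m := k)).
pose N := [set z : kermod dk | exists x, ker_val z = Defs.bd R F X k.+1 x].
have sN : submodule N.
  split=> [|a x y [u xu] [v yv]]; first by exists 0; rewrite linear0.
  by exists (a *: u + v); rewrite linearP -xu -yv.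
have qt z : quot_proj N (tK z) = t (quot_proj N z) by exact/esym/quot_mapE.
pose q : {linear pmod tK -> pmod t} :=
  HB.pack (quot_proj N : pmod tK -> pmod t) (GRing.isLinear.Build _ _ _ _ _ (pmod_linear qt)).
pose vl : {linear kermod dk -> chain R F X k} :=
  HB.pack (@ker_val _ _ _ dk) (GRing.isLinear.Build _ _ _ _ (@ker_val _ _ _ dk) (fun a x y => erefl)).
have vt z : vl (tK z) = chain_map R F tau k (vl z) by [].
pose v : {linear pmod tK -> Ch} :=
  HB.pack (vl : pmod tK -> Ch) (GRing.isLinear.Build _ _ _ _ _ (pmod_linear vt)).
have q0 z : q z = 0 <-> N z.
  rewrite -[X in _ = X](linear0 (quot_proj N)); split=> [/quot_proj_eq|h]; last first.
    by apply/quot_proj_eq; rewrite subr0; exact: sub_span.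
  by rewrite subr0 => h; exact: (@span_min _ _ N N sN (fun _ => id) z h).
have gk i : g i \in ker_pred dk by apply/eqP.
pose K i : pmod tK := KerMod (gk i).
pose G i : pmod t := q (K i).
have GE a : pcomb G a = q (\sum_i a 0 i *: K i).
  by rewrite linear_sum; apply: eq_bigr => i _; rewrite linearZ.
have vE (a : 'rV[P]_r) : v (\sum_i a 0 i *: K i) = \sum_i a 0 i *: g i.
  by rewrite linear_sum; apply: eq_bigr => i _; rewrite linearZ.
have BN (z : pmod tK) : Bd (v z) <-> N z.
  by split=> [[w _ h]|[w h]]; exists w.
have Ggen h : exists a, h = pcomb G a.
  have [z ->] : exists z, h = q z by exists (repr h); rewrite /q /= quot_reprK.
  have [a aB] := gs (v z) (eqP (ker_valP z)).
  exists a; apply/eqP; rewrite GE -subr_eq0 -linearB; apply/eqP/q0/BN.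
  by rewrite linearB vE.
have GM a : pcomb G a = 0 <-> exists y, a = y *m M.
  by rewrite GE -gr -vE; split=> [/q0/BN|/BN/q0].
exists (r - \rank (map_mx (horner_eval 0) M))%N, (r' - \rank (map_mx (horner_eval 0) M))%N.
have rr := relations_le gi; split=> //.
- exact: (has_rank_coker_t Ggen GM).
- exact: (has_rank_ker_t Ggen GM gi).
have := rank_leq_row (map_mx (horner_eval (0 : F)) M); have := rank_leq_col (map_mx (horner_eval (0 : F)) M).
by move: (\rank _) => p; lia.
Qed.

End HomologyPresentation.

(** * Transfer of the rank to the integral chains of the cover *)

Section RankMod.
Variables (R : nzRingType) (M : lmodType R).
Implicit Types P N : set M.

(** Independence in the quotient of [P] by [N], stated with representatives. Ranks can then be
    compared along maps given only on chains. *)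
Definition has_indep P N n := exists2 v : 'I_n -> M, forall i, P (v i) &
  forall a : 'I_n -> R, N (\sum_i a i *: v i) -> forall i, a i = 0.

Definition rank_mod P N b := has_indep P N b /\ ~ has_indep P N b.+1.

End RankMod.

Lemma homology_rank (R : nzRingType) (A B C : lmodType R) (d : {linear A -> B}) (e : {linear B -> C}) b :
  rank_mod [set z | e z = 0] (range d) b -> has_rank (homology d e) b.
Proof.
pose N := [set z : kermod e | exists x, ker_val z = d x].
have sN : submodule N.
  split=> [|a x y [u xu] [v yv]]; first by exists 0; rewrite linear0.
  by exists (a *: u + v); rewrite linearP -xu -yv.
have q0 (z : kermod e) : quot_proj N z = 0 <-> range d (ker_val z).
  rewrite -(linear0 (quot_proj N)); split=> [/quot_proj_eq|[x _ xz]].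
    by rewrite subr0 => h; have [x ->] : N z := @span_min _ _ N N sN (fun _ => id) z h; exists x.
  by apply/quot_proj_eq; rewrite subr0; apply: sub_span; exists x.
have vS n (a : 'I_n -> R) (v : 'I_n -> kermod e) : ker_val (\sum_i a i *: v i) = \sum_i a i *: ker_val (v i).
  pose vl : {linear kermod e -> B} := HB.pack (@ker_val _ _ _ e) (GRing.isLinear.Build _ _ _ _ (@ker_val _ _ _ e) (fun a x y => erefl)).
  by have /= -> := linear_sum vl; apply: eq_bigr => i _; rewrite -[LHS]/(vl (a i *: v i)) linearZ.
suff E n : has_indep [set z | e z = 0] (range d) n <-> exists v : 'I_n -> homology d e,
    forall a : 'I_n -> R, \sum_i a i *: v i = 0 -> forall i, a i = 0.
  by case=> /E h1 h2; split=> // /E.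
split=> [[v vk vi]|[v vi]].
  have vk' i : v i \in ker_pred e by apply/eqP; exact: vk.
  exists (fun i => quot_proj N (KerMod (vk' i))) => a h; apply: vi.
  rewrite -(vS _ _ (fun i => KerMod (vk' i))); apply/q0; rewrite -h linear_sum.
  by apply: eq_bigr => i _; rewrite linearZ.
exists (fun i => ker_val (repr (v i))) => [i|a]; first by have /eqP := ker_valP (repr (v i)).
rewrite -vS => /q0 h; apply: vi; rewrite -[RHS]h linear_sum.
by apply: eq_bigr => i _; rewrite linearZ /= quot_reprK.
Qed.

Section Transfer.
Variables (R1 R2 : idomainType) (psi : {rmorphism R1 -> R2}) (M1 : lmodType R1) (M2 : lmodType R2).
Variables (phi : {additive M1 -> M2}) (P1 N1 : set M1) (P2 N2 : set M2).
Hypothesis psi_inj : injective psi.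
Hypothesis phiZ : forall a x, phi (a *: x) = psi a *: phi x.
Hypothesis frac : forall a, exists n m, n != 0 /\ psi m = psi n * a.
Hypothesis sN2 : submodule N2.
Hypothesis P12 : forall z, P1 z -> P2 (phi z).
Hypothesis N12 : forall z, N1 z -> N2 (phi z).
Hypothesis P21 : forall x, P2 x -> exists n z, [/\ n != 0, P1 z & phi z = psi n *: x].
Hypothesis N21 : forall z, N2 (phi z) -> exists2 n, n != 0 & N1 (n *: z).

Let common_denominator k (a : 'I_k -> R2) : exists n (m : 'I_k -> R1), n != 0 /\ forall i, psi (m i) = psi n * a i.
Proof.
have /choice[n /choice[m nm]] := fun i => frac (a i).
exists (\prod_i n i), (fun i => m i * \prod_(j | j != i) n j); split=> [|i].
  by apply/prodf_neq0 => i _; have [] := nm i.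
have -> : \prod_j n j = n i * \prod_(j | j != i) n j by rewrite (bigD1 i).
have [_ E] := nm i; rewrite !rmorphM E; ring.
Qed.

Let phi_sum n (a : 'I_n -> R1) (z : 'I_n -> M1) : phi (\sum_i a i *: z i) = \sum_i psi (a i) *: phi (z i).
Proof. by rewrite raddf_sum; apply: eq_bigr => i _; rewrite phiZ. Qed.

(** [phi] becomes an isomorphism of the quotients once nonzero scalars are inverted: [P21] is
    surjectivity and [N21] injectivity up to such a scalar. It is used with integers as denominators
    from Z to Q, and with powers of 'X from the sublevel set to the cover. *)
Lemma has_indep_transfer n : has_indep P1 N1 n <-> has_indep P2 N2 n.
Proof.
split=> -[v vP vi].
  exists (fun i => phi (v i)) => [i|a aN]; first exact: P12.
  have [c [m [c0 mE]]] := common_denominator a.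
  have /N21[c' c'0] : N2 (phi (\sum_i m i *: v i)).
    rewrite phi_sum; under eq_bigr do rewrite mE -scalerA.
    by rewrite -scaler_sumr; exact: submoduleZ.
  rewrite scaler_sumr; under eq_bigr do rewrite scalerA; move/vi => H i.
  have m0 : m i = 0 by apply/eqP; have /eqP := H i; rewrite mulf_eq0 (negbTE c'0).
  have := mE i; rewrite m0 rmorph0 => /esym/eqP; rewrite mulf_eq0 => /orP[|/eqP //].
  by rewrite -[X in _ == X](rmorph0 psi) (inj_eq psi_inj) (negbTE c0).
have /choice[c /choice[z cz]] := fun i => P21 (vP i).
exists z => [i|a /N12]; first by have [] := cz i.
rewrite phi_sum => h i.
have : psi (a i * c i) = 0.
  apply: (vi (fun i => psi (a i * c i))); rewrite [X in N2 X](_ : _ = \sum_i psi (a i) *: phi (z i)) //.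
  by apply: eq_bigr => j _; have [_ _ ->] := cz j; rewrite rmorphM scalerA.
rewrite -[RHS](rmorph0 psi) => /psi_inj /eqP; rewrite mulf_eq0 => /orP[/eqP //|].
by have [/negbTE -> _ _] := cz i.
Qed.

Lemma rank_mod_transfer b : rank_mod P1 N1 b <-> rank_mod P2 N2 b.
Proof. by split=> -[h1 h2]; split; try exact/has_indep_transfer; move=> /has_indep_transfer. Qed.

End Transfer.

(* [K' = D - K Q] with [Q] a pseudo-inverse of [K] up to the denominator [D] *)
Lemma rel_approx (R : idomainType) m n (K : 'M[R]_(m, n)) : exists D (K' : 'M[R]_m),
  [/\ D != 0, K' *m K = 0 & forall (S : comNzRingType) (f : {rmorphism R -> S}) p (e : 'M[S]_(p, m)),
    e *m map_mx f K = 0 -> f D *: e = e *m map_mx f K'].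
Proof.
pose fr := @tofrac R.
have [D D0 [Q QE]] := clear_denominators (pinvmx (map_mx fr K)).
exists D, (D%:M - K *m Q); split=> //.
  apply: map_tofrac_inj.
  rewrite mulmxBl -mulmxA map_mx0 map_mxB !map_mxM map_scalar_mx QE -scalemxAl -scalemxAr mul_scalar_mx.
  by rewrite mulmxA mulmxKpV ?submx_refl ?subrr.
move=> S f p e eK; rewrite map_mxB map_scalar_mx map_mxM mulmxBr mulmxA eK mul0mx subr0.
by rewrite mul_mx_scalar.
Qed.

Section PresentsRank.
Variables (R : realType) (F : fieldType) (X : topologicalType) (tau : continuousType X X) (k : nat).
Local Notation P := {poly F}.
Local Notation Ch := (pchain R F tau k).

(** Over the fraction field the rows of [M] stay independent. A complement of their span, cleared of
    denominators, provides [r - r'] independent classes. *)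
Lemma presents_rank r (g : 'I_r -> Ch) r' (M : 'M[P]_(r', r)) : presents g M ->
  rank_mod [set z : Ch | Defs.bd R F X k z = 0] (@bnd R F X tau setT k) (r - r').
Proof.
move=> [gc gs gr gi].
have sB : submodule (@bnd R F X tau setT k) by apply: bnd_submodule.
pose f (a : 'rV[P]_r) : Ch := \sum_i a 0 i *: g i.
have fL : linear f.
  move=> c a b; rewrite /f scaler_sumr -big_split; apply: eq_bigr => i _.
  by rewrite !mxE scalerDl scalerA.
pose fl : {linear 'rV[P]_r -> Ch} := HB.pack f (GRing.isLinear.Build _ _ _ _ _ fL).
have sumE n (B : 'M[P]_(n, r)) (a : 'I_n -> P) : \sum_i a i *: fl (row i B) = fl ((\row_i a i) *m B).
  by rewrite mulmx_sum_row linear_sum; apply: eq_bigr => i _; rewrite linearZ mxE.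
have nzd (x y : P) : x * y = 0 -> x = 0 \/ y = 0.
  by move/eqP; rewrite mulf_eq0 => /orP[] /eqP; [left|right].
have rr := relations_le gi.
pose fr := @tofrac P.
split.
  have rM : \rank (map_mx fr M) = r'.
    apply/eqP; rewrite -/(row_free _) -kermx_eq0; apply/negPn/negP => /rowV0Pn[v /sub_kermxP vM v0].
    have [d d0 [a aE]] := clear_denominators v.
    have a0 : a = 0 by apply/gi/map_tofrac_inj; rewrite map_mxM aE -scalemxAl vM scaler0 map_mx0.
    move: aE; rewrite a0 map_mx0 => /esym/eqP; rewrite scaler_eq0 (negbTE v0) orbF.
    by rewrite tofrac_eq0 (negbTE d0).
  have rC : \rank (map_mx fr M)^C%MS = (r - r')%N by rewrite mxrank_compl rM.
  rewrite -rC; set W := (map_mx fr M)^C%MS.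
  have [d d0 [J JE]] := clear_denominators (row_base W).
  exists (fun i => fl (row i J)) => [i|a].
    rewrite /= /f; have := linear_sum (pbd R F tau k) => /= ->; apply: big1 => j _.
    by have := pbdP (J i j) (g j) 0; rewrite linear0 !addr0 mxE => ->; rewrite gc scaler0.
  rewrite sumE => /gr[y yE].
  have z0 : map_mx fr (\row_i a i) *m row_base W = 0.
    apply/eqP; rewrite -submx0 -(capmx_compl (map_mx fr M)) sub_capmx; apply/andP; split.
      rewrite -(eqmx_scale _ (_ : fr d != 0)) ?tofrac_eq0 //.
      by rewrite scalemxAr -JE -map_mxM yE map_mxM submxMl.
    by rewrite (submx_trans (submxMl _ _)) // eq_row_base.
  move: z0; rewrite -[RHS](mul0mx _ (row_base W)) => /(row_free_inj (row_base_free _)).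
  rewrite -(map_mx0 fr) => /map_tofrac_inj /rowP E i; have := E i; by rewrite !mxE.
(* The coefficient rows of [r - r' + 1] cycles and the [r'] relations are [r + 1] rows of width [r],
   hence dependent. By independence of the relations the dependence involves the cycles. *)
case=> v vc vi; have /choice[e eP] := fun i => gs (v i) (vc i).
pose E : 'M[P]_(_, r) := \matrix_(i, j) e i 0 j.
have [|w w0 wE] := left_kernel (col_mx E M) nzd; first by lia.
move: w0 wE; rewrite -[w]hsubmxK mul_row_col; set a := lsubmx w; set y := rsubmx w => w0 E0.
have a0 : a = 0.
  apply/rowP => i; rewrite [RHS]mxE; apply: (vi (a 0)).
  have -> : \sum_i a 0 i *: v i = \sum_i a 0 i *: (v i - fl (e i)) + fl (a *m E).
    have -> : a *m E = (\row_i a 0 i) *m E by congr (_ *m _); apply/rowP => j; rewrite [RHS]mxE.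
    rewrite -sumE -big_split /=; apply: eq_bigr => j _; rewrite (_ : row j E = e j).
      by rewrite -[RHS]scalerDr subrK.
    by apply/rowP => l; rewrite !mxE.
  apply: (submoduleD sB); last by apply/gr; exists (- y); rewrite mulNmx; apply/eqP; rewrite -addr_eq0 E0.
  by apply: submodule_sum => // j _; apply: submoduleZ => //; exact: eP.
apply: w0; move: E0; rewrite a0 mul0mx add0r => /gi ->.
by rewrite row_mx0.
Qed.

End PresentsRank.

Section RatFreeg.
Variable K : choiceType.
Local Notation FZ := {freeg K / int}.
Local Notation FQ := {freeg K / rat}.

(** Additivity is enough for integer coefficients. [flift_ext] does not apply to maps into rational
    chains, which are not linear over a common ring. *)
Lemma additive_ext (V : zmodType) (f g : {additive FZ -> V}) :
  (forall x, f << x >> = g << x >>) -> f =1 g.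
Proof.
move=> fg c; rewrite -[c]freeg_sumE !raddf_sum; apply: eq_bigr => x _; rewrite freegUZ.
have fgn (n : nat) : f (n%:Z *: << x >>) = g (n%:Z *: << x >>).
  elim: n => [|n IH]; first by rewrite scale0r !raddf0.
  by rewrite intS scalerDl scale1r !raddfD /= IH fg.
by case: (coeff x c) => n; rewrite ?NegzE ?scaleNr ?raddfN; [|congr (- _)]; exact: fgn.
Qed.

Definition ratc (c : FZ) : FQ := flift (fun x => << x >> : zmodule FQ) c.

Lemma ratcB : zmod_morphism ratc.
Proof. by move=> x y; rewrite /ratc linearB. Qed.
HB.instance Definition _ := GRing.isZmodMorphism.Build FZ FQ ratc ratcB.

Lemma ratcU x : ratc << x >> = << x >>.
Proof. by rewrite /ratc fliftU. Qed.

Lemma ratcZ a c : ratc (a *: c) = a%:~R *: ratc c.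
Proof. by rewrite /ratc linearZ /= scalezrE scaler_int. Qed.

Lemma coeff_ratc x c : coeff x (ratc c) = (coeff x c)%:~R.
Proof.
apply: (@carried_ind _ _ setT [set c | coeff x (ratc c) = (coeff x c)%:~R]) => [|y _|//].
  split=> [|a u v /= uE vE]; first by rewrite /= raddf0 !coeff0.
  by rewrite raddfD /= ratcZ !coeffD !coeffZ uE vE intrD intrM.
by rewrite /= ratcU !coeffU !mul1r; case: (y == x).
Qed.

Lemma ratc_inj : injective ratc.
Proof.
move=> c d E; apply/eqP/freeg_eqP => x; apply: (@intr_inj rat).
by rewrite -!coeff_ratc E.
Qed.

Lemma ratc_frac (c : FQ) : exists2 n : int, n != 0 & exists x, ratc x = n%:~R *: c.
Proof.
rewrite -[c]freeg_sumE; elim/big_ind: _ => [|a b [n n0 [x xE]] [m m0 [y yE]]|z _].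
- by exists 1 => //; exists 0; rewrite raddf0 scaler0.
- exists (n * m); first by rewrite mulf_neq0.
  exists (m *: x + n *: y); rewrite raddfD /= !ratcZ xE yE !scalerA -!intrM.
  by rewrite scalerDr [m * n]mulrC.
- exists (denq (coeff z c)); first exact: denq_neq0.
  exists (numq (coeff z c) *: << z >>); rewrite ratcZ ratcU [in RHS]freegUZ scalerA.
  by rewrite [X in X *: _]numqE mulrC.
Qed.

End RatFreeg.

Section RationalTransfer.
Variables (R : realType) (X : topologicalType) (tau : continuousType X X) (k : nat).
Local Notation CZ := (pchain R int tau k).
Local Notation CQ := (pchain R rat tau k).

Lemma ratc_bd j (c : chain R int X j) : ratc (Defs.bd R int X j c) = Defs.bd R rat X j (ratc c).
Proof.
apply: (@additive_ext _ _ (@ratc _ \o Defs.bd R int X j) (Defs.bd R rat X j \o @ratc _)) => s /=.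
rewrite ratcU !bdU; case: j {c} s => [|j] s /=; first by rewrite raddf0.
rewrite raddf_sum; apply: eq_bigr => i _; rewrite /= ratcZ ratcU.
by rewrite rmorphXn rmorphN1.
Qed.

Lemma ratc_chain_map (Y : topologicalType) (f : continuousType X Y) j (c : chain R int X j) :
  ratc (chain_map R int f j c) = chain_map R rat f j (ratc c).
Proof.
apply: (@additive_ext _ _ (@ratc _ \o chain_map R int f j) (chain_map R rat f j \o @ratc _)) => s /=.
by rewrite ratcU !chain_mapU ratcU.
Qed.

Definition pQ : {rmorphism {poly int} -> {poly rat}} := map_poly (intr : int -> rat).

Lemma ratc_pact (p : {poly int}) (c : CZ) : ratc (p *: c : CZ) = pQ p *: (ratc c : CQ) :> CQ.
Proof.
rewrite !pmodE (pactE _ (n := size p)) // (pactE _ (n := size p)) ?size_map_inj_poly //; last exact: intr_inj.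
rewrite [LHS]raddf_sum; apply: eq_bigr => i _; rewrite /= ratcZ coef_map; congr (_ *: _).
by elim: (nat_of_ord i) => //= j <-; rewrite ratc_chain_map.
Qed.

Theorem rational_rank b :
  rank_mod [set z : CQ | Defs.bd R rat X k z = 0] (range (Defs.bd R rat X k.+1)) b ->
  rank_mod [set z : CZ | Defs.bd R int X k z = 0] (range (Defs.bd R int X k.+1)) b.
Proof.
pose phi : {additive CZ -> CQ} := HB.pack (@ratc _ : CZ -> CQ) (GRing.isZmodMorphism.Build CZ CQ _ (@ratcB _)).
have cst (n : int) (c : CZ) : n%:P *: c = n *: (c : chain R int X k) :> CZ by rewrite pmodE pactC.
have cstQ (n : int) (c : CQ) : pQ n%:P *: c = n%:~R *: (c : chain R rat X k) :> CQ.
  by rewrite /pQ /= map_polyC pmodE pactC.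
apply: (iffRL (@rank_mod_transfer _ _ pQ CZ CQ phi _ _ _ _ _ ratc_pact _ _ _ _ _ _ b)).
- exact/map_inj_poly/rmorph0/intr_inj.
- move=> a; have [q [n n0 ->]] := rat_poly_scale a.
  exists n%:P, q; split; first by rewrite polyC_eq0.
  by rewrite /pQ /= map_polyC mul_polyC scalerA divff ?scale1r ?intr_eq0.
- split=> [|a _ _ [u _ <-] [v _ <-]]; first by exists 0; rewrite ?linear0.
  exists ((a *: (u : pchain R rat tau k.+1) : pchain R rat tau k.+1) + v) => //; exact: pbdP.
- move=> z bz; apply: etrans (esym (ratc_bd z)) _.
  by rewrite (bz : Defs.bd R int X k z = 0) raddf0.
- by move=> _ [w _ <-]; exists (ratc w) => //; rewrite -ratc_bd.
- move=> x bx; have [n n0 [z zE]] := ratc_frac x.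
  exists n%:P, z; split; rewrite ?polyC_eq0 ?cstQ //=.
  by apply: ratc_inj; rewrite ratc_bd zE linearZ /= bx scaler0 raddf0.
- move=> z [w _ wE]; have [n n0 [w' w'E]] := ratc_frac w.
  exists n%:P; first by rewrite polyC_eq0.
  exists w' => //; apply: ratc_inj; rewrite cst ratc_bd ratcZ w'E linearZ /=.
  by congr (_ *: _); exact: wE.
Qed.

End RationalTransfer.

Lemma simplex_bounded (R : realType) m (h : std_simplex R m -> R) : continuous h ->
  exists b : R, forall x, h x <= b.
Proof.
move=> hc; pose P (b : R) (u : 'rV[R]_m.+1) := forall x : std_simplex R m, set_val x = u -> h x <= b.
have /compact_near_coveringP/(_ R (+oo)%R P) := @compact_simplex R m.
case=> [u /mem_set uS|b [_ bP]].
  pose x : std_simplex R m := SigSub uS.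
  have : nbhs x [set y | h y < h x + 1] by apply: (cvgr_lt (h x) (hc x)); rewrite ltrDl.
  move=> /near_simplex[e e0 eU].
  near=> u' b => y /= yu; apply: le_trans (_ : h x + 1 <= b).
    by apply/ltW/eU; rewrite yu; near: u'; exact: cvgr_dist_lt.
  by near: b; apply: nbhs_pinfty_ge; exact: num_real.
by exists (b + 1) => x; apply: (bP (b + 1) _ (set_val x) (set_valP x)); rewrite ?ltrDl.
Unshelve. all: by end_near. Qed.

Section SublevelTransfer.
Variables (R : realType) (L : topologicalType) (theta : continuousType L (circle R)) (B : R) (k : nat).
Local Notation K := (cover theta).
Local Notation X := (sublevel theta B).
Local Notation CK j := (pchain R int (cover_shift theta 1) j).
Local Notation CX j := (pchain R int (sublevel_shift theta B) j).
Local Notation V := [set y : K | cover_height y <= B].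

Lemma sublevel_incl_continuous : continuous (set_val : X -> K).
Proof. exact: initial_continuous. Qed.
Definition sublevel_incl : continuousType X K := mkcont sublevel_incl_continuous.
Local Notation inc j := (chain_map R int sublevel_incl j).

Lemma inc_shift j (c : chain R int X j) :
  inc j (chain_map R int (sublevel_shift theta B) j c) = chain_map R int (cover_shift theta 1) j (inc j c).
Proof.
apply: (flift_ext (f := inc j \o chain_map R int (sublevel_shift theta B) j)
  (g := chain_map R int (cover_shift theta 1) j \o inc j)) => s /=.
by rewrite !chain_mapU; congr << _ >>; apply/continuousEP.
Qed.

Lemma inc_inj j : injective (inc j).
Proof.
have H (s s' : singular R X j) : (sublevel_incl \o s : singular R K j) = (sublevel_incl \o s' : singular R K j) -> s = s'.
  move=> E; apply/continuousEP => x; apply: val_inj.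
  by have := congr1 (fun u : singular R K j => u x) E.
have coeff_inc (s : singular R X j) c : coeff (sublevel_incl \o s : singular R K j) (inc j c) = coeff s c.
  apply: (@carried_ind _ _ setT [set c | coeff (sublevel_incl \o s : singular R K j) (inc j c) = coeff s c]) => [|s' _|//].
    split=> [|a u v /= uE vE]; first by rewrite /= linear0 !coeff0.
    by rewrite linearP /= !coeffD !coeffZ uE vE.
  rewrite /= chain_mapU !coeffU !mul1r; congr (nat_of_bool _)%:R.
  by apply/eqP/eqP => [/H|->].
by move=> c d E; apply/eqP/freeg_eqP => s; rewrite -!coeff_inc E.
Qed.

Lemma inc_lift j (c : chain R int K j) : carried (inside V j) c -> exists x, inc j x = c.
Proof.
apply: (@carried_ind _ _ (inside V j) [set c | exists x, inc j x = c]) => [|s sV].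
  split=> [|a _ _ [x <-] [y <-]]; first by exists 0; rewrite linear0.
  by exists (a *: x + y); rewrite linearP.
have sV' x : s x \in V by apply/mem_set/sV; exists x.
have cs : continuous (fun x => SigSub (sV' x) : X).
  by apply: (@continuous_comp_initial _ _ _ set_val) => x; exact: cts_fun.
exists << (mkcont cs : singular R X j) >>; rewrite chain_mapU; congr << _ >>.
exact/continuousEP.
Qed.

(** The height is bounded on each simplex by compactness, and each power of t lowers it by [2 * pi].
    The bound is stated for all large [n] so that it passes to sums. *)
Lemma shift_into j (c : CK j) : exists N : nat, forall n, (N <= n)%N -> carried (inside V j) ('X^n *: c : CK j).
Proof.
have sV : stable (cover_shift theta 1) V.
  by move=> y yV; have := sublevel_shift_subproof (SigSub (mem_set yV) : X); rewrite inE.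
have sI : submodule (carried (inside V j) : set (CK j)).
  apply: pmod_submodule => [|e]; first exact: carried_submodule.
  apply: (carried_map (f := chain_map R int (cover_shift theta 1) j) (Q := carried (inside V j))) => [|s ss].
    exact: carried_submodule.
  by rewrite chain_mapU; apply: carriedU => _ [x _ <-] /=; apply/sV/ss; exists x.
apply: (@carried_ind _ _ setT [set c : CK j |
  exists N : nat, forall n, (N <= n)%N -> carried (inside V j) ('X^n *: c : CK j)]) => [|s _|//].
  split=> [|a u v [N uN] [M vM]].
    by exists 0%N => n _; rewrite scaler0; exact: carried0.
  exists (maxn N M) => n; rewrite geq_max => /andP[Nn Mn].
  have -> : 'X^n *: (a *: u + v : CK j) = a%:P *: ('X^n *: (u : CK j)) + 'X^n *: (v : CK j) :> CK j.
    by rewrite scalerDr scalerA mulrC -scalerA [a%:P *: (u : CK j)]pmodE pactC.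
  by apply: sI.2; [exact: uN|exact: vM].
have [b bP] : exists b : R, forall x, cover_height (s x) <= b.
  pose h x := cover_height (s x).
  have hc : continuous h.
    move=> x; apply: (@continuous_comp _ _ _ s (@cover_height R L theta)); first exact: cts_fun.
    exact: cover_height_continuous.
  exact: simplex_bounded hc.
have XnE n : ('X^n *: (<< s >> : CK j) : CK j) = << (cover_shift theta n%:Z \o s : singular R K j) >>.
  elim: n => [|n IH].
    rewrite expr0 scale1r; congr << _ >>; apply/continuousEP => x /=; apply: val_inj => /=.
    by rewrite mulr0 subr0 -surjective_pairing.
  rewrite exprS -scalerA IH pmodE -['X]mul1r pactMX pact1 /= chain_mapU; congr << _ >>.
  apply/continuousEP => x /=; apply: val_inj => /=; congr pair.
  by rewrite intS intrD; ring.
pose z : int := Num.floor ((b - B) / (2 * pi)) + 1; pose N := `|z|%N.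
have P0 : 0 < 2 * pi :> R by rewrite mulr_gt0 // pi_gt0.
exists N => n Nn; rewrite XnE; apply: carriedU => _ [x _ <-] /=.
rewrite /cover_height /= lerBlDr -lerBlDl; apply: le_trans (_ : b - B <= _).
  by rewrite lerD2r; exact: bP.
rewrite -ler_pdivrMl // mulrC; apply: ltW; apply: lt_le_trans (floorD1_gt _) _.
by rewrite ler_int -/z; lia.
Qed.

Theorem sublevel_rank b :
  rank_mod [set z : CX k | Defs.bd R int X k z = 0] (range (Defs.bd R int X k.+1)) b ->
  rank_mod [set z : CK k | Defs.bd R int K k z = 0] (range (Defs.bd R int K k.+1)) b.
Proof.
pose phi : {additive CX k -> CK k} := HB.pack (inc k : CX k -> CK k)
  (GRing.isZmodMorphism.Build (CX k) (CK k) _ (linearB (inc k))).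
have phiZ a x : phi (a *: x) = idfun a *: phi x.
  by have := pmod_linear (@inc_shift k) a x 0; rewrite !addr0 raddf0 addr0.
have X0 n : 'X^n != 0 :> {poly int} by rewrite monic_neq0 // monicXn.
have incX j n x : inc j ('X^n *: (x : CX j)) = 'X^n *: (inc j x : CK j) :> CK j.
  by have := pmod_linear (@inc_shift j) 'X^n x 0; rewrite !addr0 raddf0 addr0.
have bdX n (c : CK k.+1) : Defs.bd R int K k.+1 ('X^n *: c : CK k.+1) = 'X^n *: (Defs.bd R int K k.+1 c : CK k) :> CK k.
  by have := pbdP 'X^n c 0; rewrite linear0 !addr0.
have bdX' n (c : CK k) : Defs.bd R int K k ('X^n *: c : CK k) = 'X^n *: (Defs.bd R int K k c : CK k.-1) :> CK k.-1.
  by have := pbdP 'X^n c 0; rewrite linear0 !addr0.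
apply: (iffLR (@rank_mod_transfer _ _ idfun (CX k) (CK k) phi _ _ _ _ _ phiZ _ _ _ _ _ _ b)) => //.
- by move=> a; exists 1, a; rewrite oner_eq0 mul1r.
- split=> [|a _ _ [u _ <-] [v _ <-]]; first by exists 0; rewrite ?linear0.
  exists ((a *: (u : CK k.+1) : CK k.+1) + v) => //; exact: pbdP.
- move=> z bz; apply: etrans (bd_chain_map _ _) _.
  by rewrite (bz : Defs.bd R int X k z = 0) linear0.
- by move=> _ [w _ <-]; exists (inc k.+1 w); [|apply: etrans (bd_chain_map sublevel_incl (m := k.+1) w) _].
- move=> x bx; have [n /(_ n (leqnn n)) /inc_lift[z zE]] := shift_into x.
  exists 'X^n, z; split=> //; apply: (@inc_inj k.-1).
  by rewrite linear0 -bd_chain_map zE bdX' (bx : Defs.bd R int K k x = 0) scaler0.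
- move=> z [w _ wE]; have [n /(_ n (leqnn n)) /inc_lift[w' w'E]] := shift_into w.
  exists 'X^n => //; exists w' => //; apply: (@inc_inj k).
  apply: etrans (esym (bd_chain_map sublevel_incl (m := k.+1) w')) _.
  by rewrite w'E bdX wE; exact/esym/incX.
Qed.

End SublevelTransfer.

(** * The Novikov homology *)

Section LaurentFacts.

Definition lcoef (i : int) (f : laurent) : int := f i.
Lemma lcoef_additive i : zmod_morphism (lcoef i).
Proof. by []. Qed.
HB.instance Definition _ i := GRing.isZmodMorphism.Build laurent int (lcoef i) (lcoef_additive i).

Lemma laurentP (f g : laurent) : (forall i, f i = g i) -> f = g.
Proof. by move=> fg; apply: val_inj; apply/funext. Qed.

Lemma laurentME (f g : laurent) n : (f * g : laurent) n = \sum_(i \in [set: int]) f i * g (n - i).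
Proof. by []. Qed.

Lemma laurent_bound (f : laurent) : exists N, forall i, i < N -> f i = 0.
Proof. by case: f => f /= /asboolP. Qed.

(* The lowest coefficients multiply *)
Lemma laurent_domain (f g : laurent) : f * g = 0 -> f = 0 \/ g = 0.
Proof.
have low (h : laurent) : h = 0 \/ exists2 v, h v <> 0 & forall i, i < v -> h i = 0.
  have [|/existsNP[j hj]] := pselect (forall i, h i = 0); first by move=> h0; left; exact: laurentP.
  have [N hN] := laurent_bound h; right.
  have Nj : N <= j by rewrite leNgt; apply/negP => /hN.
  have ex : exists n : nat, h (N + n%:Z) != 0.
    by exists `|j - N|%N; rewrite gez0_abs ?subr_ge0 // addrCA subrr addr0; apply/eqP.
  case: (ex_minnP ex) => m hm mmin; exists (N + m%:Z); first exact/eqP.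
  move=> i im; apply/eqP/negPn/negP => hi.
  have Ni : N <= i by rewrite leNgt; apply/negP => /hN /eqP; exact/negP.
  have := mmin `|i - N|%N; rewrite gez0_abs ?subr_ge0 // addrCA subrr addr0 => /(_ hi); lia.
case: (low f) => [->|[u fu fl]]; first by left.
case: (low g) => [->|[v gv gl]]; first by right.
move=> /(congr1 (lcoef (u + v))); rewrite raddf0 /lcoef laurentME.
rewrite (fsum_zint (a := u) (b := u)).
  rewrite (_ : [set _ | _] = [set u]).
    by rewrite fsbig_set1 [u + v]addrC addrK => /eqP; rewrite mulf_eq0 => /orP[] /eqP.
  by apply/seteqP; split=> i /=; [lia|move=> ->; lia].
move=> i iu; have [iu'|] := ltP i u; first by rewrite fl ?mul0r.
by move=> ui; rewrite gl ?mulr0 //; lia.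
Qed.

Lemma mono_bounded (n : int) : (fun i : int => (i == n)%:R : int) \in laurent_pred.
Proof. by apply/asboolP; exists n => i; case: eqP => // ->; rewrite ltxx. Qed.
Definition mono n : laurent := Laurent (mono_bounded n).

Lemma mulr_mono (f : laurent) n i : (f * mono n : laurent) i = f (i - n).
Proof.
rewrite laurentME (fsum_zint (a := i - n) (b := i - n)) => [|j jn].
  rewrite (_ : [set _ | _] = [set i - n]); first by rewrite fsbig_set1 /= subKr eqxx mulr1.
  by apply/seteqP; split=> j /=; [lia|move=> ->; lia].
by rewrite /= (_ : (i - j == n) = false) ?mulr0 //; apply/negbTE; apply: contra jn => /eqP; lia.
Qed.

Lemma laurentDE (f g : laurent) i : (f + g : laurent) i = f i + g i.
Proof. by []. Qed.

Lemma intr_laurent (c i : int) : (c%:~R : laurent) i = c * (i == 0)%:R.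
Proof.
rewrite -[LHS]/(lcoef i (1 *~ c)) raddfMz /lcoef.
by rewrite -mulrzr mulrC intz.
Qed.

Lemma polyL_comm : commr_rmorph (intr : int -> laurent) (mono 1).
Proof. by move=> x; exact: mulrC. Qed.
Definition polyL : {rmorphism {poly int} -> laurent} := horner_morph polyL_comm.

Lemma polyL_step p c : polyL (p * 'X + c%:P) = polyL p * mono 1 + c%:~R.
Proof. by rewrite rmorphD rmorphM /polyL /= horner_morphX horner_morphC. Qed.

Lemma polyLE p i : polyL p i = if 0 <= i then p`_`|i|%N else 0.
Proof.
elim/poly_ind: p i => [|p c IH] i; first by rewrite rmorph0 coef0 if_same.
rewrite polyL_step laurentDE mulr_mono intr_laurent IH coefD coefMX coefC.
case: i => [[|n]|n] //=.
- by rewrite !add0r mulr1.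
- by rewrite mulr0 !addr0 subn1.
by rewrite mulr0 addr0.
Qed.

Lemma polyL_inj : injective polyL.
Proof.
move=> p q E; apply/polyP => i; have := polyLE p i; by rewrite E polyLE /= => ->.
Qed.

Lemma polyL_eq0 p : polyL p = 0 -> p = 0.
Proof. by rewrite -[X in _ = X](rmorph0 polyL) => /polyL_inj. Qed.

Lemma polyL_Xn n : polyL 'X^n = mono n%:Z.
Proof.
apply: laurentP => -[i|i]; rewrite polyLE //= coefXn.
by rewrite eqz_nat.
Qed.

Lemma laurent_poly_polyL p : laurent_poly (polyL p).
Proof.
apply: sub_finite_set (finite_zint 0 (size p)%:Z) => i /=; rewrite polyLE.
case: ifP => [|]; last by rewrite eqxx.
case: i => // i _ pi; have : (i < size p)%N by rewrite ltnNge; apply: contra pi => /(nth_default 0) /= ->.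
by rewrite lez_nat => /ltnW.
Qed.

(** The threshold form allows one power of 'X to clear finitely many series at once, by taking the
    maximum of the thresholds. *)
Lemma laurent_poly_clear (f : laurent) : laurent_poly f ->
  exists N, forall n : nat, (N <= n)%N -> exists p, polyL p = polyL 'X^n * f.
Proof.
move=> ff; have [M fM] := laurent_bound f.
have [U fU] : exists U : int, forall i, U < i -> f i = 0.
  have [s sE] : exists s : seq int, forall i, f i != 0 -> i \in s.
    have /finite_seqP[s sE] := ff; exists s => i fi.
    by have : [set` s] i by rewrite -sE.
  exists (\sum_(j <- s) `|j|) => i Ui; apply/eqP/negPn/negP => /sE is_.
  have : i <= \sum_(j <- s) `|j|.
    rewrite (big_rem i) //=; apply: le_trans (ler_norm i) _; rewrite lerDl.
    by apply: sumr_ge0.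
  by rewrite leNgt Ui.
exists `|M|%N => n Mn; exists (\poly_(i < (`|U| + n).+1) f (i%:Z - n%:Z)).
apply: laurentP => i; rewrite mulrC polyL_Xn mulr_mono polyLE coef_poly.
case: ifP => i0; last by rewrite fM //; lia.
rewrite gez0_abs //; case: ifP => // iU; rewrite fU //; lia.
Qed.

End LaurentFacts.

Section Novikov.
Variables (R : realType) (L : topologicalType) (theta : continuousType L (circle R)).
Local Notation K := (cover theta).
Local Notation S j := (pchain R int (cover_shift theta 1) j).
Local Notation bd j := (Defs.bd R int K j).
Local Notation sh i j := (chain_map R int (cover_shift theta i) j).
Local Notation P := {poly int}.

Lemma shift_comp i i' j (s : singular R K j) :
  (cover_shift theta i \o (cover_shift theta i' \o s : singular R K j) : singular R K j) =
  (cover_shift theta (i + i') \o s : singular R K j).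
Proof.
apply/continuousEP => x /=; apply: val_inj => /=; congr pair.
by rewrite intrD; ring.
Qed.

Lemma shift0 j (s : singular R K j) : (cover_shift theta 0 \o s : singular R K j) = s.
Proof.
apply/continuousEP => x /=; apply: val_inj => /=.
by rewrite mulr0 subr0 -surjective_pairing.
Qed.

Lemma shift_inj i i' j (s : singular R K j) :
  (cover_shift theta i \o s : singular R K j) = (cover_shift theta i' \o s : singular R K j) -> i = i'.
Proof.
move=> /(congr1 (fun u : singular R K j => cover_height (u (vertex R ord0)))) /=.
rewrite /cover_height /= => /addrI /oppr_inj /mulfI H.
apply: (@intr_inj R); apply: H.
by rewrite mulf_neq0 // gt_eqF // trigo.pi_gt0.
Qed.

Lemma coeff_shift i j (s : singular R K j) (c : chain R int K j) :
  coeff s (sh i j c) = coeff (cover_shift theta (- i) \o s : singular R K j) c.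
Proof.
apply: (@carried_ind _ _ setT [set c | coeff s (sh i j c) = coeff (cover_shift theta (- i) \o s : singular R K j) c]) => [|u _|//].
  split=> [|a u v /= uE vE]; first by rewrite /= linear0 !coeff0.
  by rewrite linearP /= !coeffD !coeffZ uE vE.
rewrite /= chain_mapU !coeffU !mul1r; congr (nat_of_bool _)%:R.
by apply/eqP/eqP => [<-|->]; rewrite shift_comp ?addNr ?subrr shift0.
Qed.

(** The shift acts freely, since it changes heights, so each simplex of [c] meets the orbit of [s]
    for at most one exponent. *)
Lemma coord_fin j (s : singular R K j) (c : chain R int K j) :
  finite_set [set i : int | coeff (cover_shift theta i \o s : singular R K j) c != 0].
Proof.
pose F (c : {freeg (singular R K j) / int}) := finite_set [set i : int | coeff (cover_shift theta i \o s : singular R K j) c != 0].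
apply: (@carried_ind _ _ setT F) => [|u _|//].
  split=> [|a u v uF vF].
    by apply: sub_finite_set (finite_set0 _) => i /=; rewrite coeff0 eqxx.
  apply: (@sub_finite_set _ _ ([set i : int | coeff (cover_shift theta i \o s : singular R K j) u != 0] `|`
    [set i : int | coeff (cover_shift theta i \o s : singular R K j) v != 0])); last by rewrite finite_setU; split.
  move=> i /=; rewrite coeffD coeffZ => h; case: (eqVneq (coeff (cover_shift theta i \o s : singular R K j) u) 0) => [u0|]; last by left.
  by right; move: h; rewrite u0 mulr0 add0r.
have [[i0 iE]|nE] := pselect (exists i, u = (cover_shift theta i \o s : singular R K j)); last first.
  apply: sub_finite_set (finite_set0 _) => i /=; rewrite coeffU mul1r.
  case: (u =P _) => [uE _|_]; last by rewrite eqxx.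
  by apply: nE; exists i.
apply: sub_finite_set (finite_set1 i0) => i /=; rewrite coeffU mul1r.
case: (u =P _) => [+ _|_]; last by rewrite eqxx.
by rewrite iE => /shift_inj ->.
Qed.

Lemma finite_bounded (f : int -> int) : finite_set [set i | f i != 0] -> f \in laurent_pred.
Proof.
move=> /finite_seqP[s sE]; apply/asboolP; exists (- \sum_(j <- s) `|j|) => i iU.
apply/eqP/negPn/negP => fi; have : [set` s] i by rewrite -sE.
move=> /= is_; move: iU; rewrite ltNge => /negP; apply.
rewrite lerNl (big_rem i) //=; apply: le_trans (_ : `|i| <= _); first by rewrite -normrN ler_norm.
by rewrite lerDl; apply: sumr_ge0.
Qed.

(* The coefficients of [c] along the orbit of [s], as a Laurent series *)
Definition coord j (s : singular R K j) (c : chain R int K j) : laurent := Laurent (finite_bounded (coord_fin s c)).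

Lemma coordE j (s : singular R K j) c i : coord s c i = coeff (cover_shift theta i \o s : singular R K j) c.
Proof. by []. Qed.

Lemma coord_poly j (s : singular R K j) c : laurent_poly (coord s c).
Proof. exact: coord_fin. Qed.

Lemma coordD j (s : singular R K j) : {morph coord s : c d / c + d}.
Proof. by move=> c d; apply: laurentP => i; rewrite laurentDE !coordE coeffD. Qed.

Lemma coord_lp_act p j (s : singular R K j) c : laurent_poly p -> coord s (lp_act p c) = p * coord s c.
Proof.
move=> pf; apply: laurentP => n; rewrite coordE laurentME /lp_act fsbig_finite // raddf_sum /=.
transitivity (\sum_(i \in [set i | p i != 0]) p i * coord s c (n - i)); last first.
  by apply: fsbig_widen => // i [_ /= /negP /negPn /eqP ->]; rewrite mul0r.
rewrite [RHS]fsbig_finite //; apply: eq_bigr => i _.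
by rewrite coeffZ coeff_shift coordE shift_comp addrC.
Qed.

(** A chain is determined by its coordinates, its coefficient at [s] being entry 0 of [coord s].
    Both actions multiply coordinates by [polyL p]. *)
Lemma pact_lp (p : P) j (c : S j) : p *: c = lp_act (polyL p) c :> S j.
Proof.
apply/eqP/freeg_eqP => s; rewrite -[s]shift0 -!coordE coord_lp_act; last exact: laurent_poly_polyL.
suff -> : coord s (p *: c : S j) = polyL p * coord s c by [].
elim/poly_ind: p => [|p a IH].
  by rewrite scale0r rmorph0 mul0r; apply: laurentP => i; rewrite coordE coeff0.
rewrite scalerDl coordD polyL_step mulrDl; congr (_ + _).
  rewrite mulrC -scalerA pmodE -['X]mul1r pactMX pact1.
  rewrite mulrAC -IH; apply: laurentP => i; rewrite mulr_mono !coordE coeff_shift shift_comp.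
  by rewrite addrC.
apply: laurentP => i; rewrite pmodE pactC mulrC laurentME.
rewrite (fsum_zint (a := i) (b := i)) => [|l li].
  rewrite (_ : [set _ | _] = [set i]).
    by rewrite fsbig_set1 subrr intr_laurent mulr1 mulrC !coordE coeffZ.
  by apply/seteqP; split=> l /=; [lia|move=> ->; lia].
rewrite intr_laurent (_ : (i - l == 0) = false) ?mulr0 //; apply/negbTE; apply: contra li => /eqP; lia.
Qed.

Local Notation T j := (tensor theta j).
Local Notation rel j := (@tensor_rel R L theta j).

Definition tens j (c : S j) : T j := quot_proj (rel j) << c >>.

Lemma tensD j : {morph @tens j : c d / c + d}.
Proof.
move=> c d; rewrite /tens -linearD; apply/quot_proj_eq.
by rewrite opprD addrA; apply: sub_span; left; exists c, d.
Qed.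

Lemma tens_zmod j : zmod_morphism (@tens j).
Proof.
have b0 : @tens j 0 = 0 by apply: (@addrI _ (tens 0)); rewrite -tensD !addr0.
move=> c d; apply: (@addIr _ (tens d)); rewrite subrK -tensD subrK //.
Qed.
HB.instance Definition _ j := GRing.isZmodMorphism.Build (S j) (T j) (@tens j) (@tens_zmod j).

Lemma tensZ (p : P) j (c : S j) : tens (p *: c) = polyL p *: tens c.
Proof.
rewrite /tens -linearZ pact_lp; apply/quot_proj_eq; apply: sub_span; right.
exists (polyL p), c; split=> //; exact: laurent_poly_polyL.
Qed.

Lemma tens_bd j (c : S j) : tensor_bd theta j (tens c) = tens (bd j c : S j.-1).
Proof. by rewrite [LHS]quot_mapE; congr quot_proj; exact: fliftU. Qed.

(** [coord s] respects the relations defining the tensor product, so its linear extension [f]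
    factors through [tensor]. *)
Lemma tens_coord j (s : singular R K j) m (c : 'I_m -> S j) (l : 'I_m -> laurent) :
  \sum_i l i *: tens (c i) = 0 -> \sum_i l i * coord s (c i) = 0.
Proof.
pose f : {linear {freeg (S j) / laurent} -> laurent^o} := flift (fun c : S j => coord s c : laurent^o).
have fl : f (\sum_i l i *: << c i >>) = \sum_i l i * coord s (c i).
  by rewrite linear_sum; apply: eq_bigr => i _; rewrite linearZ /= fliftU.
rewrite -fl => h; have : \sum_i l i *: << c i >> \in span (rel j).
  rewrite -[X in X \in _]subr0; apply/quot_proj_eq; rewrite linear0 -[RHS]h linear_sum.
  by apply: eq_bigr => i _; rewrite linearZ.
apply: (@span_min _ _ (rel j) [set z | f z = 0]) => [|z].
  split=> [|a x y xf yf]; first by rewrite /= linear0.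
  by apply: etrans (linearP f a x y) _; rewrite (xf : f x = 0) (yf : f y = 0) scaler0 addr0.
case=> [[x [y ->]]|[p [x [pf ->]]]] /=.
  by rewrite !linearB /= !fliftU coordD addrAC addrK subrr.
by rewrite linearB linearZ /= !fliftU coord_lp_act // subrr.
Qed.

Lemma tensor_span j n (z : 'I_n -> T j) :
  exists m (c : 'I_m -> S j) (l : 'M[laurent]_(n, m)), forall i, z i = \sum_a l i a *: tens (c a).
Proof.
pose s := undup (flatten [seq dom (repr (z i)) | i <- enum 'I_n]).
exists (size s), (tnth (in_tuple s)), (\matrix_(i, a) coeff (tnth (in_tuple s) a) (repr (z i))) => i.
rewrite -[LHS]quot_reprK; have -> : repr (z i) = \sum_(x <- s) coeff x (repr (z i)) *: << x >>.
  apply/eqP/freeg_eqP => y; rewrite raddf_sum /=.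
  under eq_bigr do rewrite coeffZ coeffU mul1r.
  have [ys|ys] := boolP (y \in s).
    rewrite (bigD1_seq y) ?undup_uniq //= eqxx mulr1 big1 ?addr0 // => x /negbTE ->.
    by rewrite mulr0.
  rewrite big_seq big1 => [|x xs].
    apply/eqP/negPn/negP; rewrite -mem_dom => yd; move/negP: ys; apply; rewrite mem_undup.
    by apply/flattenP; exists (dom (repr (z i))) => //; apply: map_f; rewrite mem_enum.
  by case: eqP => [xy|_]; [move: ys; rewrite -xy xs|rewrite mulr0].
rewrite (big_nth 0) big_mkord linear_sum; apply: eq_bigr => a _.
by rewrite linearZ mxE (tnth_nth 0).
Qed.

(* The coordinates along the simplices occurring in the chains [c] detect relations, and those coordinates are
   Laurent polynomials *)
Lemma tens_relations j m (c : 'I_m -> S j) : exists D (K' : 'M[P]_m), [/\ D != 0,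
  forall i, \sum_a K' i a *: c a = 0 &
  forall n (l : 'M[laurent]_(n, m)), (forall i, \sum_a l i a *: tens (c a) = 0) ->
    polyL D *: l = l *m map_mx polyL K'].
Proof.
pose s := flatten [seq dom (c i) | i <- enum 'I_m]; pose t := tnth (in_tuple s).
have /choice[N NP] : forall x : 'I_m * 'I_(size s), exists N, forall n : nat, (N <= n)%N ->
    exists p, polyL p = polyL 'X^n * coord (t x.2) (c x.1).
  by move=> x; apply/laurent_poly_clear/coord_poly.
pose n := \max_x N x.
have /choice[k kP] : forall x : 'I_m * 'I_(size s), exists p, polyL p = polyL 'X^n * coord (t x.2) (c x.1).
  by move=> x; apply: NP; exact: leq_bigmax.
(* A common power of 'X makes all coordinates polynomials; relations between the [tens (c a)] then
   lie in the left kernel of [M]. *)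
pose M : 'M[P]_(m, size s) := \matrix_(i, a) k (i, a).
have [D [K' [D0 K'M DK']]] := rel_approx M.
have kE i a : polyL (M i a) = polyL 'X^n * coord (t a) (c i) by rewrite mxE kP.
exists D, K'; split=> // [i|q l lc].
  pose u : S j := \sum_a K' i a *: c a.
  have ut a : coord (t a) u = 0.
    have : polyL 'X^n * coord (t a) u = 0.
      have /matrixP/(_ i a)/(congr1 polyL) := K'M; rewrite !mxE rmorph0 rmorph_sum => E.
      rewrite -[RHS]E /u (big_morph (coord (t a)) (coordD (t a)) (id1 := 0)).
        rewrite mulr_sumr; apply: eq_bigr => b _; rewrite rmorphM kE pact_lp coord_lp_act; last exact: laurent_poly_polyL.
        by rewrite mulrCA.
      by apply: laurentP => i'; rewrite coordE coeff0.
    case/laurent_domain => // /polyL_eq0 X0.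
    by have := monic_neq0 (monicXn int n); rewrite X0 eqxx.
  apply/eqP/freeg_eqP => x; rewrite coeff0; apply/eqP/negPn/negP => ux.
  (* [u] is supported on the orbits of the simplices occurring in the chains [c], and along these
     all its coordinates vanish. *)
  pose Q := [set x : singular R K j | exists i' a, x = (cover_shift theta i' \o t a : singular R K j)].
  have sQ : submodule (carried Q : set (S j)).
    apply: pmod_submodule => [|e]; first exact: carried_submodule.
    apply: (carried_map (f := sh 1 j) (Q := carried Q)) => [|y [i' [a ->]]]; first exact: carried_submodule.
    by rewrite chain_mapU; apply: carriedU; exists (1 + i'), a; rewrite shift_comp.
  have : carried Q u.
    apply: (@submodule_sum _ (S j) (carried Q)) => // a _; apply: (submoduleZ _ sQ) => y ya.
    have ys : y \in s by apply/flattenP; exists (dom (c a)); [apply: map_f; rewrite mem_enum|rewrite mem_dom].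
    by have /tnthP[b yb] : y \in in_tuple s by []; exists 0, b; rewrite shift0.
  move=> /(_ x ux)[i' [a xE]]; have := ut a => /(congr1 (lcoef i')); rewrite raddf0 /lcoef coordE -xE.
  by move/eqP; apply/negP.
apply: DK'; apply/matrixP => i a; rewrite !mxE.
transitivity (polyL 'X^n * \sum_b l i b * coord (t a) (c b)); last by rewrite (tens_coord _ (lc i)) mulr0.
by rewrite mulr_sumr; apply: eq_bigr => b _; rewrite mxE kE mulrCA.
Qed.

End Novikov.

(** The coefficient of [u] in a dependence cannot be 0, since otherwise the [y i] would be
    dependent. *)
Lemma dependent_mod (R : nzRingType) (M : lmodType R) (N : set M) b (y : 'I_b -> M) u : submodule N ->
  (forall a : 'I_b -> R, N (\sum_i a i *: y i) -> forall i, a i = 0) ->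
  ~ (forall a : 'I_b.+1 -> R,
       N (\sum_i a i *: (if unlift ord0 i is Some j then y j else u)) -> forall i, a i = 0) ->
  exists d (g : 'I_b -> R), d <> 0 /\ N (d *: u - \sum_i g i *: y i).
Proof.
move=> sN yi /existsNP[a /not_implyP[aN /existsNP[i ai]]].
move: aN; rewrite big_ord_recl unlift_none.
under eq_bigr do rewrite liftK.
move=> aN; exists (a ord0), (fun j => - a (fintype.lift ord0 j)); split.
  move=> a0; apply: ai; case: (unliftP ord0 i) => [j ->|->//].
  by apply: (yi (fun j => a (fintype.lift ord0 j))); move: aN; rewrite a0 scale0r add0r.
rewrite [X in N X](_ : _ = a ord0 *: u + \sum_(i < b) a (fintype.lift ord0 i) *: y i) //.
by congr (_ + _); rewrite -sumrN; apply: eq_bigr => j _; rewrite scaleNr opprK.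
Qed.

Section NovikovRank.
Variables (R : realType) (L : topologicalType) (theta : continuousType L (circle R)) (k : nat).
Local Notation K := (cover theta).
Local Notation S j := (pchain R int (cover_shift theta 1) j).
Local Notation bd j := (Defs.bd R int K j).
Local Notation P := {poly int}.
Local Notation T j := (tensor theta j).
Local Notation dT j := (tensor_bd theta j).

Let pb j : {linear S j -> S j.-1} := pbd R int (cover_shift theta 1) j.

Lemma range_submodule (A : nzRingType) (M M' : lmodType A) (f : {linear M -> M'}) : submodule (range f).
Proof.
split=> [|a _ _ [u _ <-] [v _ <-]]; first by exists 0; rewrite ?linear0.
by exists (a *: u + v); rewrite ?linearP.
Qed.

Lemma tens_sum j n (a : 'I_n -> P) (c : 'I_n -> S j) : tens (\sum_i a i *: c i) = \sum_i polyL (a i) *: tens (c i).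
Proof. by rewrite raddf_sum; apply: eq_bigr => i _; rewrite /= tensZ. Qed.

(** A boundary equal to a combination of the [tens (y i)] is a relation between pure tensors of the
    [y i] and of boundaries [w j]. Up to [D] it combines relations over Z[t], in which the
    coefficients of the [y i] vanish by independence. *)
Lemma novikov_lower b : has_indep [set z : S k | pb k z = 0] (range (pb k.+1)) b ->
  has_indep [set z : T k | dT k z = 0] (range (dT k.+1)) b.
Proof.
move=> [y yc yi]; exists (fun i => tens (y i)) => [i|a [z _ zE]].
  by rewrite /= tens_bd [X in tens X](yc i) raddf0.
have [m [w [mu wE]]] := tensor_span (fun _ : 'I_1 => z).
pose c := gcat y (fun j => pb k.+1 (w j)).
have [D [K' [D0 K'c K'P]]] := tens_relations c.
pose l : 'rV[laurent]_(b + m) := row_mx (\row_i a i) (- mu).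
have /K'P Dl : forall i, \sum_j l i j *: tens (c j) = 0.
  move=> i; rewrite ord1 big_split_ord /=.
  have -> : \sum_(j < b) l 0 (lshift m j) *: tens (c (lshift m j)) = \sum_j a j *: tens (y j).
    by apply: eq_bigr => j _; rewrite row_mxEl mxE /c /gcat (unsplitK (inl j)).
  rewrite -zE (wE 0) linear_sum -big_split; apply: big1 => j _ /=.
  rewrite row_mxEr mxE /c /gcat (unsplitK (inr j)) linearZ /= tens_bd.
  by rewrite scaleNr subrr.
move=> i; have K0 q : K' q (lshift m i) = 0.
  apply: (yi (fun j => K' q (lshift m j))).
  have := K'c q; rewrite big_split_ord /=.
  have -> : \sum_(j < b) K' q (lshift m j) *: c (lshift m j) = \sum_j K' q (lshift m j) *: y j.
    by apply: eq_bigr => j _; rewrite /c /gcat (unsplitK (inl j)).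
  move/eqP; rewrite addr_eq0 => /eqP ->; exists (- \sum_j K' q (rshift b j) *: w j) => //.
  rewrite linearN linear_sum; congr (- _); apply: eq_bigr => j _.
  rewrite /c /gcat (unsplitK (inr j)).
  by have := pbdP (K' q (rshift b j)) (w j) 0; rewrite linear0 !addr0.
have /rowP/(_ (lshift m i)) := Dl; rewrite !mxE (unsplitK (inl i)) mxE big1 => [|q _].
  case/laurent_domain => // /polyL_eq0 D0'; by rewrite D0' eqxx in D0.
by rewrite !mxE K0 rmorph0 mulr0.
Qed.

(** Up to [D], each cycle [z i] is a combination of tensors of honest cycles [u q]. A nonzero
    multiple of each [u q] is a combination of the [b] cycles [y j] modulo boundaries, so [b + 1]
    cycles [z i] must be dependent. *)
Lemma novikov_upper b : rank_mod [set z : S k | pb k z = 0] (range (pb k.+1)) b ->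
  ~ has_indep [set z : T k | dT k z = 0] (range (dT k.+1)) b.+1.
Proof.
move=> [[y yc yi] nind] [z zc zi].
have [m [c [l lE]]] := tensor_span z.
have [D [K' [D0 K'c K'P]]] := tens_relations (fun a => pb k (c a)).
have /K'P Dl : forall i, \sum_a l i a *: tens (pb k (c a)) = 0.
  move=> i; rewrite -[RHS](zc i) (lE i) linear_sum; apply: eq_bigr => a _.
  by rewrite linearZ /= tens_bd.
pose u q : S k := \sum_a K' q a *: c a.
have uc q : pb k (u q) = 0.
  by rewrite -[RHS](K'c q) linear_sum; apply: eq_bigr => a _; rewrite linearZ.
have /choice[d /choice[g dg]] : forall q, exists d (g : 'I_b -> P), d <> 0 /\
    range (pb k.+1) (d *: u q - \sum_i g i *: y i).
  move=> q; apply: dependent_mod => // [|H]; first exact: range_submodule.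
  by apply: nind; exists (fun i => if unlift ord0 i is Some j then y j else u q) => // i; case: unlift.
(* The common multiple [e] of the [d q] lets all the [u q] be expressed by the [y j] at once; [e' q]
   is the complementary factor. *)
pose e := \prod_q d q; pose e' q := \prod_(q' | q' != q) d q'.
have eE q : e = e' q * d q by rewrite /e (bigD1 q) //= mulrC.
have e0 : e <> 0.
  apply/eqP/prodf_neq0 => q _; apply/eqP; exact: (dg q).1.
pose G : 'M[P]_(m, b) := \matrix_(q, i) (e' q * g q i).
pose beta := l *m map_mx polyL G.
have zB i : range (dT k.+1) (polyL (e * D) *: z i - \sum_j beta i j *: tens (y j)).
  have E1 : polyL D *: z i = \sum_q l i q *: tens (u q).
    rewrite (lE i) scaler_sumr.
    transitivity (\sum_a (l *m map_mx polyL K') i a *: tens (c a)).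
      by apply: eq_bigr => a _; rewrite -Dl mxE scalerA.
    under [RHS]eq_bigr do rewrite tens_sum scaler_sumr.
    rewrite exchange_big; apply: eq_bigr => a _; rewrite mxE scaler_suml.
    by apply: eq_bigr => q _; rewrite mxE scalerA.
  have -> : polyL (e * D) *: z i - \sum_j beta i j *: tens (y j) =
      \sum_q (l i q * polyL (e' q)) *: tens (d q *: u q - \sum_j g q j *: y j).
    rewrite rmorphM -scalerA E1 scaler_sumr.
    have -> : \sum_j beta i j *: tens (y j) = \sum_q (l i q * polyL (e' q)) *: tens (\sum_j g q j *: y j).
      under [RHS]eq_bigr do rewrite tens_sum scaler_sumr.
      rewrite exchange_big; apply: eq_bigr => j _; rewrite mxE scaler_suml.
      by apply: eq_bigr => q _; rewrite !mxE rmorphM scalerA mulrA.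
    rewrite -sumrB; apply: eq_bigr => q _; rewrite raddfB /= scalerBr; congr (_ - _).
    by rewrite tensZ !scalerA (eE q) rmorphM; congr (_ *: _); ring.
  apply: (@submodule_sum _ _ (range (dT k.+1))) => [|q _]; first exact: range_submodule.
  apply: submoduleZ; first exact: range_submodule.
  have [w _ <-] := (dg q).2.
  by exists (tens w) => //; rewrite tens_bd.
have [a a0 aB] := left_kernel beta laurent_domain (ltnSn b).
apply: a0; apply/rowP => i; rewrite [RHS]mxE.
have : a 0 i * polyL (e * D) = 0.
  apply: (zi (fun i => a 0 i * polyL (e * D))).
  rewrite [X in range _ X](_ : _ = \sum_i a 0 i *: (polyL (e * D) *: z i - \sum_j beta i j *: tens (y j))).
    apply: (@submodule_sum _ _ (range (dT k.+1))) => [|q _]; first exact: range_submodule.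
    by apply: submoduleZ => //; exact: range_submodule.
  under [RHS]eq_bigr do rewrite scalerBr scalerA.
  rewrite sumrB [X in _ - X](_ : _ = 0) ?subr0 //.
  under eq_bigr do rewrite scaler_sumr.
  rewrite exchange_big big1 // => j _; have /rowP/(_ j) := aB; rewrite !mxE => E.
  by under eq_bigr do rewrite scalerA; rewrite -scaler_suml E scale0r.
by case/laurent_domain => // /polyL_eq0 /eqP; rewrite mulf_eq0 (negbTE D0) orbF => /eqP /e0.
Qed.

Theorem novikov_rank b : rank_mod [set z : S k | bd k z = 0] (range (bd k.+1)) b ->
  is_novikov_betti theta k b.
Proof.
move=> h; apply: homology_rank; split; first by apply: novikov_lower; exact: h.1.
exact: novikov_upper h.
Qed.

End NovikovRank.

Theorem theorem8p3 (R : realType) (n : nat) (L : topologicalType)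
    (atl : set (chart R n L)) (theta : continuousType L (circle R))
    (L_closed_connected : closed_connected_manifold atl)
    (theta_morse : circle_morse atl theta)
    (theta_H1 : range (homology_push R int theta 1) =
                [set: singular_homology R int (circle R) 1])
    (A : R)
    (A_regular : regular_value (pullback_atlas (@cover_proj R L theta) atl)
                               (@cover_height R L theta) A)
    (k : nat) :
  exists b : nat,
    is_novikov_betti theta k b /\ is_pitcher_number theta A k b%:Z.
Proof.
have [haus comp _ atlas] := L_closed_connected.
have [r [g [r' [M gM]]]] := fg_presents (fgH_sublevel atlas theta_morse A_regular haus comp rat k).
exists (r - r')%N; split.
  apply/novikov_rank/(@sublevel_rank _ _ _ (A + 2 * trigo.pi))/rational_rank.
  have := presents_rank gM; rewrite (_ : @bnd R rat _ _ setT k = range (Defs.bd R rat _ k.+1)) //.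
  by apply/seteqP; split=> [_ [w _ ->]|_ [w _ <-]]; exists w.
have [q [s [hq hs _ E]]] := presents_pitcher gM.
by exists q, s; split.
Qed.
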